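(* Let $n\ge2$ and $1\le k\le n-1$ be integers. Let $(M,g)$ be an $n$-dimensional Riemannian manifold endowed with a smooth symmetric $(0,2)$ tensor $W$ such that at every $x\in M$ the decreasingly ordered vector of eigenvalues $\lambda(x)=(\lambda_1(x),\dots,\lambda_n(x))$ of $W_g=g^{-1}\circ W$ lies in $\Gamma_n$. Assume that $W$ satisfies the equation $$F(W_g(x))=\frac{\sigma_n(W_g(x))}{\sigma_{n-k}(W_g(x))}=f(x),\qquad x\in M,$$ and that $W$ satisfies Condition (A) with constant $A$. Then there exist $\epsilon(n,k)>0$ (depending only on $n,k$) and a constant $C=C(n,k,f,A)$ (depending on $n,k,f$ and $A$) such that $b=\log(1+\lambda_1)$ satisfies, in the viscosity sense, $$\sum_{\alpha,\beta=1}^nF^{\alpha\beta}(\lambda(x))\,b_{\alpha\beta}(x)\ \ge\ \epsilon(n,k)\sum_{\alpha,\beta=1}^nF^{\alpha\beta}(\lambda(x))\,b_\alpha(x)b_\beta(x)-C(n,k,f,A)\,\mathcal{F}(x)-\frac{|\nabla f(x)|_g^2}{f(x)(\lambda_1(x)+1)}-\frac{|\nabla^2f(x)|_g}{\lambda_1(x)+1}$$ at any $x\in M$, where $\mathcal{F}(x)=\sum_{\alpha=1}^nF^{\alpha\alpha}(\lambda(x))$.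
   Context: For $\lambda\in\mathbb{R}^n$, $\sigma_m(\lambda)$ is the $m$-th elementary symmetric polynomial; $\sigma_m$ of a symmetric matrix (or self-adjoint endomorphism) is $\sigma_m$ of its eigenvalues. $\Gamma_n=\{\lambda\in\mathbb{R}^n:\sigma_m(\lambda)>0\text{ for all }1\le m\le n\}$, i.e. all entries positive. $W_g:=g^{-1}\circ W:TM\to T^*M\to TM$ is the endomorphism field obtained from $W$ by raising an index with $g$. $\nabla$ is the Levi-Civita connection of $g$; all derivatives are covariant derivatives, and all components are taken with respect to local orthonormal frames: $w_{ij}$ are the components of $W$, $b_\alpha=\nabla_\alpha b$, $b_{\alpha\beta}=\nabla^2_{\alpha\beta}b$. $F^{\alpha\beta}=\frac{\partial F}{\partial w_{\alpha\beta}}$ is the first derivative of $F(W)=\sigma_n(W)/\sigma_{n-k}(W)$ as a function of the symmetric matrix $W=(w_{\alpha\beta})$; $F^{\alpha\beta}(\lambda(x))$ denotes its value at $W_g(x)$ expressed in the frame. Condition (A): the tensor $W$ on $(M,g)$ satisfies Condition (A) if, for a uniform constant $A>0$ independent of $W$, the inequalities $$|\nabla_lw_{ij}(x)-\nabla_iw_{jl}(x)|\le A\,(1+|W(x)|_g),$$ $$|\nabla^2_{lm}w_{ij}(x)-\nabla^2_{ij}w_{lm}(x)|\le A\,\big(1+|W(x)|_g+|\nabla w_{il}(x)|_g+|\nabla w_{jl}(x)|_g+|\nabla w_{im}(x)|_g+|\nabla w_{jm}(x)|_g\big)$$ hold for all indices $i,j,l,m$ in any orthonormal frame and at every point $x\in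 M$. Here $\nabla_lw_{ij}$ and $\nabla^2_{lm}w_{ij}$ are the components of $\nabla W$ and $\nabla^2W$, and $|\nabla w_{il}|_g=\big(\sum_p(\nabla_pw_{il})^2\big)^{1/2}$. Viscosity sense (standard meaning): whenever $x\in M$ and $\varphi$ is a $C^2$ function near $x$ with $\varphi\ge b$ near $x$ and $\varphi(x)=b(x)$, the inequality holds at $x$ with $b_\alpha,b_{\alpha\beta}$ replaced by $\varphi_\alpha,\varphi_{\alpha\beta}$. *)

(* Defs.v *)
From HB Require Import structures.
From mathcomp Require Import all_boot all_order all_algebra.
From mathcomp Require Import all_classical all_reals all_analysis.

Set Implicit Arguments.
Unset Strict Implicit.
Unset Printing Implicit Defensive.

Import Order.TTheory GRing.Theory Num.Theory.
Import numFieldNormedType.Exports.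

Local Open Scope classical_set_scope.
Local Open Scope ring_scope.

Section Calculus.
Variables (R : realType) (n : nat).
Implicit Types (U : set 'rV[R]_n) (h : 'rV[R]_n -> R).

Definition partial (a : 'I_n) h : 'rV[R]_n -> R :=
  fun y => 'D_(delta_mx 0 a) h y.

Definition partials (s : seq 'I_n) h := foldr partial h s.

(* Meant for open U, where continuity and derivability at a point of U only
   involve the values of h on U. *)
Definition C_on (r : nat) U h :=
  forall s : seq 'I_n, (size s <= r)%N ->
    (forall y, U y -> {for y, continuous (partials s h)}) /\
    ((size s < r)%N -> forall (a : 'I_n) y, U y ->
       derivable (partials s h) y (delta_mx 0 a)).

Definition smooth_on U h := forall r, C_on r U h.

End Calculus.

Section Manifold.
Variables (R : realType) (n : nat).

(* A smooth n-manifold without boundary, given by a smooth atlas. Chart i is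
   the homeomorphism coord i : dom i -> coord i @` dom i with inverse param i;
   the values of coord i and param i elsewhere are irrelevant. *)
Record manifold := Manifold {
  space :> topologicalType;
  space_hausdorff : hausdorff_space space;
  space_second_countable : @second_countable space;
  chart : Type;
  dom : chart -> set space;
  coord : chart -> space -> 'rV[R]_n;
  param : chart -> 'rV[R]_n -> space;
  dom_open : forall i, open (dom i);
  coord_open : forall i, open (coord i @` dom i);
  coordK : forall i x, dom i x -> param i (coord i x) = x;
  coord_continuous : forall i x, dom i x -> {for x, continuous (coord i)};
  param_continuous : forall i y, (coord i @` dom i) y ->
    {for y, continuous (param i)};
  dom_cover : forall x, exists i, dom i x;
  transition_smooth : forall i j (a : 'I_n),
    smooth_on (coord i @` (dom i `&` dom j))
      (fun y => coord j (param i y) 0 a) }.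

Variable M : manifold.

(* A smooth symmetric (0,2) tensor, as the matrix of its components in each
   chart, written as a function of the coordinates.  MathComp-Analysis uses row
   vectors, so [jacobian t y] has (a, b) entry d t_b / d y_a. *)
Record sym2_tensor := Sym2Tensor {
  tcomp :> chart M -> 'rV[R]_n -> 'M[R]_n;
  tcomp_sym : forall i x, dom i x -> (tcomp i (coord i x))^T = tcomp i (coord i x);
  tcomp_smooth : forall i a b,
    smooth_on (coord i @` dom i) (fun y => tcomp i y a b);
  tcomp_transition : forall i j x, dom i x -> dom j x ->
    let J := jacobian (fun y => coord j (param i y)) (coord i x) in
    tcomp i (coord i x) = J *m tcomp j (coord j x) *m J^T }.

Record riemannian_metric := RiemannianMetric {
  mtensor :> sym2_tensor;
  metric_pos : forall i x (v : 'rV[R]_n), dom i x -> v != 0 ->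
    0 < (v *m mtensor i (coord i x) *m v^T) 0 0 }.

End Manifold.
Arguments dom {R n m} _.
Arguments coord {R n m} _.
Arguments param {R n m} _.

Section Covariant.
Variables (R : realType) (n : nat).

(* Components, in some coordinates y, of a covariant tensor field: the rank r
   components are the values on index lists of size r. *)
Definition covtensor := seq 'I_n -> 'rV[R]_n -> R.

Definition christoffel (G : 'rV[R]_n -> 'M[R]_n) (c a b : 'I_n) (y : 'rV[R]_n) : R :=
  2^-1 * \sum_d invmx (G y) c d *
    (partial a (fun z => G z b d) y + partial b (fun z => G z a d) y
     - partial d (fun z => G z a b) y).

(* The derivative slot comes first, so (nabla^2 T) on l :: m :: J is the
   component nabla_l (nabla_m T_J) of the second covariant derivative.  The [l]
   in nth and set_nth is an unused default. *)
Definition nabla (G : 'rV[R]_n -> 'M[R]_n) (T : covtensor) : covtensor :=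
  fun I y => if I is l :: J then
      partial l (T J) y
      - \sum_(s < size J) \sum_(c < n)
          christoffel G c l (nth l J s) y * T (set_nth l J s c) y
    else 0.

(* Components of a tensor at a point in the frame e_a = \sum_c E c a d/dy_c. *)
Fixpoint frame_comp (E : 'M[R]_n) (T : seq 'I_n -> R) (I : seq 'I_n) : R :=
  if I is a :: J then \sum_(c < n) E c a * frame_comp E (fun K => T (c :: K)) J
  else T [::].

End Covariant.

Section Geometry.
Variables (R : realType) (n : nat) (M : manifold R n) (g : riemannian_metric M).
Implicit Types (i : chart M) (x : M) (E : 'M[R]_n) (W : sym2_tensor M).

Definition orthonormal_frame i x E := E^T *m g i (coord i x) *m E = 1%:M.

Definition fun_cov i (f : M -> R) : covtensor R n :=
  fun I y => if I is [::] then f (param i y) else 0.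

Definition sym2_cov i W : covtensor R n :=
  fun I y => if I is [:: a; b] then W i y a b else 0.

(* Components at x, in the frame E of chart i, of the r-th covariant
   derivative of T. *)
Definition nabla_comp i x E (r : nat) (T : covtensor R n) (I : seq 'I_n) : R :=
  frame_comp E (fun J => iter r (nabla (g i)) T J (coord i x)) I.

Definition norm_grad i x E (f : M -> R) : R :=
  Num.sqrt (\sum_(a < n) nabla_comp i x E 1 (fun_cov i f) [:: a] ^+ 2).

Definition norm_hess i x E (f : M -> R) : R :=
  Num.sqrt (\sum_(a < n) \sum_(b < n)
    nabla_comp i x E 2 (fun_cov i f) [:: a; b] ^+ 2).

Definition frame_mx i x E W : 'M[R]_n :=
  \matrix_(a, b) nabla_comp i x E 0 (sym2_cov i W) [:: a; b].

Definition norm_sym2 i x E W : R :=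
  Num.sqrt (\sum_(a < n) \sum_(b < n) frame_mx i x E W a b ^+ 2).

Definition norm_grad_comp i x E W (a b : 'I_n) : R :=
  Num.sqrt (\sum_(p < n) nabla_comp i x E 1 (sym2_cov i W) [:: p; a; b] ^+ 2).

Definition condition_A W (A : R) : Prop :=
  forall q x E, dom q x -> orthonormal_frame q x E ->
  let w1 (l i j : 'I_n) := nabla_comp q x E 1 (sym2_cov q W) [:: l; i; j] in
  let w2 (l m i j : 'I_n) := nabla_comp q x E 2 (sym2_cov q W) [:: l; m; i; j] in
  let normW := norm_sym2 q x E W in
  let normDw (i l : 'I_n) := norm_grad_comp q x E W i l in
  (forall i j l : 'I_n, `|w1 l i j - w1 i j l| <= A * (1 + normW)) /\
  (forall i j l m : 'I_n, `|w2 l m i j - w2 i j l m| <=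
     A * (1 + normW + normDw i l + normDw j l + normDw i m + normDw j m)).

(* The endomorphism g^-1 o W at x, as a matrix in the coordinates of chart i. *)
Definition raise_index W i x : 'M[R]_n :=
  invmx (g i (coord i x)) *m W i (coord i x).

Definition C2_touches_above (phi b : M -> R) x : Prop :=
  exists U : set M, [/\ open U, U x,
    forall i, C_on 2 (coord i @` (dom i `&` U)) (fun y => phi (param i y)),
    forall z, U z -> b z <= phi z & phi x = b x].

End Geometry.

Section SymmetricFunctions.
Variables (R : realType) (n : nat).

Definition sigma (m : nat) (l : n.-tuple R) : R :=
  \sum_(S : {set 'I_n} | #|S| == m) \prod_(i in S) tnth l i.

Definition in_Gamma_n (l : n.-tuple R) : Prop :=
  forall m, (1 <= m <= n)%N -> 0 < sigma m l.

Definition is_spectrum (B : 'M[R]_n) (l : n.-tuple R) : Prop :=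
  sorted >=%R l /\ char_poly B = \prod_(a <- l) ('X - a%:P).

(* Meaningful for matrices whose eigenvalues are all real. *)
Definition spectrum (B : 'M[R]_n) : n.-tuple R :=
  xget [tuple of nseq n 0] [set l | is_spectrum B l].

Definition quotientF (k : nat) (B : 'M[R]_n) : R :=
  sigma n (spectrum B) / sigma (n - k) (spectrum B).

(* F is a function on symmetric matrices, so the derivative in w_ab is taken
   along the symmetrised elementary matrix: dF(H) = \sum_(a, b) F^{ab} H a b
   for symmetric H. *)
Definition dF (k : nat) (B : 'M[R]_n) (a b : 'I_n) : R :=
  'D_(2^-1 *: (delta_mx a b + delta_mx b a)) (quotientF k) B.

End SymmetricFunctions.

(* Main.v *)
Require Import Defs.
From HB Require Import structures.
From mathcomp Require Import all_boot all_order all_algebra perm.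
From mathcomp Require Import all_classical all_reals all_analysis.
From mathcomp Require Import zify ring lra.

(** Fix x and a frame E diagonalising W at x.  Everything is read off second-order
expansions at t = 0 along the curves of velocity E_m that are geodesic to second
order, in frames that are parallel to second order and then made orthonormal:
there W becomes a curve of symmetric matrices N(t) with 1-jet the covariant
derivative of W and second coefficient half the second covariant derivative, so
no differentiability of the eigenvalues is needed.

Since log (1 + lambda_1) <= phi, testing N(t) on e_z + t c, with c_p the first-order
perturbation coefficient, bounds nabla^2_mm w_zz + 2 sum_p (nabla_m w_zp)^2 /
(lambda_z - lambda_p) by the Hessian of e^phi (z is an index of the top eigenvalue);
the first-order part determines nabla_m w on the top eigenspace.

With Phi = sigma_k (1/lambda) the equation reads f = 1/Phi.  Phi is Schur-convex, so
f <= 1/Phi (diagonal of N) in any rotating orthonormal frame, with equality at t = 0.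
Comparing second-order terms, in a frame rotating so as to cancel the entries N_zp
to first order, bounds nabla^2_zz f; the term quadratic in nabla W is a variance for
the weights prod_{i in S} 1/lambda_i on k-subsets S, and it beats
F_z (nabla_z w_zz)^2 / lambda_z by a factor 1 + 1/(2kn).  That surplus pays for
eps |nabla b|^2, and Condition (A) exchanges nabla^2_mm w_zz with nabla^2_zz w_mm
and nabla_m w_zz with nabla_z w_zm. *)

Set Implicit Arguments.
Unset Strict Implicit.
Unset Printing Implicit Defensive.

Import Order.TTheory GRing.Theory Num.Theory.
Import numFieldNormedType.Exports.

Local Open Scope classical_set_scope.
Local Open Scope ring_scope.

(** * Second-order expansions *)

Section Jets.
Variable R : realType.
Implicit Types (h u : R -> R) (a b c e t : R).

(** Passing from e^phi to phi costs F_m (nabla_m w_zz)^2 / (1 + lambda_1) in every direction m, and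
    the proof consists in paying for it. For m below the top eigenspace the equation supplies 2 F_m
    (nabla_z w_zm)^2 / (lambda_z - lambda_m); the factor 2 against 1 leaves room for the Codazzi
    error, for |nabla w_zm| in Condition (A) and for eps. For m <> z inside the top eigenspace
    nabla_z w_zm vanishes, so nabla_m w_zz is itself an error term. For m = z a plain Cauchy-Schwarz
    inequality would pay with factor 1 and leave no uniform surplus: this is where the sharper
    variance estimate is indispensable. Hence eps = 1/(4kn), which is below the surplus 1/(2kn) of
    direction z and below the 1/4 tolerated in the other directions.

    The obstacle throughout is that lambda_1 may be multiple. Derivatives of eigenvalues and
    eigenvectors are therefore replaced by one-sided comparisons of expansions that agree at t = 0,
    such comparisons giving equality at first order and an inequality at second order. *)

Definition o_sq h := forall e, 0 < e -> \forall t \near (0 : R), `|h t| <= e * t ^+ 2.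

(** An expansion in Peano's sense: [c] is half a second derivative, and nothing is asked of [h] off
    0 beyond the estimate. The estimate at t = 0 forces h 0 = a. *)
Definition jet h a b c := o_sq (fun t => h t - (a + b * t + c * t ^+ 2)).

Lemma near0_lt e : 0 < e -> \forall t \near (0 : R), `|t| < e.
Proof.
move=> e0; near=> t.
by near: t; apply: cvgr0_norm_lt => //; exact: cvg_id.
Unshelve. all: by end_near. Qed.

Lemma near0W (P : R -> Prop) : (forall t, P t) -> \forall t \near (0 : R), P t.
Proof. by move=> HP; apply: (@filterE _ (nbhs (0 : R))). Qed.

Lemma near0P (P : R -> Prop) : (\forall t \near (0 : R), P t) ->
  exists2 e, 0 < e & forall t, `|t| < e -> P t.
Proof.
move=> /nbhs_ballP [e /= e0 He]; exists e => // t te.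
by apply: He; rewrite /ball /= sub0r normrN.
Qed.

Lemma o_sq0 : o_sq (fun=> 0).
Proof. by move=> e e0; near=> t; rewrite normr0 mulr_ge0 ?sqr_ge0 // ltW.
Unshelve. all: by end_near. Qed.

Lemma o_sq_near h u : (\forall t \near (0 : R), h t = u t) -> o_sq u -> o_sq h.
Proof.
move=> hu ou e e0; near=> t.
have -> : h t = u t by near: t.
by near: t; exact: ou.
Unshelve. all: by end_near. Qed.

Lemma o_sqD h u : o_sq h -> o_sq u -> o_sq (fun t => h t + u t).
Proof.
move=> oh ou e e0; have e20 : 0 < e / 2 by lra.
near=> t; apply: le_trans (ler_normD _ _) _.
have H1 : `|h t| <= e / 2 * t ^+ 2 by near: t; exact: oh.
have H2 : `|u t| <= e / 2 * t ^+ 2 by near: t; exact: ou.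
lra.
Unshelve. all: by end_near. Qed.

Lemma o_sqMl h u B : (\forall t \near (0 : R), `|u t| <= B) -> o_sq h ->
  o_sq (fun t => u t * h t).
Proof.
move=> uB oh e e0.
have B10 : 0 < 1 + `|B| by rewrite ltr_pwDl.
near=> t; rewrite normrM.
have H1 : `|h t| <= e / (1 + `|B|) * t ^+ 2 by near: t; apply: oh; exact: divr_gt0.
have H2 : `|u t| <= 1 + `|B|.
  have : `|u t| <= B by near: t.
  by have := ler_norm B; lra.
apply: le_trans (ler_pM _ _ H2 H1) _ => //.
by rewrite le_eqVlt; apply/orP; left; apply/eqP; field; rewrite gt_eqF.
Unshelve. all: by end_near. Qed.

Lemma o_sqZ h c : o_sq h -> o_sq (fun t => c * h t).
Proof. by move=> oh; apply: (@o_sqMl _ _ `|c|) => //; apply: near0W. Qed.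

Lemma o_sqN h : o_sq h -> o_sq (fun t => - h t).
Proof.
move=> oh; apply: o_sq_near (o_sqZ (-1) oh).
by apply: near0W => t; rewrite mulN1r.
Qed.

Lemma o_sq_cube : o_sq (fun t => t ^+ 3).
Proof.
move=> e e0; near=> t.
have te : `|t| < e by near: t; exact: near0_lt.
rewrite exprS normrM (ger0_norm (sqr_ge0 t)) ler_wpM2r ?sqr_ge0 ?ltW //.
Unshelve. all: by end_near. Qed.

Lemma jet_near h u a b c : (\forall t \near (0 : R), h t = u t) ->
  jet u a b c -> jet h a b c.
Proof.
by move=> hu; apply: o_sq_near; apply: filterS hu => t ->.
Qed.

Lemma jet_ext h u a b c : h =1 u -> jet u a b c -> jet h a b c.
Proof. by move=> hu; apply: jet_near; apply: near0W. Qed.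

Lemma jet_eq h a b c a' b' c' : jet h a b c -> a = a' -> b = b' -> c = c' ->
  jet h a' b' c'.
Proof. by move=> ? <- <- <-. Qed.

Lemma jet_poly a b c : jet (fun t => a + b * t + c * t ^+ 2) a b c.
Proof. by apply: o_sq_near o_sq0; apply: near0W => t; rewrite subrr. Qed.

Lemma jet_cst a : jet (fun=> a) a 0 0.
Proof. by apply: jet_ext (jet_poly a 0 0) => t; rewrite !mul0r !addr0. Qed.

Lemma jetD h u a b c a' b' c' : jet h a b c -> jet u a' b' c' ->
  jet (fun t => h t + u t) (a + a') (b + b') (c + c').
Proof.
move=> jh ju; apply: o_sq_near (o_sqD jh ju); apply: near0W => t; ring.
Qed.

Lemma jetZ h a b c k : jet h a b c -> jet (fun t => k * h t) (k * a) (k * b) (k * c).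
Proof.
by move=> jh; apply: o_sq_near (o_sqZ k jh); apply: near0W => t; ring.
Qed.

Lemma jetN h a b c : jet h a b c -> jet (fun t => - h t) (- a) (- b) (- c).
Proof.
by move=> jh; apply: o_sq_near (o_sqN jh); apply: near0W => t; ring.
Qed.

Lemma jetB h u a b c a' b' c' : jet h a b c -> jet u a' b' c' ->
  jet (fun t => h t - u t) (a - a') (b - b') (c - c').
Proof. by move=> jh /jetN; exact: jetD. Qed.

Lemma jet_sum (I : Type) (r : seq I) (P : pred I) (h : I -> R -> R) (a b c : I -> R) :
  (forall i, P i -> jet (h i) (a i) (b i) (c i)) ->
  jet (fun t => \sum_(i <- r | P i) h i t) (\sum_(i <- r | P i) a i)
    (\sum_(i <- r | P i) b i) (\sum_(i <- r | P i) c i).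
Proof.
move=> jh; elim: r => [|i r IH].
  by rewrite !big_nil; apply: jet_ext (jet_cst 0) => t; rewrite big_nil.
rewrite !big_cons; case: ifPn => Pi.
  by apply: jet_ext (jetD (jh _ Pi) IH) => t; rewrite big_cons Pi.
by apply: jet_ext IH => t; rewrite big_cons (negbTE Pi).
Qed.

Lemma jet_close h a b c e : jet h a b c -> 0 < e ->
  \forall t \near (0 : R), `|h t - a| < e.
Proof.
move=> jh e0.
set B := 1 + `|b| + `|c|.
have B0 : 0 < B by rewrite /B -addrA ltr_pwDl // addr_ge0.
near=> t.
have H1 : `|h t - (a + b * t + c * t ^+ 2)| <= 1 * t ^+ 2.
  by near: t; apply: jh; exact: ltr01.
have te : `|t| < e / B by near: t; apply: near0_lt; exact: divr_gt0.
have t1 : `|t| < 1 by near: t; exact: near0_lt.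
have t2 : t ^+ 2 <= `|t|.
  by rewrite -normr_id -real_normK ?num_real // expr2 normr_id ler_piMr // ltW.
have -> : h t - a = (h t - (a + b * t + c * t ^+ 2)) + (b * t + c * t ^+ 2) by ring.
apply: (@le_lt_trans _ _ (B * `|t|)); last by rewrite mulrC -ltr_pdivlMr.
apply: le_trans (ler_normD _ _) _.
apply: le_trans (lerD H1 (ler_normD _ _)) _.
rewrite (normrM b) (normrM c) (ger0_norm (sqr_ge0 t)).
have := ler_wpM2l (normr_ge0 c) t2; rewrite /B; lra.
Unshelve. all: by end_near. Qed.

Lemma jet_bounded h a b c : jet h a b c -> \forall t \near (0 : R), `|h t| <= 1 + `|a|.
Proof.
move=> jh; near=> t.
have : `|h t - a| < 1 by near: t; exact: jet_close jh ltr01.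
have := ler_normD (h t - a) a; rewrite subrK; lra.
Unshelve. all: by end_near. Qed.

Lemma jet_gt h a b c m : jet h a b c -> m < a -> \forall t \near (0 : R), m < h t.
Proof.
move=> jh ma; near=> t.
have : `|h t - a| < a - m by near: t; apply: jet_close jh _; rewrite subr_gt0.
rewrite ltr_norml; lra.
Unshelve. all: by end_near. Qed.

Lemma jetM h u a b c a' b' c' : jet h a b c -> jet u a' b' c' ->
  jet (fun t => h t * u t) (a * a') (a * b' + b * a') (a * c' + b * b' + c * a').
Proof.
move=> jh ju.
set p := fun t => a + b * t + c * t ^+ 2.
have jp : jet p a b c by exact: jet_poly.
(* With p, q the two Taylor polynomials, h u - p q = (h - p) u + p (u - q), and p q differs from its
   truncation by t^3 times a bounded factor. *)
apply: o_sq_near (o_sqD (o_sqD (o_sqMl (jet_bounded ju) jh) (o_sqMl (jet_bounded jp) ju))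
   (o_sqMl (jet_bounded (jet_poly (b * c' + c * b') (c * c') 0)) o_sq_cube)).
by apply: near0W => t; rewrite /p; ring.
Qed.

Lemma jet_inv h a b c : jet h a b c -> a != 0 ->
  jet (fun t => (h t)^-1) a^-1 (- b / a ^+ 2) (b ^+ 2 / a ^+ 3 - c / a ^+ 2).
Proof.
move=> jh a0.
set p := fun t => a^-1 + (- b / a ^+ 2) * t + (b ^+ 2 / a ^+ 3 - c / a ^+ 2) * t ^+ 2.
have jp : jet p a^-1 (- b / a ^+ 2) (b ^+ 2 / a ^+ 3 - c / a ^+ 2) by exact: jet_poly.
(* The coefficients of [p] are those for which 1 - h p is o(t^2); then h^-1 - p = h^-1 (1 - h p),
   with h^-1 bounded near 0. *)
have := jetB (jet_cst 1) (jetM jh jp).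
have -> : 1 - a * a^-1 = 0 by rewrite divff ?subrr.
have -> : 0 - (a * (- b / a ^+ 2) + b * a^-1) = 0 by field.
have -> : 0 - (a * (b ^+ 2 / a ^+ 3 - c / a ^+ 2) + b * (- b / a ^+ 2) + c * a^-1) = 0.
  by field.
move=> j0.
have a20 : 0 < `|a| / 2 by rewrite divr_gt0 // normr_gt0.
have hb : \forall t \near (0 : R), `|a| / 2 <= `|h t|.
  near=> t.
  have : `|h t - a| < `|a| / 2 by near: t; exact: jet_close jh a20.
  have := ler_normD (h t) (a - h t); rewrite addrC subrK (distrC a); lra.
have ib : \forall t \near (0 : R), `|(h t)^-1| <= (`|a| / 2)^-1.
  near=> t; have H : `|a| / 2 <= `|h t| by near: t.
  by rewrite normfV lef_pV2 // posrE // (lt_le_trans a20).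
apply: o_sq_near (o_sqMl ib j0); near=> t.
have H : `|a| / 2 <= `|h t| by near: t.
have h0 : h t != 0 by rewrite -normr_gt0 (lt_le_trans a20).
by rewrite /p; field; apply/andP.
Unshelve. all: by end_near. Qed.

Lemma jet_at0 h a b c : jet h a b c -> h 0 = a.
Proof.
move=> jh; have /nbhs_singleton := jh _ ltr01.
by rewrite expr0n /= !mulr0 !addr0 normr_le0 subr_eq0 => /eqP.
Qed.

Lemma jet_ge0 h b c : jet h 0 b c -> (\forall t \near (0 : R), 0 <= h t) ->
  b = 0 /\ 0 <= c.
Proof.
move=> jh h0.
have b0 : b = 0.
  apply/eqP; apply: contraT => bn0.
  have nb : 0 < `|b| by rewrite normr_gt0.
  have [d d0 Hd] := near0P (filterI h0 (jh _ ltr01)).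
  set K := 1 + `|c|.
  have K0 : 0 < K by rewrite ltr_pwDl.
  (* At t = - sg b * s the linear term is -|b| s, and [s] is small enough for it to outweigh (1 +
     |c|) s^2. *)
  set s := Num.min (d / 2) (`|b| / (2 * K)).
  have s0 : 0 < s by rewrite lt_min !divr_gt0 // mulr_gt0.
  have sd : s <= d / 2 by rewrite ge_min lexx.
  have sb : s * (2 * K) <= `|b| by rewrite -ler_pdivlMr ?mulr_gt0 // ge_min lexx orbT.
  pose t := - Num.sg b * s.
  have nt : `|t| = s by rewrite normrM normrN normr_sg bn0 mul1r gtr0_norm.
  have [|ht0 ht] := Hd t; first by rewrite nt; lra.
  have t2 : t ^+ 2 = s ^+ 2 by rewrite -[LHS]real_normK ?num_real // nt.
  move: ht; rewrite ler_distl t2 mul1r => /andP[_].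
  have -> : b * t = - (`|b| * s) by rewrite /t normrEsg; ring.
  have cK : c + 1 <= K by rewrite /K addrC lerD2l ler_norm.
  have := ler_wpM2r (sqr_ge0 s) cK.
  have := ler_wpM2l (ltW s0) sb.
  have := mulr_gt0 nb s0.
  nra.
split=> //; rewrite leNgt; apply/negP => c0.
have e0 : 0 < - c / 2 by lra.
have [d /= d0 Hd] := near0P (filterI h0 (jh _ e0)).
have t0 : 0 < d / 2 by lra.
have [|ht0 ht] := Hd (d / 2); first by rewrite gtr0_norm; lra.
move: ht; rewrite ler_distl b0 => /andP[_].
have := mulr_gt0 t0 t0.
nra.
Qed.

(** The second-derivative test at a contact point. Viscosity testing and the bound on F both enter
    through it. *)
Lemma jet_le h u a b c b' c' : jet h a b c -> jet u a b' c' ->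
  (\forall t \near (0 : R), h t <= u t) -> b = b' /\ c <= c'.
Proof.
move=> jh ju hu; have := jetB ju jh; rewrite subrr => /jet_ge0 [].
  by apply: filterS hu => t; rewrite subr_ge0.
by move=> /eqP; rewrite !subr_eq0 subr_ge0 => /eqP ->.
Qed.

Lemma jet_uniq h a b c a' b' c' : jet h a b c -> jet h a' b' c' ->
  [/\ a = a', b = b' & c = c'].
Proof.
move=> jh ju; have e : a = a' by rewrite -(jet_at0 jh) (jet_at0 ju).
move: ju; rewrite -e => ju.
have hh : \forall t \near (0 : R), h t <= h t by exact: near0W.
have [-> c1] := jet_le jh ju hh; have [_ c2] := jet_le ju jh hh.
by split=> //; apply/eqP; rewrite eq_le c1 c2.
Qed.

Lemma jet_comp (G h : R -> R) a b c g0 g1 g2 : jet h a b c ->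
  jet (fun s => G (a + s)) g0 g1 g2 ->
  jet (fun t => G (h t)) g0 (g1 * b) (g1 * c + g2 * b ^+ 2).
Proof.
move=> jh jG.
pose p t := h t - a.
have jp : jet p 0 b c.
  by apply: jet_eq (jetB jh (jet_cst a)) _ _ _; rewrite ?subrr ?subr0.
have jq : jet (fun t => g0 + g1 * p t + g2 * (p t * p t)) g0 (g1 * b)
    (g1 * c + g2 * b ^+ 2).
  apply: jet_eq (jetD (jetD (jet_cst g0) (jetZ g1 jp)) (jetZ g2 (jetM jp jp))) _ _ _;
    ring.
suff os : o_sq (fun t => G (h t) - (g0 + g1 * p t + g2 * (p t * p t))).
  by apply: o_sq_near (o_sqD os jq); apply: near0W => t; ring.
move=> e e0.
set K := (b ^+ 2 + 1).
have K0 : 0 < K by rewrite ltr_wpDl // sqr_ge0.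
have [d /= d0 Hd] := near0P (jG _ (divr_gt0 e0 K0)).
have p2 : \forall t \near (0 : R), p t * p t <= K * t ^+ 2.
  have jb := jet_poly (0 : R) 0 K.
  have jpp : o_sq _ := jetM jp jp.
  have [d1 /= d10 Hd1] := near0P (jpp _ ltr01).
  apply: filterS (near0_lt d10) => t td1.
  have := Hd1 t td1; rewrite ler_distl => /andP[_].
  rewrite /K; nra.
near=> t.
have td : `|p t| < d by near: t; apply: filterS (jet_close jp d0) => t; rewrite subr0.
have := Hd _ td; rewrite (_ : a + p t = h t); last by rewrite /p addrC subrK.
rewrite {2}expr2 => H.
apply: le_trans H _.
have : p t * p t <= K * t ^+ 2 by near: t.
move=> /(ler_wpM2l (ltW (divr_gt0 e0 K0))) /le_trans; apply.
by rewrite mulrA divfK // gt_eqF.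
Unshelve. all: by end_near. Qed.

Lemma mean_value (q q' : R -> R) (d : R) :
  (forall t, `|t| < d -> is_derive t 1 q (q' t)) ->
  forall t, `|t| < d -> exists2 s, `|s| <= `|t| & q t - q 0 = q' s * t.
Proof.
move=> Hq t td.
have cq a b : - d < a -> b < d -> {within `[a, b], continuous q}.
  move=> da bd; apply: derivable_within_continuous => y; rewrite in_itv /= => /andP[ay yb].
  have yd : `|y| < d by rewrite ltr_norml; lra.
  by have [] := Hq _ yd.
have [t0|t0] := leP 0 t.
  have td' : t < d by rewrite -(ger0_norm t0).
  have [y||s] := @MVT_segment R q q' 0 t t0.
  - rewrite in_itv /= => /andP[y0 yt]; apply: Hq; rewrite ltr_norml; lra.
  - by apply: cq; lra.
  rewrite in_itv /= subr0 => /andP[s0 st] E; exists s => //.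
  by rewrite !ger0_norm.
have t0' : t <= 0 by exact: ltW.
have td' : - d < t by move: td; rewrite ltr0_norm; lra.
have [y||s] := @MVT_segment R q q' t 0 t0'.
- rewrite in_itv /= => /andP[y0 yt]; apply: Hq; rewrite ltr_norml; lra.
- by apply: cq; lra.
rewrite in_itv /= => /andP[ts s0] E; exists s.
  by rewrite !ler0_norm //; lra.
lra.
Qed.

Lemma is_derive1P (q : R -> R) (x l : R) : is_derive x 1 q l <->
  (forall e, 0 < e -> \forall t \near (0 : R), `|q (x + t) - q x - l * t| <= e * `|t|).
Proof.
split.
  move=> [dq <-] e e0.
  have : (fun h : R => h^-1 *: (q (h *: 1 + x) - q x)) @ 0^' --> 'D_1 q x by exact: dq.
  move=> /cvgrPdist_le /(_ e e0); rewrite near_withinE; apply: filterS => t Ht.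
  have [->|t0] := eqVneq t 0; first by rewrite addr0 mulr0 subrr subr0 normr0 mulr0.
  have := Ht t0; rewrite distrC /GRing.scale /= mulr1 => H.
  have -> : q (x + t) - q x - 'D_1 q x * t =
     (t^-1 * (q (t + x) - q x) - 'D_1 q x) * t by rewrite (addrC x); field.
  by rewrite normrM ler_wpM2r.
move=> H.
have cv : (fun h : R => h^-1 *: (q (h *: 1 + x) - q x)) @ 0^' --> l.
  apply/cvgrPdist_le => e e0; rewrite near_withinE; apply: filterS (H e e0) => t Ht t0.
  rewrite distrC /GRing.scale /= mulr1.
  have -> : t^-1 * (q (t + x) - q x) - l = (q (x + t) - q x - l * t) / t.
    by rewrite (addrC x); field.
  by rewrite normrM normfV ler_pdivrMr // normr_gt0.
split; first by apply/cvg_ex; exists l.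
exact: cvg_lim cv.
Qed.

(** The remainder has derivative o(t), so the mean value theorem makes it o(t^2); a second
    derivative is involved at 0 only. *)
Lemma jet_taylor (q q' : R -> R) (q2 : R) :
  (\forall t \near (0 : R), is_derive (t : R) 1 q (q' t)) -> is_derive (0 : R) 1 q' q2 ->
  jet q (q 0) (q' 0) (q2 / 2).
Proof.
move=> dq /is_derive1P dq' e e0.
have [d /= d0 Hd] := near0P (filterI dq (dq' _ e0)).
apply: filterS (near0_lt d0) => t td.
pose r t := q t - (q 0 + q' 0 * t + q2 / 2 * t ^+ 2).
pose r' t := q' t - q' 0 - q2 * t.
have dr (s : R) : `|s| < d -> is_derive s 1 r (r' s).
  move=> sd; have [dqs _] := Hd s sd.
  apply: is_derive_eq.
  rewrite /r' /GRing.scale /= !mulr1 add0r mul1r; by field.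
have [s st] := mean_value dr td.
rewrite {2}/r expr0n /= !mulr0 !addr0 subrr subr0 => E.
have -> : q t - (q 0 + q' 0 * t + q2 / 2 * t ^+ 2) = r t by [].
rewrite E normrM.
have [_] := Hd s (le_lt_trans st td); rewrite add0r => H.
have H2 : `|r' s| <= e * `|t| by apply: le_trans H _; rewrite ler_pM2l.
by rewrite -(real_normK (num_real t)) expr2 mulrA ler_wpM2r.
Qed.

Lemma jet_is_derive h a b c : jet h a b c -> is_derive (0 : R) 1 h b.
Proof.
move=> jh; apply/is_derive1P => e e0.
have [d /= d0 Hd] := near0P (jh _ ltr01).
have K0 : 0 < 1 + `|c| by rewrite ltr_pwDl.
near=> t.
have td : `|t| < d by near: t; exact: near0_lt.
have te : `|t| < e / (1 + `|c|) by near: t; apply: near0_lt; exact: divr_gt0.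
have := Hd t td; rewrite add0r (jet_at0 jh) mul1r => H.
have -> : h t - a - b * t = (h t - (a + b * t + c * t ^+ 2)) + c * t ^+ 2 by ring.
apply: le_trans (ler_normD _ _) _; rewrite normrM.
have tt : `|t ^+ 2| = `|t| * `|t| by rewrite expr2 normrM.
rewrite tt.
have t2 : t ^+ 2 = `|t| * `|t| by rewrite -tt ger0_norm // sqr_ge0.
move: H; rewrite t2 => H.
move: te; rewrite ltr_pdivlMr // => te.
have := ler_wpM2r (normr_ge0 t) (ltW te); lra.
Unshelve. all: by end_near. Qed.

Lemma expR_jet a : jet (fun s => expR (a + s)) (expR a) (expR a) (expR a / 2).
Proof.
have H (s : R) : is_derive s 1 (fun s => expR (a + s)) (expR (a + s)).
  apply: (@is_derive_eq _ _ _ (expR \o (fun s => a + s))).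
  by rewrite /GRing.scale /= add0r !mulr1.
apply: jet_eq (jet_taylor (near0W H) (H 0)) _ _ _; by rewrite addr0.
Qed.

Lemma jet_expR h a b c : jet h a b c ->
  jet (fun t => expR (h t)) (expR a) (expR a * b) (expR a * (c + b ^+ 2 / 2)).
Proof.
move=> jh; apply: jet_eq (jet_comp jh (expR_jet a)) _ _ _ => //.
by rewrite mulrDr mulrAC mulrA.
Qed.

(* The product of the inverses of [1 + x_i t + y_i t^2], that is
   [exp (- sum_i log (1 + x_i t + y_i t^2))]. *)
Lemma jet_prod_inv (I : Type) (s : seq I) (P : pred I) (h : I -> R -> R) (l x y : I -> R) :
  (forall i, P i -> 0 < l i) ->
  (forall i, P i -> jet (h i) (l i) (l i * x i) (l i * y i)) ->
  let p := \prod_(i <- s | P i) (l i)^-1 in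
  let sx := \sum_(i <- s | P i) x i in
  jet (fun t => \prod_(i <- s | P i) (h i t)^-1) p (- (p * sx))
    (p * ((sx ^+ 2 + \sum_(i <- s | P i) x i ^+ 2) / 2 - \sum_(i <- s | P i) y i)).
Proof.
move=> l0 jh; elim: s => [|i s IH] p sx.
  rewrite /p /sx !big_nil; apply: jet_eq (jet_ext _ (jet_cst 1)) _ _ _ => //.
  - by move=> t; rewrite big_nil.
  - by rewrite mulr0 oppr0.
  - by rewrite expr0n /= add0r mul0r subrr mulr0.
rewrite /p /sx !big_cons; case: ifPn => Pi; last first.
  by apply: jet_ext IH => t; rewrite big_cons (negbTE Pi).
have ln0 : l i != 0 by rewrite gt_eqF // l0.
apply: jet_eq (jet_ext _ (jetM (jet_inv (jh i Pi) ln0) IH)) _ _ _ => //.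
- by move=> t; rewrite big_cons Pi.
- by field.
- by field.
Qed.

End Jets.

(** * Functions of class C^r on an open set *)

Section SmoothFunctions.
Variables (R : realType) (n : nat) (U : set 'rV[R]_n).
Hypothesis oU : open U.
Implicit Types (h u : 'rV[R]_n -> R) (a : 'I_n) (y : 'rV[R]_n).
Local Notation e_ a := (delta_mx 0 a : 'rV[R]_n).

Lemma near_open y : U y -> \forall z \near y, U z.
Proof. by move=> Uy; exact: open_nbhs_nbhs. Qed.

Lemma partial_eq_on h u a : (forall y, U y -> h y = u y) ->
  forall y, U y -> partial a h y = partial a u y.
Proof.
move=> hu y Uy; apply: near_eq_derive.
by apply: filterS (near_open Uy) => z; exact: hu.
Qed.

Lemma C_on0 h : C_on 0 U h <-> forall y, U y -> {for y, continuous h}.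
Proof.
split=> [H y Uy|H [|//] _]; last by split.
by have [+ _] := H [::] isT; apply.
Qed.

Lemma partials_rcons (s : seq 'I_n) a h : partials (rcons s a) h = partials s (partial a h).
Proof. by rewrite /partials foldr_rcons. Qed.

Lemma C_onS r h : C_on r.+1 U h <->
  [/\ forall y, U y -> {for y, continuous h},
      forall a y, U y -> derivable h y (e_ a) &
      forall a, C_on r U (partial a h)].
Proof.
split=> [H|[cH dH pH] s].
  split=> [y Uy|a y Uy|a s sr].
  - by have [+ _] := H [::] isT; apply.
  - by have [_] := H [::] isT; apply.
  have := H (rcons s a); rewrite size_rcons partials_rcons ltnS => /(_ sr) [c d].
  by split=> // sr'; apply: d.
case/lastP: s => [_|s a]; first by split.
by rewrite size_rcons partials_rcons ltnS; exact: pH.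
Qed.

Lemma C_on_le r q h : (r <= q)%N -> C_on q U h -> C_on r U h.
Proof.
move=> rq H s sr; have [c d] := H s (leq_trans sr rq).
by split=> // sr'; apply: d; exact: leq_trans rq.
Qed.

Lemma C_on_derivable r h a y : C_on r.+1 U h -> U y -> derivable h y (e_ a).
Proof. by move=> /C_onS[_ + _]; exact. Qed.

Lemma C_on_partial r h a : C_on r.+1 U h -> C_on r U (partial a h).
Proof. by move=> /C_onS[]. Qed.

Lemma C_on_pred r h : C_on r.+1 U h -> C_on r U h.
Proof. exact: C_on_le. Qed.

Lemma continuous_eq_on h u : (forall y, U y -> h y = u y) ->
  (forall y, U y -> {for y, continuous h}) -> forall y, U y -> {for y, continuous u}.
Proof.
move=> hu H y Uy; rewrite /prop_for /continuous_at -(hu y Uy).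
apply: cvg_trans (H y Uy); apply: (@near_eq_cvg _ _ (nbhs y)).
by apply: filterS (near_open Uy) => z; exact: hu.
Qed.

Lemma C_on_eq r h u : (forall y, U y -> h y = u y) -> C_on r U h -> C_on r U u.
Proof.
elim: r h u => [|r IH] h u hu.
  by move=> /C_on0 H; apply/C_on0; exact: continuous_eq_on hu H.
move=> /C_onS[cH dH pH]; apply/C_onS; split.
- exact: continuous_eq_on hu cH.
- move=> a y Uy; apply: near_eq_derivable (dH a y Uy).
  by apply: filterS (near_open Uy) => z; exact: hu.
- move=> a; apply: IH (pH a); exact: partial_eq_on.
Qed.

Lemma C_on_cst r c : C_on r U (fun=> c).
Proof.
elim: r c => [|r IH] c; first by apply/C_on0 => y _; exact: cst_continuous.
apply/C_onS; split.
- by move=> y _; exact: cst_continuous.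
- by move=> a y _; exact: derivable_cst.
- move=> a; apply: C_on_eq (IH 0) => y _.
  by rewrite /partial (derive_cst c).
Qed.

Lemma partialD h u a y : derivable h y (e_ a) -> derivable u y (e_ a) ->
  partial a (fun z => h z + u z) y = partial a h y + partial a u y.
Proof. exact: deriveD. Qed.

Lemma partialB h u a y : derivable h y (e_ a) -> derivable u y (e_ a) ->
  partial a (fun z => h z - u z) y = partial a h y - partial a u y.
Proof. exact: deriveB. Qed.

Lemma partialM h u a y : derivable h y (e_ a) -> derivable u y (e_ a) ->
  partial a (fun z => h z * u z) y = h y * partial a u y + u y * partial a h y.
Proof. exact: deriveM. Qed.

Lemma C_onD r h u : C_on r U h -> C_on r U u -> C_on r U (fun y => h y + u y).
Proof.
elim: r h u => [|r IH] h u.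
  move=> /C_on0 H /C_on0 K; apply/C_on0 => y Uy.
  by apply: continuousD; [exact: H|exact: K].
move=> /C_onS[ch dh ph] /C_onS[cu du pu]; apply/C_onS; split.
- by move=> y Uy; apply: continuousD; [exact: ch|exact: cu].
- by move=> a y Uy; apply: derivableD; [exact: dh|exact: du].
- move=> a; apply: C_on_eq (IH _ _ (ph a) (pu a)) => y Uy.
  by rewrite partialD //; [exact: dh|exact: du].
Qed.

Lemma C_onM r h u : C_on r U h -> C_on r U u -> C_on r U (fun y => h y * u y).
Proof.
elim: r h u => [|r IH] h u.
  move=> /C_on0 H /C_on0 K; apply/C_on0 => y Uy.
  by apply: continuousM; [exact: H|exact: K].
move=> Ch Cu; have Ch' := C_on_pred Ch; have Cu' := C_on_pred Cu.
move: Ch Cu => /C_onS[ch dh ph] /C_onS[cu du pu]; apply/C_onS; split.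
- by move=> y Uy; apply: continuousM; [exact: ch|exact: cu].
- by move=> a y Uy; apply: derivableM; [exact: dh|exact: du].
- move=> a; apply: C_on_eq (C_onD (IH _ _ Ch' (pu a)) (IH _ _ Cu' (ph a))) => y Uy.
  by rewrite partialM //; [exact: dh|exact: du].
Qed.

Lemma C_onZ r h c : C_on r U h -> C_on r U (fun y => c * h y).
Proof. by apply: C_onM; exact: C_on_cst. Qed.

Lemma C_onN r h : C_on r U h -> C_on r U (fun y => - h y).
Proof. by move=> /(C_onZ (-1)); apply: C_on_eq => y _; rewrite mulN1r. Qed.

Lemma C_onB r h u : C_on r U h -> C_on r U u -> C_on r U (fun y => h y - u y).
Proof. by move=> Ch /C_onN; exact: C_onD. Qed.

Lemma C_on_sum r (I : Type) (s : seq I) (P : pred I) (h : I -> 'rV[R]_n -> R) :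
  (forall i, P i -> C_on r U (h i)) -> C_on r U (fun y => \sum_(i <- s | P i) h i y).
Proof.
move=> H; elim: s => [|i s IH].
  by apply: (@C_on_eq _ (fun=> 0)) => [y _|]; [rewrite big_nil|exact: C_on_cst].
have [Pi|nPi] := boolP (P i).
  by apply: C_on_eq (C_onD (H i Pi) IH) => y _; rewrite big_cons Pi.
by apply: C_on_eq IH => y _; rewrite big_cons (negbTE nPi).
Qed.

Lemma C_onV r h : (forall y, U y -> h y != 0) -> C_on r U h -> C_on r U (fun y => (h y)^-1).
Proof.
move=> h0; elim: r => [|r IH].
  move=> /C_on0 H; apply/C_on0 => y Uy; apply: continuousV; [exact: h0|exact: H].
move=> Ch; have := IH (C_on_pred Ch) => Cv.
move: Ch => /C_onS[ch dh ph]; apply/C_onS; split.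
- by move=> y Uy; apply: continuousV; [exact: h0|exact: ch].
- by move=> a y Uy; apply: derivableV; [exact: h0|exact: dh].
- move=> a; apply: C_on_eq (C_onN (C_onM (C_onM Cv Cv) (ph a))) => y Uy.
  rewrite /partial deriveV ?h0 //; last exact: dh.
  by rewrite /GRing.scale /= expr2 invfM mulNr.
Qed.

Lemma is_derive_line h (p v : 'rV[R]_n) (t : R) : derivable h (p + t *: v) v ->
  is_derive t 1 (fun s => h (p + s *: v)) ('D_v h (p + t *: v)).
Proof.
set q := fun s => _.
have E : (fun s : R => s^-1 *: ((q \o shift t) (s *: 1) - q t)) =
    (fun s => s^-1 *: ((h \o shift (p + t *: v)) (s *: v) - h (p + t *: v))).
  apply/funext => s; congr (_ *: (h _ - _)).
  by rewrite /= [s%:A]mulr1 scalerDl addrCA.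
by move=> d; split; rewrite /derivable /derive E.
Qed.

Lemma ball_row y (d : R) z : ball y d z <-> 0 < d /\ forall j, `|z 0 j - y 0 j| < d.
Proof.
split=> [[d0 H]|[d0 H]]; split=> //.
  by move=> j; have := H 0 j; rewrite /ball /= distrC.
by move=> i j; rewrite ord1 /ball /= distrC.
Qed.

Lemma C1_expansion h y : C_on 1 U h -> U y -> forall e, 0 < e ->
  exists2 d : R, 0 < d & forall u : 'rV[R]_n, (forall j, `|u 0 j| < d) ->
    `|h (y + u) - h y - \sum_a u 0 a * partial a h y| <= e * \sum_a `|u 0 a|.
Proof.
move=> C1 Uy e e0.
have near_all : \forall z \near y, U z /\ forall a, `|partial a h z - partial a h y| < e.
  apply: filterI; first exact: near_open.
  apply: (@filter_forall _ _ _ (nbhs y)) => a.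
  have /C_on0 /(_ y Uy) := C_on_partial a C1.
  move=> /cvgrPdist_lt /(_ e e0).
  by apply: filterS => z; rewrite distrC.
move/nbhs_ballP : near_all => [d /= d0 Hd]; exists d => // u ud.
pose w m : 'rV[R]_n := \row_j (if (j < m)%N then u 0 j else 0).
have step (m : 'I_n) : exists2 s, `|s| <= `|u 0 m| &
    h (y + w m.+1) - h (y + w m) = partial m h (y + w m + s *: e_ m) * u 0 m.
  have inb t : `|t| < d -> ball y d (y + w m + t *: e_ m).
    move=> td; apply/ball_row; split => // j; rewrite !mxE eqxx /=.
    rewrite -addrA (addrC (y 0 j)) addrK; have [->|jm] := eqVneq j m.
      by rewrite ltnn add0r mulr1.
    by rewrite mulr0 addr0; case: ifP => _; rewrite ?normr0.
  have [t td|s su E] := @mean_value R (fun t => h (y + w m + t *: e_ m))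
     (fun t => partial m h (y + w m + t *: e_ m)) d _ (u 0 m) (ud m).
    apply: is_derive_line; apply: C_on_derivable C1 _.
    by have [] := Hd _ (inb _ td).
  exists s => //; rewrite -E scale0r addr0; congr (h _ - _).
  rewrite -addrA; congr (_ + _); apply/rowP => j; rewrite !mxE eqxx /= ltnS leq_eqVlt.
  have [/val_inj ->|jm] := eqVneq (j : nat) m; first by rewrite ltnn eqxx add0r mulr1.
  have -> : (j == m) = false by apply/negP => /eqP jm'; rewrite jm' eqxx in jm.
  by rewrite mulr0 addr0.
have /choice[s Hs] m : exists s, `|s| <= `|u 0 m| /\
    h (y + w m.+1) - h (y + w m) = partial m h (y + w m + s *: e_ m) * u 0 m.
  by have [s su E] := step m; exists s.
have tele : h (y + u) - h y = \sum_(m < n) (h (y + w m.+1) - h (y + w m)).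
  rewrite -(big_mkord xpredT (fun m => h (y + w m.+1) - h (y + w m))).
  rewrite telescope_sumr //; congr (h _ - h _).
    by congr (_ + _); apply/rowP => j; rewrite mxE ltn_ord.
  by rewrite -[LHS]addr0; congr (_ + _); apply/rowP => j; rewrite !mxE.
rewrite tele -sumrB mulr_sumr; apply: le_trans (ler_norm_sum _ _ _) _.
apply: ler_sum => m _; have [su ->] := Hs m; rewrite mulrC -mulrBr normrM mulrC.
rewrite ler_wpM2r // ltW //.
suff : ball y d (y + w m + s m *: e_ m) by move=> /Hd[_]; apply.
apply/ball_row; split => // j; rewrite !mxE eqxx /=.
rewrite -addrA (addrC (y 0 j)) addrK; have [->|jm] := eqVneq j m.
  by rewrite ltnn add0r mulr1; exact: le_lt_trans su _.
by rewrite mulr0 addr0; case: ifP => _; rewrite ?normr0.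
Qed.

Lemma is_derive_curve h (gam : R -> 'rV[R]_n) (t : R) (v : 'rV[R]_n) :
  C_on 1 U h -> U (gam t) -> (forall j, is_derive t 1 (fun s => gam s 0 j) (v 0 j)) ->
  is_derive t 1 (h \o gam) (\sum_a v 0 a * partial a h (gam t)).
Proof.
move=> C1 Ug dg; apply/is_derive1P => e e0.
(* [K] bounds the increment of [gam] relative to |s| and [L] the gradient of [h], so that each of
   the two errors costs at most e / 2 * |s|. *)
set K := 1 + \sum_a (`|v 0 a| + 1).
have K0 : 0 < K by rewrite ltr_pwDl // sumr_ge0 // => j _; rewrite addr_ge0.
set L := 1 + \sum_a `|partial a h (gam t)|.
have L0 : 0 < L by rewrite ltr_pwDl // sumr_ge0.
have eK : 0 < e / (2 * K) by rewrite divr_gt0 // mulr_gt0.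
have eL : 0 < e / (2 * L) by rewrite divr_gt0 // mulr_gt0.
have [d d0 Hd] := C1_expansion C1 Ug eK.
have n1 : \forall s \near (0 : R), forall j,
    `|gam (t + s) 0 j - gam t 0 j - v 0 j * s| <= e / (2 * L) * `|s|.
  by apply: (@filter_forall _ _ _ (nbhs (0 : R))) => j; have /is_derive1P := dg j; apply.
have n2 : \forall s \near (0 : R), forall j,
    `|gam (t + s) 0 j - gam t 0 j - v 0 j * s| <= 1 * `|s|.
  by apply: (@filter_forall _ _ _ (nbhs (0 : R))) => j; have /is_derive1P := dg j; apply; exact: ltr01.
apply: filterS (filterI (filterI n1 n2) (near0_lt (divr_gt0 d0 K0))) => s [[h1 h2] sd].
set u := gam (t + s) - gam t.
have uj j : `|u 0 j| <= (`|v 0 j| + 1) * `|s|.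
  have := ler_normD (u 0 j - v 0 j * s) (v 0 j * s); rewrite subrK => /le_trans; apply.
  have : `|u 0 j - v 0 j * s| <= 1 * `|s| by rewrite !mxE; exact: h2.
  rewrite normrM; lra.
have Ks : K * `|s| < d by rewrite mulrC -ltr_pdivlMr.
have ud j : `|u 0 j| < d.
  apply: le_lt_trans (uj j) _; apply: le_lt_trans Ks; rewrite ler_wpM2r //.
  rewrite /K (bigD1 j) //= addrCA lerDl.
  by rewrite addr_ge0 // sumr_ge0 // => i _; rewrite addr_ge0.
have := Hd u ud; rewrite (_ : gam t + u = gam (t + s)); last by rewrite addrC subrK.
move=> H.
have -> : (h \o gam) (t + s) - (h \o gam) t - (\sum_a v 0 a * partial a h (gam t)) * s =
  (h (gam (t + s)) - h (gam t) - \sum_a u 0 a * partial a h (gam t)) +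
  \sum_a (u 0 a - v 0 a * s) * partial a h (gam t).
  have -> : \sum_a (u 0 a - v 0 a * s) * partial a h (gam t) =
      \sum_a u 0 a * partial a h (gam t) - (\sum_a v 0 a * partial a h (gam t)) * s.
    by rewrite mulr_suml -sumrB; apply: eq_bigr => a _; ring.
  by rewrite /=; ring.
apply: le_trans (ler_normD _ _) _.
have H1 : e / (2 * K) * \sum_a `|u 0 a| <= e / 2 * `|s|.
  have : \sum_a `|u 0 a| <= K * `|s|.
    apply: (@le_trans _ _ ((\sum_a (`|v 0 a| + 1)) * `|s|)).
      by rewrite mulr_suml; apply: ler_sum => a _.
    by rewrite ler_wpM2r // /K lerDr.
  move=> /(ler_wpM2l (ltW eK)) /le_trans; apply.
  by rewrite le_eqVlt; apply/orP; left; apply/eqP; field; rewrite gt_eqF.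
have H2 : `|\sum_a (u 0 a - v 0 a * s) * partial a h (gam t)| <= e / 2 * `|s|.
  apply: le_trans (ler_norm_sum _ _ _) _.
  apply: (@le_trans _ _ (\sum_a (e / (2 * L) * `|s|) * `|partial a h (gam t)|)).
    apply: ler_sum => a _; rewrite normrM ler_wpM2r //.
    by have := h1 a; rewrite !mxE.
  rewrite -mulr_sumr; set S := \sum_a _.
  have SL : S <= L by rewrite /L lerDr.
  have es : 0 <= e / (2 * L) * `|s| by rewrite mulr_ge0 // ltW.
  apply: le_trans (ler_wpM2l es SL) _.
  by rewrite le_eqVlt; apply/orP; left; apply/eqP; field; rewrite gt_eqF.
lra.
Qed.

Definition quad_curve y (v w : 'rV[R]_n) (t : R) : 'rV[R]_n := y + t *: v + t ^+ 2 *: w.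

Lemma quad_curve0 y (v w : 'rV[R]_n) : quad_curve y v w 0 = y.
Proof. by rewrite /quad_curve expr0n /= !scale0r !addr0. Qed.

Lemma is_derive_quad y (v w : 'rV[R]_n) (t : R) j :
  is_derive t 1 (fun s => quad_curve y v w s 0 j) ((v + (2 * t) *: w) 0 j).
Proof.
have -> : (fun s => quad_curve y v w s 0 j) =
   (fun s => y 0 j + s * v 0 j + s ^+ 2 * w 0 j) by apply/funext => s; rewrite !mxE.
rewrite !mxE.
apply/is_derive1P => e e0.
have K0 : 0 < 1 + `|w 0 j| by rewrite ltr_pwDl.
apply: filterS (near0_lt (divr_gt0 e0 K0)) => s.
rewrite ltr_pdivlMr // => H.
have -> : y 0 j + (t + s) * v 0 j + (t + s) ^+ 2 * w 0 j -
   (y 0 j + t * v 0 j + t ^+ 2 * w 0 j) - (v 0 j + 2 * t * w 0 j) * s = (s * w 0 j) * s by ring.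
rewrite normrM ler_wpM2r // normrM; have := normr_ge0 s; lra.
Qed.

Lemma quad_curve_near y (v w : 'rV[R]_n) : U y -> \forall t \near (0 : R), U (quad_curve y v w t).
Proof.
move=> Uy; have /nbhs_ballP [d /= d0 Hd] := near_open Uy.
have : \forall t \near (0 : R), forall j, `|quad_curve y v w t 0 j - y 0 j| < d.
  apply: (@filter_forall _ _ _ (nbhs (0 : R))) => j.
  have := jet_close (jet_poly (y 0 j) (v 0 j) (w 0 j)) d0.
  apply: filterS => t; rewrite !mxE.
  by rewrite (mulrC t) (mulrC (t ^+ 2)).
by apply: filterS => t H; apply: Hd; apply/ball_row.
Qed.

Lemma jet_quad_curve h y (v w : 'rV[R]_n) : C_on 2 U h -> U y ->
  jet (fun t => h (quad_curve y v w t)) (h y) (\sum_j v 0 j * partial j h y)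
    (\sum_j w 0 j * partial j h y +
     2^-1 * \sum_l \sum_j v 0 l * v 0 j * partial l (partial j h) y).
Proof.
move=> C2 Uy; have C1 := C_on_pred C2.
pose q' t := \sum_j (v + (2 * t) *: w) 0 j * partial j h (quad_curve y v w t).
have dq : \forall t \near (0 : R),
    is_derive (t : R) 1 (fun t => h (quad_curve y v w t)) (q' t).
  apply: filterS (quad_curve_near v w Uy) => t Ut.
  by apply: is_derive_curve C1 Ut _ => j; exact: is_derive_quad.
have U0 : U (quad_curve y v w 0) by rewrite quad_curve0.
have dq' : is_derive (0 : R) 1 q' (\sum_j (2 * w 0 j * partial j h y +
   v 0 j * \sum_l v 0 l * partial l (partial j h) y)).
  have -> : q' = \sum_j (fun t => (v 0 j + t * (2 * w 0 j)) * partial j h (quad_curve y v w t)).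
    apply/funext => t; rewrite /q' fct_sumE; apply: eq_bigr => j _.
    by rewrite !mxE; congr (_ * _); ring.
  apply: is_derive_sum => j.
  have d1 : is_derive (0 : R) 1 (fun t => v 0 j + t * (2 * w 0 j)) (2 * w 0 j).
    apply: jet_is_derive (jet_ext _ (jet_poly (v 0 j) (2 * w 0 j) 0)) => t; ring.
  have d2 : is_derive (0 : R) 1 ((partial j h) \o quad_curve y v w)
      (\sum_l (v + (2 * 0) *: w) 0 l * partial l (partial j h) (quad_curve y v w 0)).
    by apply: is_derive_curve (C_on_partial j C2) U0 _ => l; exact: is_derive_quad.
  apply: is_derive_eq (is_deriveM d1 d2) _.
  rewrite /= quad_curve0 mul0r addr0 mulr0 scale0r addr0 /GRing.scale /= addrC.
  by rewrite mulrC.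
apply: jet_eq (jet_taylor dq dq') _ _ _.
- by rewrite quad_curve0.
- by rewrite /q' quad_curve0 mulr0 scale0r addr0.
rewrite big_split /= mulrDl; congr (_ + _).
  by rewrite mulr_suml; apply: eq_bigr => j _; field.
rewrite mulrC; congr (_ * _); rewrite exchange_big /=; apply: eq_bigr => j _.
by rewrite mulr_sumr; apply: eq_bigr => l _; ring.
Qed.

End SmoothFunctions.

(** * Real symmetric matrices *)

Section CharPoly.
Variables (R : comNzRingType).

Lemma char_poly_conj n (A P Q : 'M[R]_n) : Q *m P = 1%:M ->
  char_poly (Q *m A *m P) = char_poly A.
Proof.
move=> QP; rewrite /char_poly.
have -> : char_poly_mx (Q *m A *m P) =
    map_mx polyC Q *m char_poly_mx A *m map_mx polyC P.
  rewrite /char_poly_mx !map_mxM /= mulmxBr mulmxBl; congr (_ - _).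
  by rewrite mul_mx_scalar -scalemxAl -map_mxM /= QP map_scalar_mx /= scalemx1.
rewrite !det_mulmx mulrAC -det_mulmx -map_mxM /= QP map_scalar_mx /=.
by rewrite det1 mul1r.
Qed.

Lemma char_poly_diag n (d : 'rV[R]_n) :
  char_poly (diag_mx d) = \prod_i ('X - (d 0 i)%:P).
Proof.
rewrite char_poly_trig ?is_diag_mx_is_trig ?diag_mx_is_diag //.
by apply: eq_bigr => i _; rewrite mxE eqxx.
Qed.

End CharPoly.

Section Spectral.
Variable R : realType.

Definition orthogonal_mx n (P : 'M[R]_n) := P^T *m P = 1%:M.

Lemma orthogonal_tr n (P : 'M[R]_n) : orthogonal_mx P -> P *m P^T = 1%:M.
Proof. exact: mulmx1C. Qed.

Lemma orthogonal_mxM n (P Q : 'M[R]_n) : orthogonal_mx P -> orthogonal_mx Q ->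
  orthogonal_mx (P *m Q).
Proof.
by rewrite /orthogonal_mx => hP hQ; rewrite trmx_mul mulmxA -(mulmxA Q^T) hP mulmx1.
Qed.

Lemma orthogonal_col_norm n (P : 'M[R]_n) i : orthogonal_mx P -> \sum_j P j i ^+ 2 = 1.
Proof.
move=> /matrixP /(_ i i); rewrite !mxE eqxx => E; rewrite (_ : 1 = true%:R) // -E.
by apply: eq_bigr => j _; rewrite mxE expr2.
Qed.

Lemma orthogonal_row_norm n (P : 'M[R]_n) i : orthogonal_mx P -> \sum_j P i j ^+ 2 = 1.
Proof.
move=> /orthogonal_tr /matrixP /(_ i i); rewrite !mxE eqxx => E.
rewrite (_ : 1 = true%:R) // -E.
by apply: eq_bigr => j _; rewrite mxE expr2.
Qed.

Lemma orthogonal_le1 n (P : 'M[R]_n) i j : orthogonal_mx P -> `|P i j| <= 1.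
Proof.
move=> /(orthogonal_row_norm i) H.
rewrite -(@expr_le1 _ 2) // real_normK ?num_real // -H (bigD1 j) //= lerDl.
by apply: sumr_ge0 => l _; exact: sqr_ge0.
Qed.

Definition quad_form n (B : 'M[R]_n) (v : 'rV[R]_n) : R := \sum_a \sum_b v 0 a * B a b * v 0 b.

Lemma quad_formE n (B : 'M[R]_n) v : quad_form B v = (v *m B *m v^T) 0 0.
Proof.
rewrite /quad_form mxE exchange_big /=; apply: eq_bigr => b _.
by rewrite !mxE mulr_suml.
Qed.

Lemma quad_form_continuous n (B : 'M[R]_n) : continuous (quad_form B).
Proof.
move=> v; have oT : open [set: 'rV[R]_n] by exact: openT.
suff : C_on 0 [set: 'rV[R]_n] (quad_form B) by move=> /C_on0; apply.
have cc a : C_on 0 [set: 'rV[R]_n] (fun y : 'rV[R]_n => y 0 a).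
  by apply/C_on0 => y _; exact: coord_continuous.
apply: (C_on_sum oT) => a _; apply: (C_on_sum oT) => b _.
by apply: C_onM => //; apply: C_onM => //; exact: C_on_cst.
Qed.

Lemma quad_form1 n (v : 'rV[R]_n) : quad_form 1%:M v = \sum_j v 0 j ^+ 2.
Proof.
apply: eq_bigr => a _; rewrite (bigD1 a) //= mxE eqxx mulr1 big1 ?addr0 //.
by move=> b ba; rewrite mxE eq_sym (negbTE ba) mulr0 mul0r.
Qed.

Lemma quad_formZ n (B : 'M[R]_n) k v : quad_form B (k *: v) = k ^+ 2 * quad_form B v.
Proof.
rewrite /quad_form mulr_sumr; apply: eq_bigr => a _.
by rewrite mulr_sumr; apply: eq_bigr => b _; rewrite !mxE; ring.
Qed.

Lemma quad_form_line n (B : 'M[R]_n) v w (t : R) : B^T = B ->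
  quad_form B (v + t *: w) = quad_form B v + 2 * (v *m B *m w^T) 0 0 * t +
     quad_form B w * t ^+ 2.
Proof.
move=> sB; rewrite !quad_formE linearD linearZ /= !mulmxDl !mulmxDr.
rewrite -!scalemxAl -!scalemxAr.
have -> : (w *m B *m v^T) = (v *m B *m w^T)^T by rewrite !trmx_mul trmxK sB mulmxA.
move: (v *m B *m v^T) (v *m B *m w^T) (w *m B *m w^T) => X Y Z; rewrite !mxE; ring.
Qed.

(** Compactness of the unit sphere gives a maximiser of the quadratic form; at it the nonnegative
    form l |w|^2 - B(w, w) vanishes, hence so does its first variation in every direction, which is
    the eigenvector equation. *)
Lemma symmetric_eigenvector n (B : 'M[R]_n.+1) : B^T = B ->
  exists (v : 'rV[R]_n.+1) (l : R), \sum_j v 0 j ^+ 2 = 1 /\ v *m B = l *: v.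
Proof.
move=> sB.
pose box : set R := `[-1, 1]%classic.
pose A := [set v : 'rV[R]_n.+1 | quad_form 1%:M v = 1].
have A0 : A !=set0.
  exists (delta_mx 0 0); rewrite /A /= quad_form1 (bigD1 0) //= mxE !eqxx expr1n.
  by rewrite big1 ?addr0 // => j j0; rewrite mxE (negbTE j0) andbF expr0n.
have cA : compact A.
  apply: (@subclosed_compact _ _ [set v : 'rV[R]_n.+1 | forall i, box (v ord0 i)]).
  - apply: (@closed_comp _ _ (quad_form 1%:M) [set 1]).
      by move=> v _; exact: quad_form_continuous.
    exact: closed_eq.
  - by apply: (@rV_compact R n.+1 (fun=> box)) => _; exact: segment_compact.
  - move=> v; rewrite /A /= quad_form1 => v1 i; rewrite /box /= in_itv /= -ler_norml.
    rewrite -(@expr_le1 _ 2) // real_normK ?num_real // -v1 (bigD1 i) //= lerDl.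
    by apply: sumr_ge0 => l _; exact: sqr_ge0.
have [v + vmax] := EVT_max_rV A0 cA (continuous_subspaceT (@quad_form_continuous _ B)).
rewrite inE => vA; set l := quad_form B v in vmax.
have bound w : quad_form B w <= l * quad_form 1%:M w.
  have [w0|w0] := eqVneq (quad_form 1%:M w) 0.
    suff -> : w = 0 by rewrite /quad_form !big1 ?mulr0 // => a _; rewrite big1 // => b _; rewrite !mxE !mul0r.
    apply/rowP => j; rewrite mxE; apply/eqP; rewrite -sqrf_eq0 eq_le sqr_ge0 andbT.
    move: w0; rewrite quad_form1 => <-; rewrite (bigD1 j) //= lerDl.
    by apply: sumr_ge0 => i _; exact: sqr_ge0.
  have wp : 0 < quad_form 1%:M w.
    rewrite lt_neqAle eq_sym w0 quad_form1.
    by apply: sumr_ge0 => i _; exact: sqr_ge0.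
  pose k := (Num.sqrt (quad_form 1%:M w))^-1.
  have k2 : k ^+ 2 = (quad_form 1%:M w)^-1 by rewrite exprVn sqr_sqrtr // ltW.
  have : quad_form B (k *: w) <= l.
    by apply: vmax; rewrite inE /A /= quad_formZ k2 mulVf.
  by rewrite quad_formZ k2 mulrC ler_pdivrMr.
exists v, l; split; first by rewrite -quad_form1.
suff H (w : 'rV[R]_n.+1) : ((v *m B - l *: v) *m w^T) 0 0 = 0.
  apply/eqP; rewrite -subr_eq0; apply/eqP/rowP => j; rewrite [RHS]mxE.
  have := H (delta_mx 0 j); rewrite mxE (bigD1 j) //= big1 ?addr0.
    by rewrite 2![X in _ * X]mxE !eqxx mulr1.
  by move=> i ij; rewrite 2![X in _ * X]mxE (negbTE ij) andbF mulr0.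
have s1 : (1%:M : 'M[R]_n.+1)^T = 1%:M by rewrite trmx1.
set beta := 2 * (l * (v *m w^T) 0 0 - (v *m B *m w^T) 0 0).
have jp : jet (fun t => l * quad_form 1%:M (v + t *: w) - quad_form B (v + t *: w))
   0 beta (l * quad_form 1%:M w - quad_form B w).
  apply: jet_ext (jet_poly _ _ _) => t.
  rewrite !quad_form_line // mulmx1 /beta vA /l; ring.
have hb : \forall t \near (0 : R),
    0 <= l * quad_form 1%:M (v + t *: w) - quad_form B (v + t *: w).
  by apply: near0W => t; rewrite subr_ge0; exact: bound.
have [b0 _] := jet_ge0 jp hb.
move: b0; rewrite /beta mulmxBl -scalemxAl => /eqP.
by rewrite mulf_eq0 pnatr_eq0 /= subr_eq0 => /eqP; rewrite !mxE => ->; rewrite subrr.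
Qed.

(** The reflection in the hyperplane orthogonal to e_0 - v exchanges the unit vectors e_0 and v. *)
Lemma householder n (v : 'rV[R]_n.+1) : \sum_j v 0 j ^+ 2 = 1 ->
  exists H : 'M[R]_n.+1, [/\ H^T = H, H *m H = 1%:M & delta_mx 0 0 *m H = v].
Proof.
move=> v1; pose e : 'rV[R]_n.+1 := delta_mx 0 0; pose u := e - v.
(* If v = e_0 then u = 0 and the reflection degenerates to the identity, whatever 2 / 0 is. *)
pose s := (u *m u^T) 0 0; pose c := 2 / s.
have ee : (e *m e^T) 0 0 = 1.
  by rewrite trmx_delta mul_delta_mx mxE !eqxx.
have vv : (v *m v^T) 0 0 = 1.
  by rewrite -v1 mxE; apply: eq_bigr => j _; rewrite mxE expr2.
have ev : (v *m e^T) 0 0 = (e *m v^T) 0 0.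
  by rewrite -[in LHS](trmxK v) -trmx_mul mxE.
have eu : (e *m u^T) 0 0 = s / 2.
  rewrite /s /u linearB /= mulmxBr mulmxBl !mulmxBr.
  have mxB (X Y : 'M[R]_1) : (X - Y) 0 0 = X 0 0 - Y 0 0 by rewrite !mxE.
  by rewrite !mxB ee vv ev; field.
have ss : s = \sum_i u 0 i ^+ 2.
  by rewrite /s mxE; apply: eq_bigr => i _; rewrite [u^T _ _]mxE expr2.
have u0 : s = 0 -> u = 0.
  move=> s0; apply/rowP => j; rewrite [RHS]mxE; apply/eqP.
  rewrite -sqrf_eq0 eq_le sqr_ge0 andbT -s0 ss (bigD1 j) //= lerDl.
  by apply: sumr_ge0 => i _; exact: sqr_ge0.
have uu : u *m u^T = s%:M by rewrite [LHS]mx11_scalar.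
have euv : e - u = v by rewrite /u subKr.
clearbody s; clearbody u.
exists (1%:M - c *: (u^T *m u)); split.
- by rewrite linearB linearZ /= trmx1 trmx_mul trmxK.
- rewrite mulmxBl mul1mx mulmxBr mulmx1 -scalemxAl -scalemxAr mulmxA -(mulmxA u^T) uu.
  rewrite mul_mx_scalar -scalemxAl !scalerA.
  have [s0|s0] := eqVneq s 0; first by rewrite (u0 s0) mulmx0 !scaler0 !subr0.
  rewrite (_ : c * (c * s) = c + c); first by rewrite scalerDl opprB addrK subrK.
  by rewrite /c; field.
- rewrite -/e mulmxBr mulmx1 -scalemxAr mulmxA.
  rewrite (mx11_scalar (e *m u^T)) eu mul_scalar_mx scalerA.
  have [s0|s0] := eqVneq s 0; first by rewrite -euv (u0 s0) scaler0.
  rewrite (_ : c * (s / 2) = 1) ?scale1r // /c; by field.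
Qed.

Lemma block_mx_row0 n (C : 'M[R]_(1 + n)) (l : R) : C^T = C ->
  (forall j, C 0 j = l * (j == 0)%:R) -> C = block_mx (l%:M : 'M[R]_1) 0 0 (drsubmx C).
Proof.
move=> sC C0j; have sCE i j : C i j = C j i by rewrite -[in LHS]sC mxE.
have l0 : lshift n (0 : 'I_1) = 0 by exact: val_inj.
have r0 i : (rshift 1 i : 'I_(1 + n)) == 0 = false by [].
rewrite -[LHS]submxK; congr block_mx; apply/matrixP => i j; rewrite !mxE ?ord1.
- by rewrite l0 C0j eqxx mulr1.
- by rewrite l0 C0j r0 mulr0.
- by rewrite l0 sCE C0j r0 mulr0.
Qed.

(** Deflation: a reflection moves a unit eigenvector to the first basis vector, and symmetry then
    splits off a 1 x 1 block. *)
Lemma real_spectral n (B : 'M[R]_n) : B^T = B ->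
  exists (P : 'M[R]_n) (d : 'rV[R]_n), orthogonal_mx P /\ B = P *m diag_mx d *m P^T.
Proof.
elim: n B => [|n IH] B sB.
  by exists 1%:M, 0; split; [rewrite /orthogonal_mx trmx1 mulmx1|apply/matrixP => -[]].
have [v [l [v1 vB]]] := symmetric_eigenvector sB.
have [H [sH HH eH]] := householder v1.
have vH : v *m H = delta_mx 0 0 by rewrite -eH -mulmxA HH mulmx1.
pose C : 'M[R]_(1 + n) := H *m B *m H.
have sC : C^T = C by rewrite /C !trmx_mul sH sB mulmxA.
have C0 : row 0 C = l *: (delta_mx 0 0 : 'rV_(1 + n)).
  by rewrite /C rowE !mulmxA eH vB -scalemxAl vH.
have C0j j : C 0 j = l * (j == 0)%:R.
  by move/rowP : C0 => /(_ j); rewrite !mxE eqxx.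
have bC := block_mx_row0 sC C0j.
have sD : (drsubmx C)^T = drsubmx C by rewrite -[in RHS]sC trmx_drsub.
have [P' [d' [oP' eD]]] := IH _ sD.
pose K : 'M[R]_(1 + n) := block_mx (1%:M : 'M[R]_1) 0 0 P'.
pose D : 'rV[R]_(1 + n) := row_mx l%:M d'.
have oK : @orthogonal_mx (1 + n) K.
  rewrite /orthogonal_mx tr_block_mx !trmx0 trmx1 mulmx_block !mulmx0 !mul0mx !addr0.
  by rewrite !add0r mulmx1 oP' -scalar_mx_block.
have CK : C = K *m diag_mx D *m K^T.
  rewrite diag_mx_row tr_block_mx !trmx0 trmx1 !mulmx_block.
  rewrite !(mulmx0, mul0mx, addr0, add0r) -eD mul1mx mulmx1 (_ : diag_mx l%:M = l%:M) //.
  by apply/matrixP => i j; rewrite !mxE !ord1.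
exists (H *m K), D; split; first by apply: orthogonal_mxM => //; rewrite /orthogonal_mx sH.
rewrite trmx_mul sH mulmxA -(mulmxA H) -(mulmxA H) -CK.
by rewrite /C !mulmxA HH mul1mx -mulmxA HH mulmx1.
Qed.

Lemma sqrt_inv_bound (d : R) : 2^-1 <= d ->
  `|(Num.sqrt d)^-1 - 1| <= 2 * `|d - 1| /\ (Num.sqrt d)^-1 ^+ 2 * d = 1.
Proof.
move=> d2; have d0 : 0 < d by lra.
set r := (Num.sqrt d)^-1.
have r0 : 0 < r by rewrite invr_gt0 sqrtr_gt0.
have r2 : r ^+ 2 * d = 1 by rewrite exprVn sqr_sqrtr ?mulVf ?gt_eqF // ltW.
split=> //.
have E : (r - 1) * ((r + 1) * d) = 1 - d by rewrite -[X in X - d]r2; ring.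
have n1 : `|r - 1| * ((r + 1) * d) = `|d - 1|.
  rewrite (distrC d) -E normrM [X in _ = _ * X]gtr0_norm //.
  by rewrite mulr_gt0 // addr_gt0.
have := normr_ge0 (r - 1); have := mulr_gt0 r0 d0; nra.
Qed.

Lemma diag_conjE m n (P : 'M[R]_(m, n)) (d : 'rV[R]_n) i j :
  (P *m diag_mx d *m P^T) i j = \sum_k P i k * d 0 k * P j k.
Proof.
rewrite mxE; apply: eq_bigr => k _; rewrite mul_mx_diag !mxE; ring.
Qed.

(** [K] is the inverse square root of [G], computed in an eigenbasis. The explicit bound, linear in
    the distance [S] from [G] to the identity, turns o(t^2) for [G] into o(t^2) for [K]. *)
Lemma orthonormalise n (G : 'M[R]_n) (S : R) : G^T = G ->
  \sum_a \sum_b `|G a b - (a == b)%:R| <= S -> S <= 2^-1 ->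
  exists K : 'M[R]_n, K^T *m G *m K = 1%:M /\
    forall i j, `|K i j - (i == j)%:R| <= n%:R * (2 * S).
Proof.
move=> sG GS S2; have [P [d [oP eG]]] := real_spectral sG.
have oP' := orthogonal_tr oP.
have dE i : d 0 i - 1 = \sum_a \sum_b P a i * (G a b - (a == b)%:R) * P b i.
  have D1 : P^T *m (G - 1%:M) *m P = diag_mx d - 1%:M.
    by rewrite mulmxBr mulmx1 mulmxBl oP eG !mulmxA oP mul1mx -mulmxA oP mulmx1.
  have /matrixP /(_ i i) := D1; rewrite [X in _ = X]mxE [X in _ = X + _]mxE.
  rewrite [X in _ = _ + X]mxE [X in _ = _ - X]mxE eqxx !mulr1n => <-.
  rewrite mxE exchange_big /=; apply: eq_bigr => b _; rewrite mxE mulr_suml.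
  by apply: eq_bigr => a _; rewrite !mxE.
have dS i : `|d 0 i - 1| <= S.
  apply: le_trans GS; rewrite dE; apply: le_trans (ler_norm_sum _ _ _) _.
  apply: ler_sum => a _; apply: le_trans (ler_norm_sum _ _ _) _; apply: ler_sum => b _.
  rewrite !normrM -[X in _ <= X]mul1r -[X in _ <= X]mulr1.
  by rewrite !ler_pM ?mulr_ge0 ?orthogonal_le1.
have d2 i : 2^-1 <= d 0 i by have := dS i; rewrite ler_norml; lra.
pose r : 'rV[R]_n := \row_i (Num.sqrt (d 0 i))^-1.
exists (P *m diag_mx r *m P^T); split.
  rewrite !trmx_mul trmxK tr_diag_mx eG !mulmxA -(mulmxA _ P^T) oP mulmx1.
  rewrite -(mulmxA _ P^T P) oP mulmx1 -(mulmxA P) mulmx_diag -(mulmxA P) mulmx_diag.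
  rewrite (_ : (\row__ _) = const_mx 1) ?diag_const_mx ?mulmx1 //.
  apply/rowP => i; rewrite !mxE.
  by have [_ <-] := sqrt_inv_bound (d2 i); rewrite expr2; ring.
move=> i j; rewrite diag_conjE.
have -> : (i == j)%:R = \sum_m P i m * 1 * P j m.
  have /matrixP /(_ i j) := oP'; rewrite [X in _ = X]mxE => <-.
  by rewrite mxE; apply: eq_bigr => m _; rewrite mxE mulr1.
rewrite -sumrB; apply: le_trans (ler_norm_sum _ _ _) _.
apply: (@le_trans _ _ (\sum_(m < n) 2 * S)); last first.
  by rewrite [X in _ <= X]mulr_natl sumr_const card_ord.
apply: ler_sum => m _; rewrite -mulrBl -mulrBr !normrM mxE.
have [H _] := sqrt_inv_bound (d2 m).
rewrite -[X in _ <= X]mul1r -[X in _ <= X]mulr1.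
rewrite !ler_pM ?mulr_ge0 ?orthogonal_le1 //.
by apply: le_trans H _; rewrite ler_pM2l.
Qed.

(** * Second-order expansions of matrix-valued curves *)

Definition mjet m p (M : R -> 'M[R]_(m, p)) (A B C : 'M[R]_(m, p)) :=
  forall i j, jet (fun t => M t i j) (A i j) (B i j) (C i j).

Lemma mjetM m p q (M : R -> 'M[R]_(m, p)) (N : R -> 'M[R]_(p, q)) A B C A' B' C' :
  mjet M A B C -> mjet N A' B' C' ->
  mjet (fun t => M t *m N t) (A *m A') (A *m B' + B *m A') (A *m C' + B *m B' + C *m A').
Proof.
move=> jM jN i j.
have H := @jet_sum R 'I_p (index_enum _) xpredT (fun l t => M t i l * N t l j) _ _ _
  (fun l _ => jetM (jM i l) (jN l j)).
apply: jet_eq (jet_ext _ H) _ _ _.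
- by move=> t; rewrite mxE.
- by rewrite mxE.
- by rewrite !mxE -big_split.
- by rewrite !mxE -!big_split.
Qed.

Lemma mjetT m p (M : R -> 'M[R]_(m, p)) A B C :
  mjet M A B C -> mjet (fun t => (M t)^T) A^T B^T C^T.
Proof. by move=> jM i j; rewrite !mxE; apply: jet_ext (jM j i) => t; rewrite mxE. Qed.

Lemma mjet_eq m p (M : R -> 'M[R]_(m, p)) A B C A' B' C' : mjet M A B C ->
  A = A' -> B = B' -> C = C' -> mjet M A' B' C'.
Proof. by move=> jM <- <- <-. Qed.

Lemma mjet_poly m p (A B C : 'M[R]_(m, p)) :
  mjet (fun t => A + t *: B + t ^+ 2 *: C) A B C.
Proof.
move=> i j; apply: jet_ext (jet_poly _ _ _) => t.
by rewrite !mxE (mulrC (B i j)) (mulrC (C i j)).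
Qed.

Lemma mjet_conj m p (M : R -> 'M[R]_m) (K : R -> 'M[R]_(m, p)) A B C A' B' C' :
  mjet K A B C -> mjet M A' B' C' ->
  mjet (fun t => (K t)^T *m M t *m K t) (A^T *m A' *m A)
   (A^T *m A' *m B + (A^T *m B' + B^T *m A') *m A)
   (A^T *m A' *m C + (A^T *m B' + B^T *m A') *m B + (A^T *m C' + B^T *m B' + C^T *m A') *m A).
Proof. by move=> jK jM; apply: mjetM (mjetM (mjetT jK) jM) jK. Qed.

(** A frame orthonormal up to o(t^2) becomes exactly orthonormal without change of any 2-jet.
    Exactness matters because spectra are compared at t <> 0. *)
Lemma mjet_orthonormalise n (G : R -> 'M[R]_n) :
  (\forall t \near (0 : R), (G t)^T = G t) -> mjet G 1%:M 0 0 ->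
  exists K : R -> 'M[R]_n, mjet K 1%:M 0 0 /\
    \forall t \near (0 : R), (K t)^T *m G t *m K t = 1%:M.
Proof.
move=> sG jG.
pose S t := \sum_a \sum_b `|G t a b - (a == b)%:R|.
have oab a b : o_sq (fun t => `|G t a b - (a == b)%:R|).
  move=> e e0; have := jG a b _ e0; apply: filterS => t.
  by rewrite !mxE !mul0r !addr0 normr_id.
have oS : o_sq S.
  have osum (I : Type) (s : seq I) (h : I -> R -> R) : (forall i, o_sq (h i)) ->
      o_sq (fun t => \sum_(i <- s) h i t).
    move=> oh; elim: s => [|i s IH].
      by apply: o_sq_near (@o_sq0 R); apply: near0W => t; rewrite big_nil.
    by apply: o_sq_near (o_sqD (oh i) IH); apply: near0W => t; rewrite big_cons.
  by apply: (osum _ _ _ _) => a; apply: (osum _ _ _ _) => b.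
have S0 t : 0 <= S t by do 2 (apply: sumr_ge0 => ? _).
(* Where [G t] is not symmetric or is far from the identity any matrix will do, since all claims are
   local at 0. *)
have /choice[K HK] t : exists K : 'M[R]_n, (G t)^T = G t -> S t <= 2^-1 ->
    K^T *m G t *m K = 1%:M /\ forall i j, `|K i j - (i == j)%:R| <= n%:R * (2 * S t).
  have [sGt|] := pselect ((G t)^T = G t); last by exists 0.
  have [St|] := pselect (S t <= 2^-1); last by exists 0.
  by have [K HK] := orthonormalise sGt (lexx _) St; exists K.
have S2 : \forall t \near (0 : R), S t <= 2^-1.
  apply: filterS (filterI (oS _ ltr01) (near0_lt (_ : 0 < 2^-1 :> R))) => // t [H1 H2].
  rewrite (ger0_norm (S0 t)) in H1.
  have : t ^+ 2 <= `|t|.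
    by rewrite -(real_normK (num_real t)) expr2 ler_piMr //; lra.
  lra.
exists K; split; last first.
  by apply: filterS (filterI sG S2) => t [sGt St]; have [] := HK t sGt St.
move=> i j; rewrite !mxE => e e0.
have n0 : 0 < 1 + 2 * n%:R :> R by rewrite ltr_pwDl // mulr_ge0.
apply: filterS (filterI (filterI sG S2) (oS _ (divr_gt0 e0 n0))) => t [[sGt St] H].
have [_ /(_ i j)] := HK t sGt St.
rewrite !mul0r !addr0 => /le_trans; apply.
rewrite (ger0_norm (S0 t)) in H.
apply: (@le_trans _ _ ((1 + 2 * n%:R) * S t)); first by have := S0 t; lra.
move: (ler_wpM2l (ltW n0) H) => /le_trans; apply.
by rewrite mulrA (mulrC _ (e / _)) divfK // gt_eqF.
Qed.

End Spectral.

(** * Spectra and the quotient of elementary symmetric functions *)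

Section CharPolyCoef.
Variables (R : realType) (T : Type) (cls : (T -> R) -> Prop).
Hypothesis cls_cst : forall c, cls (fun=> c).
Hypothesis clsD : forall h u, cls h -> cls u -> cls (fun t => h t + u t).
Hypothesis clsM : forall h u, cls h -> cls u -> cls (fun t => h t * u t).

Lemma cls_sum (I : Type) (s : seq I) (P : pred I) (h : I -> T -> R) :
  (forall i, cls (h i)) -> cls (fun t => \sum_(i <- s | P i) h i t).
Proof.
move=> H; elim: s => [|i s IH].
  by rewrite (_ : (fun _ => _) = fun=> 0); [exact: cls_cst|apply/funext => t; rewrite big_nil].
rewrite (_ : (fun _ => _) = fun t => (if P i then h i t else 0) + \sum_(j <- s | P j) h j t).
  by apply: clsD => //; case: (P i).
by apply/funext => t; rewrite big_cons; case: ifP; rewrite ?add0r.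
Qed.

Let pcls (p : T -> {poly R}) := forall m, cls (fun t => (p t)`_m).

Let pcls_cst p : pcls (fun=> p).
Proof. by move=> m; exact: cls_cst. Qed.

Let pclsD p q : pcls p -> pcls q -> pcls (fun t => p t + q t).
Proof.
move=> hp hq m; rewrite (_ : (fun _ => _) = fun t => (p t)`_m + (q t)`_m); first exact: clsD.
by apply/funext => t; rewrite coefD.
Qed.

Let pclsM p q : pcls p -> pcls q -> pcls (fun t => p t * q t).
Proof.
move=> hp hq m.
rewrite (_ : (fun _ => _) = fun t => \sum_(j < m.+1) (p t)`_j * (q t)`_(m - j)).
  by apply: cls_sum => j; exact: clsM.
by apply/funext => t; rewrite coefM.
Qed.

(** The coefficients are polynomials in the entries. The class [cls] is abstract because the lemma
    serves both for functions having a 2-jet and for functions of class C^r. *)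
Lemma cls_char_poly n (M : T -> 'M[R]_n) m : (forall i j, cls (fun t => M t i j)) ->
  cls (fun t => (char_poly (M t))`_m).
Proof.
move=> hM; move: m; rewrite -/(pcls (fun t => char_poly (M t))) /char_poly /determinant.
have pentry i j : pcls (fun t => char_poly_mx (M t) i j).
  move=> m; rewrite (_ : (fun _ => _) = fun t =>
      (('X : {poly R}) *+ (i == j))`_m + (-1) * (if m == 0 then M t i j else 0)).
    apply: clsD => //; apply: clsM => //; case: (m == 0) => //; exact: hM.
  by apply/funext => t; rewrite !mxE coefB coefC mulN1r.
have pprod (s : 'S_n) : pcls (fun t => \prod_i char_poly_mx (M t) i (s i)).
  elim: (index_enum _) => [|i r IH].
    rewrite (_ : (fun _ => _) = fun=> 1); first exact: pcls_cst.
    by apply/funext => t; rewrite big_nil.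
  rewrite (_ : (fun _ => _) = fun t => char_poly_mx (M t) i (s i) *
     \prod_(j <- r) char_poly_mx (M t) j (s j)); first exact: pclsM.
  by apply/funext => t; rewrite big_cons.
elim: (index_enum _) => [|s r IH].
  rewrite (_ : (fun _ => _) = fun=> 0); first exact: pcls_cst.
  by apply/funext => t; rewrite big_nil.
rewrite (_ : (fun _ => _) = fun t => ((-1) ^+ s * \prod_i char_poly_mx (M t) i (s i)) +
   \sum_(s <- r) (-1) ^+ s * \prod_i char_poly_mx (M t) i (s i)).
  by apply: pclsD => //; exact: pclsM.
by apply/funext => t; rewrite big_cons.
Qed.

End CharPolyCoef.

Section Spectrum.
Variable R : realType.

Lemma signr_addB (n k : nat) : (k <= n)%N -> (-1) ^+ (n + (n - k)) = (-1) ^+ k :> R.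
Proof.
move=> kn; have -> : (n + (n - k) = k + 2 * (n - k))%N by lia.
by rewrite exprD exprM sqrrN !expr1n mulr1.
Qed.

Lemma coef_prod_sigma n (l : n.-tuple R) m : (m <= n)%N ->
  (\prod_(a <- l) ('X - a%:P))`_(n - m) = (-1) ^+ m * sigma m l.
Proof.
case: l => s sz; have e := eqP sz; subst n => mn.
rewrite coef_prod_XsubC ?leq_subr // subKn //; congr (_ * _).
by apply: eq_bigr => S _; apply: eq_bigr => i _; rewrite (tnth_nth 0).
Qed.

Lemma sigma_char_poly n (B : 'M[R]_n) l m : (m <= n)%N -> is_spectrum B l ->
  sigma m l = (-1) ^+ m * (char_poly B)`_(n - m).
Proof. by move=> mn [_ ->]; rewrite coef_prod_sigma // mulrA -expr2 sqrr_sign mul1r. Qed.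

Lemma is_spectrum_perm n (B C : 'M[R]_n) l l' : char_poly B = char_poly C ->
  is_spectrum B l -> is_spectrum C l' -> l = l'.
Proof.
move=> BC [sl el] [sl' el']; apply/val_inj/(sorted_eq ge_trans ge_anti sl sl').
by apply: prod_XsubC_eq; rewrite -el -el'.
Qed.

Lemma spectrumE n (B : 'M[R]_n) l : is_spectrum B l -> spectrum B = l.
Proof.
move=> sB; apply: is_spectrum_perm (erefl _) _ (sB).
by rewrite /spectrum; apply: (@xgetI _ _ [set l | is_spectrum B l] l).
Qed.

Lemma is_spectrum_conj n (B C : 'M[R]_n) l : char_poly B = char_poly C ->
  is_spectrum B l -> is_spectrum C l.
Proof. by rewrite /is_spectrum => ->. Qed.

Lemma quotientF_spectrum n k (B : 'M[R]_n) l : is_spectrum B l ->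
  quotientF k B = sigma n l / sigma (n - k) l.
Proof. by move=> /spectrumE; rewrite /quotientF => ->. Qed.

(** This form shows that F is rational in the entries of the matrix, hence regular although the
    eigenvalues need not be. The sign is (-1)^n / (-1)^(n-k). *)
Lemma is_spectrum_conjP n (B : 'M[R]_n) l : is_spectrum B l -> forall k,
  (k <= n)%N -> quotientF k B = (-1) ^+ k * (char_poly B)`_0 / (char_poly B)`_k.
Proof.
move=> sB k kn; rewrite (quotientF_spectrum _ sB).
rewrite !(sigma_char_poly _ sB) ?leq_subr // subnn subKn //.
rewrite invfM mulrACA -exprVn invrN1 -exprD.
by rewrite signr_addB // mulrA.
Qed.

Lemma sym_is_spectrum n (B : 'M[R]_n) : B^T = B -> exists l, is_spectrum B l.
Proof.
move=> sB; have [P [d [oP eB]]] := real_spectral sB.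
exists [tuple of sort >=%R [tuple d 0 i | i < n]]; split.
  by apply: sort_sorted; move=> x y; exact: ge_total.
rewrite eB char_poly_conj ?orthogonal_tr // char_poly_diag.
rewrite (perm_big _ (permEl (perm_sort _ _))) /= big_map enumT /=.
by [].
Qed.

(** The spectral theorem lists the eigenvalues in an arbitrary order; equality of the characteristic
    polynomials yields a permutation of the columns that matches the order of [l]. *)
Lemma sym_spectral_decomposition n (B : 'M[R]_n) l : B^T = B -> is_spectrum B l ->
  exists P, orthogonal_mx P /\ forall a b, B a b = \sum_i P a i * tnth l i * P b i.
Proof.
move=> sB [_ el]; have [Q [d [oQ eB]]] := real_spectral sB.
have pe : perm_eq l [tuple d 0 i | i < n].
  apply: prod_XsubC_eq; rewrite -el eB char_poly_conj ?orthogonal_tr // char_poly_diag.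
  by rewrite /= big_map enumT.
have /tuple_permP[s es] := pe.
have ls i : tnth l i = d 0 (s i).
  have -> : l = [tuple tnth [tuple d 0 i | i < n] (s i) | i < n] by exact: val_inj.
  by rewrite !tnth_mktuple.
exists (\matrix_(a, i) Q a (s i)); split.
  apply/matrixP => i j; rewrite !mxE.
  have /matrixP /(_ (s i) (s j)) := oQ; rewrite !mxE (inj_eq perm_inj) => <-.
  by apply: eq_bigr => a _; rewrite !mxE.
move=> a b; rewrite eB diag_conjE (reindex_inj (@perm_inj _ s)) /=.
by apply: eq_bigr => i _; rewrite !mxE ls.
Qed.

Definition Phi n k (l : 'I_n -> R) : R := \sum_(S : {set 'I_n} | #|S| == k) \prod_(i in S) (l i)^-1.

Lemma sigma_all n (l : n.-tuple R) : sigma n l = \prod_i tnth l i.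
Proof.
rewrite /sigma (bigD1 [set: 'I_n]%SET) ?finset.cardsT ?card_ord //=.
rewrite [X in _ + X]big1 ?addr0; first by apply: eq_bigl => i; rewrite inE.
move=> S /andP[/eqP cS] /eqP []; apply/eqP; rewrite finset.eqEcard finset.subsetT finset.cardsT card_ord.
by rewrite cS leqnn.
Qed.

(** Complementation of subsets: the product of [l] over the complement of S is the full product
    times the inverses over S. *)
Lemma sigma_compl n k (l : n.-tuple R) : (k <= n)%N -> (forall i, tnth l i != 0) ->
  sigma (n - k) l = sigma n l * Phi k (tnth l).
Proof.
move=> kn l0; rewrite sigma_all /Phi mulr_sumr /sigma.
rewrite (reindex_inj (inv_inj (@finset.setCK _))) /=.
apply: eq_big => [S|S _].
  have H : (#|S| <= n)%N by rewrite -[X in (_ <= X)%N]card_ord max_card.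
  have H2 : (#|S| + #|~: S|%SET = n)%N by rewrite finset.cardsC card_ord.
  by move: H H2; move: #|S| #|~: S|%SET => u v H H2; apply/eqP/eqP => E; lia.
rewrite [X in _ = X * _](bigID (mem S)) /= [RHS]mulrC mulrA.
rewrite -big_split /= [X in _ = X * _]big1 ?mul1r.
  by apply: eq_bigl => i; rewrite inE.
by move=> i _; rewrite mulVf.
Qed.

(** Up to sign, prod (X - l_i) takes at [a] the value sum_j sigma_(n-j) (-a)^j. If a <= 0 all terms
    are nonnegative and the one for j = 0 is sigma_n > 0, so [a] cannot be a root. *)
Lemma Gamma_pos n (l : n.-tuple R) : in_Gamma_n l -> forall i, 0 < tnth l i.
Proof.
move=> Gl i; rewrite ltNge; apply/negP => a0; set a := tnth l i in a0.
have n0 : (0 < n)%N by exact: leq_ltn_trans (leq0n i) (ltn_ord i).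
set p := \prod_(a <- l) ('X - a%:P).
have pa : p.[a] = 0.
  by apply/eqP; rewrite -/(root p a) root_prod_XsubC; exact: mem_tnth.
have sp : size p = n.+1 by rewrite /p size_prod_XsubC size_tuple.
have : (-1) ^+ n * p.[a] = \sum_(j < n.+1) sigma (n - j) l * (- a) ^+ j.
  rewrite horner_coef sp mulr_sumr; apply: eq_bigr => j _.
  have jn : (j <= n)%N by rewrite -ltnS.
  have -> : p`_j = p`_(n - (n - j)) by rewrite subKn.
  rewrite /p coef_prod_sigma ?leq_subr // (exprNn a) !mulrA -exprD; congr (_ * _).
  by rewrite mulrC signr_addB.
rewrite pa mulr0 => E.
suff : 0 < \sum_(j < n.+1) sigma (n - j) l * (- a) ^+ j by rewrite -E ltxx.
rewrite big_ord_recl expr0 mulr1 subn0 ltr_pwDl ?Gl ?n0 ?leqnn //.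
apply: sumr_ge0 => j _; rewrite mulr_ge0 ?exprn_ge0 ?oppr_ge0 //.
have [nj|nj] := ltnP 0 (n - lift ord0 j).
  by rewrite ltW // Gl // nj leq_subr.
(* The cone condition starts at m = 1; the remaining sigma_0 is a sum over the empty subset
   alone. *)
have -> : (n - lift ord0 j = 0)%N by apply/eqP; rewrite -leqn0.
apply: sumr_ge0 => S; rewrite cards_eq0 => /eqP ->; by rewrite big_set0.
Qed.

Lemma quotientF_Phi n k (B : 'M[R]_n) l : (k <= n)%N -> is_spectrum B l ->
  (forall i, 0 < tnth l i) -> quotientF k B = (Phi k (tnth l))^-1.
Proof.
move=> kn sB l0; rewrite (quotientF_spectrum _ sB) sigma_compl // => [|i].
  rewrite sigma_all invfM mulrA divff ?mul1r //.
  by apply/prodf_neq0 => i _; rewrite gt_eqF.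
by rewrite gt_eqF.
Qed.

Lemma Phi_gt0 n k (l : 'I_n -> R) : (k <= n)%N -> (forall i, 0 < l i) -> 0 < Phi k l.
Proof.
move=> kn l0.
have S0 (S : {set 'I_n}) : 0 < \prod_(i in S) (l i)^-1.
  by apply: prodr_gt0 => i _; rewrite invr_gt0.
pose S1 : {set 'I_n} := [set i : 'I_n | (i < k)%N]%SET.
have cS1 : #|S1| == k.
  rewrite -sum1_card (eq_bigl (fun i : 'I_n => (i < k)%N)); last by move=> i; rewrite inE.
  by rewrite -(big_ord_widen n (fun=> 1%N)) // sum1_card card_ord.
rewrite /Phi (bigD1 S1) //= ltr_pwDl //; apply: sumr_ge0 => S _; exact: ltW.
Qed.

End Spectrum.

(** * Convexity of the inverse quotient *)

Section Rearrangement.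
Variable R : realType.

(** The sum up to j is a dual potential for the assignment problem with costs c_i l_j: because [c]
    increases and [l] decreases, its increments stay below c_i (l_j - l_i). *)
Lemma concave_potential (c l : nat -> R) : {homo c : i j / (i <= j)%N >-> i <= j} ->
  (forall i j, (i <= j)%N -> l j <= l i) ->
  forall i j, \sum_(m < j) c m * (l m.+1 - l m) - \sum_(m < i) c m * (l m.+1 - l m)
    <= c i * (l j - l i).
Proof.
move=> hc hl i j; case: (leqP i j) => [ij|/ltnW ji].
- rewrite -(subnKC ij); elim: (j - i)%N => [|d IH]; first by rewrite addn0 !subrr mulr0.
  rewrite addnS big_ord_recr /= addrAC.
  apply: (@le_trans _ _ (c i * (l (i + d)%N - l i) + c i * (l (i + d).+1 - l (i + d)%N))).
    apply: lerD => //; apply: ler_wnM2r; first by rewrite subr_le0; exact: hl.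
    by apply: hc; exact: leq_addr.
  by rewrite le_eqVlt; apply/orP; left; apply/eqP; ring.
- rewrite -(subnKC ji); elim: (i - j)%N => [|d IH]; first by rewrite addn0 !subrr mulr0.
  rewrite addnS big_ord_recr /= opprD addrA.
  apply: (@le_trans _ _ (c (j + d)%N * (l j - l (j + d).+1))).
    apply: (@le_trans _ _ (c (j + d)%N * (l j - l (j + d)%N) -
      c (j + d)%N * (l (j + d).+1 - l (j + d)%N))); first by rewrite lerD2r.
    by rewrite le_eqVlt; apply/orP; left; apply/eqP; ring.
  apply: ler_wpM2r; last by apply: hc.
  by rewrite subr_ge0; apply: hl; rewrite -addnS leq_addr.
Qed.

Definition doubly_stochastic n (A : 'M[R]_n) :=
  [/\ forall i j, 0 <= A i j, forall i, \sum_j A i j = 1 & forall j, \sum_i A i j = 1].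

(** Linear programming duality: when the inequality for the potential is summed against [A], the
    potential drops out since rows and columns sum to 1. *)
Lemma rearrangement_sorted n (c l : 'I_n -> R) (A : 'M[R]_n) :
  (forall i j : 'I_n, (i <= j)%N -> c i <= c j) ->
  (forall i j : 'I_n, (i <= j)%N -> l j <= l i) -> doubly_stochastic A ->
  \sum_i c i * l i <= \sum_i \sum_j A i j * (c i * l j).
Proof.
case: n c l A => [|n] c l A hc hl [A0 Ar Ac]; first by rewrite !big_ord0.
(* [e] extends finite sequences to all naturals by repeating their last value, which keeps them
   monotone. *)
pose e m : 'I_n.+1 := inord (minn m n).
have em m : e m = minn m n :> nat by rewrite inordK // ltnS geq_minr.
have ei (i : 'I_n.+1) : e i = i.
  by apply: val_inj; rewrite /= em; apply/minn_idPl; rewrite -ltnS.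
have me i j : (i <= j)%N -> (e i <= e j)%N by rewrite !em => ij; rewrite leq_min !geq_min ij leqnn orbT.
pose v j := \sum_(m < j) c (e m) * (l (e m.+1) - l (e m)).
have vP (i j : 'I_n.+1) : v j - v i <= c i * (l j - l i).
  have := @concave_potential (c \o e) (l \o e) _ _ i j.
  rewrite /= !ei; apply => p q pq; [apply: hc|apply: hl]; exact: me.
apply: (@le_trans _ _ (\sum_i \sum_j A i j * (c i * l i - v i + v j))).
  rewrite (_ : \sum_i \sum_j _ = \sum_i c i * l i) //.
  transitivity (\sum_i (c i * l i - v i + \sum_j A i j * v j)).
    apply: eq_bigr => i _; under eq_bigr do rewrite mulrDr.
    by rewrite big_split /= -mulr_suml Ar mul1r.
  rewrite big_split /= sumrB exchange_big /=.
  under [X in _ - _ + X]eq_bigr do rewrite -mulr_suml Ac mul1r.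
  by rewrite subrK.
apply: ler_sum => i _; apply: ler_sum => j _; apply: ler_wpM2l => //.
have := vP i j; lra.
Qed.

Lemma sorting_perm n (f : 'I_n -> R) : exists s : 'S_n,
  forall i j : 'I_n, (i <= j)%N -> f (s i) <= f (s j).
Proof.
have [s es] : exists s : 'S_n, sort <=%R [tuple f i | i < n] =
    [tuple tnth [tuple f i | i < n] (s i) | i < n] :> seq R.
  by apply/tuple_permP; rewrite perm_sort.
exists s => i j ij.
have nE (m : 'I_n) : nth 0 (sort <=%R [tuple f i | i < n]) m = f (s m).
  by rewrite es -tnth_nth !tnth_mktuple.
rewrite -!nE; apply: sorted_leq_nth => //.
- exact: le_trans.
- exact: sort_le_sorted.
- by rewrite inE size_sort size_tuple.
- by rewrite inE size_sort size_tuple.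
Qed.

(** The permutation pairs the increasing order of [c] with the decreasing order of [l]; after
    sorting both, the identity is optimal. *)
Lemma rearrangement n (c l : 'I_n -> R) (A : 'M[R]_n) : doubly_stochastic A ->
  exists s : 'S_n, \sum_i c i * l (s i) <= \sum_i \sum_j A i j * (c i * l j).
Proof.
move=> [A0 Ar Ac].
have [p hp] := sorting_perm c; have [q hq] := sorting_perm (fun i => - l i).
exists (p^-1 * q)%g.
have -> : \sum_i c i * l ((p^-1 * q)%g i) = \sum_i (c \o p) i * (l \o q) i.
  rewrite (reindex_inj (@perm_inj _ p)) /=; apply: eq_bigr => i _.
  by rewrite permM permK.
have -> : \sum_i \sum_j A i j * (c i * l j) =
    \sum_i \sum_j (\matrix_(i, j) A (p i) (q j)) i j * ((c \o p) i * (l \o q) j).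
  rewrite (reindex_inj (@perm_inj _ p)) /=; apply: eq_bigr => i _.
  by rewrite (reindex_inj (@perm_inj _ q)) /=; apply: eq_bigr => j _; rewrite mxE.
apply: rearrangement_sorted => // [i j ij|]; first by rewrite -lerN2; exact: hq.
split=> [i j|i|j]; first by rewrite mxE.
- rewrite -(Ar (p i)) [RHS](reindex_inj (@perm_inj _ q)) /=.
  by apply: eq_bigr => j _; rewrite mxE.
- rewrite -(Ac (q j)) [RHS](reindex_inj (@perm_inj _ p)) /=.
  by apply: eq_bigr => i _; rewrite mxE.
Qed.

Lemma orthogonal_mx_doubly_stochastic n (P : 'M[R]_n) : orthogonal_mx P ->
  doubly_stochastic (\matrix_(i, j) P i j ^+ 2).
Proof.
move=> oP; split=> [i j|i|j]; first by rewrite mxE sqr_ge0.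
- by rewrite -(orthogonal_row_norm i oP); apply: eq_bigr => j _; rewrite mxE.
- by rewrite -(orthogonal_col_norm j oP); apply: eq_bigr => i _; rewrite mxE.
Qed.

End Rearrangement.

Section PhiConvexity.
Variable R : realType.

Lemma Phi_perm n k (l : 'I_n -> R) (s : 'S_n) : Phi k (l \o s) = Phi k l.
Proof.
rewrite /Phi [RHS](reindex_inj (imset_inj (@perm_inj _ s))) /=.
apply: eq_big => [S|S _]; first by rewrite card_imset //; exact: perm_inj.
by rewrite big_imset //= => i j _ _; exact: perm_inj.
Qed.

(** The tangent plane at r = 1 of the convex function prod 1/r_i, from e^x >= 1 + x and ln r <= r -
    1. *)
Lemma prod_inv_ge (I : finType) (P : pred I) (r : I -> R) : (forall i, 0 < r i) ->
  1 - \sum_(i | P i) (r i - 1) <= \prod_(i | P i) (r i)^-1.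
Proof.
move=> r0.
have -> : \prod_(i | P i) (r i)^-1 = expR (- \sum_(i | P i) ln (r i)).
  rewrite -sumrN expR_sum; apply: eq_bigr => i _.
  by rewrite expRN lnK ?posrE.
apply: le_trans (expR_ge1Dx _); rewrite lerD2l lerN2; apply: ler_sum => i _.
have := @le_ln1Dx R (r i - 1); rewrite (addrC 1) subrK; apply.
by have := r0 i; lra.
Qed.

(** [c] is minus the gradient of [Phi k] at [d], and the claim is convexity. The permutation is
    quantified after [c] so that it may be chosen according to [c]. *)
Lemma Phi_tangent n k (l d : 'I_n -> R) : (forall i, 0 < l i) -> (forall i, 0 < d i) ->
  exists c : 'I_n -> R, forall s : 'S_n, Phi k d - \sum_i c i * (l (s i) - d i) <= Phi k (l \o s).
Proof.
move=> l0 d0.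
pose p (S : {set 'I_n}) := \prod_(i in S) (d i)^-1.
exists (fun i => \sum_(S : {set 'I_n} | #|S| == k) (if i \in S then p S / d i else 0)) => s.
have -> : \sum_i (\sum_(S : {set 'I_n} | #|S| == k) (if i \in S then p S / d i else 0)) *
    (l (s i) - d i) = \sum_(S : {set 'I_n} | #|S| == k) p S * \sum_(i in S) (l (s i) / d i - 1).
  under eq_bigr do rewrite mulr_suml.
  rewrite exchange_big /=; apply: eq_bigr => S _.
  rewrite mulr_sumr [RHS]big_mkcond /=; apply: eq_bigr => i _.
  case: ifP => _; last by rewrite mul0r.
  by field; rewrite gt_eqF.
rewrite -sumrB; apply: ler_sum => S _.
rewrite -[X in X - _]mulr1 -mulrBr.
have -> : \prod_(i in S) ((l \o s) i)^-1 = p S * \prod_(i in S) (l (s i) / d i)^-1.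
  rewrite -big_split /=; apply: eq_bigr => i _.
  by rewrite invf_div; field; rewrite !gt_eqF.
apply: ler_wpM2l; last by apply: prod_inv_ge => i; rewrite divr_gt0.
by apply: prodr_ge0 => i _; rewrite invr_ge0 ltW.
Qed.

(* Schur-convexity of [Phi k]: the diagonal of a symmetric matrix is the image of
   the spectrum under a doubly stochastic matrix. *)
Lemma Phi_diag_le n k (l d : 'I_n -> R) (A : 'M[R]_n) : doubly_stochastic A ->
  (forall i, 0 < l i) -> (forall i, d i = \sum_j A i j * l j) -> Phi k d <= Phi k l.
Proof.
move=> dA l0 dE; have [A0 Ar Ac] := dA.
have d0 i : 0 < d i.
  rewrite dE lt_neqAle sumr_ge0 ?andbT; last by move=> j _; rewrite mulr_ge0 // ltW.
  rewrite eq_sym psumr_neq0 => [|j _]; last by rewrite mulr_ge0 // ltW.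
  apply: contraT; rewrite -all_predC => /allP H.
  have : \sum_j A i j = 0.
    apply: big1 => j _; have := H j (mem_index_enum _); rewrite /= -leNgt => H2.
    apply/eqP; rewrite eq_le A0 andbT; move: H2; rewrite pmulr_lle0 //.
  by rewrite Ar => /eqP; rewrite oner_eq0.
have [c Hc] := @Phi_tangent _ k _ _ l0 d0.
(* Since d = A l, this [s] makes sum c_i l_(s i) at most sum c_i d_i, so the linear term of the
   tangent bound has the favourable sign. *)
have [s Hs] := rearrangement c l dA.
rewrite -(Phi_perm k l s); apply: le_trans (Hc s).
rewrite lerDl oppr_ge0.
under eq_bigr do rewrite mulrBr.
rewrite sumrB subr_le0; apply: le_trans Hs _.
rewrite le_eqVlt; apply/orP; left; apply/eqP; apply: eq_bigr => i _.
by rewrite dE mulr_sumr; apply: eq_bigr => j _; ring.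
Qed.

End PhiConvexity.

(** * The variance inequality *)

Section Variance.
Variable R : realType.

Lemma weighted_cauchy_schwarz (I : finType) (P : pred I) (w h : I -> R) :
  (forall i, P i -> 0 <= w i) -> 0 < \sum_(i | P i) w i ->
  (\sum_(i | P i) w i * h i) ^+ 2 <=
    (\sum_(i | P i) w i) * \sum_(i | P i) w i * h i ^+ 2.
Proof.
move=> w0.
have E (z m : R) : \sum_(i | P i) w i * (z * h i - m) ^+ 2 =
    z ^+ 2 * (\sum_(i | P i) w i * h i ^+ 2) - 2 * z * m * (\sum_(i | P i) w i * h i)
    + m ^+ 2 * (\sum_(i | P i) w i).
  by rewrite !mulr_sumr -sumrB -big_split /=; apply: eq_bigr => i _; ring.
have := E (\sum_(i | P i) w i) (\sum_(i | P i) w i * h i).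
set Z := \sum_(i | P i) w i => {}E Z0; set m := \sum_(i | P i) w i * h i in E *.
have : 0 <= \sum_(i | P i) w i * (Z * h i - m) ^+ 2.
  by apply: sumr_ge0 => i Pi; rewrite mulr_ge0 ?w0 ?sqr_ge0.
rewrite {}E (_ : _ + _ = Z * (Z * (\sum_(i | P i) w i * h i ^+ 2) - m ^+ 2)); last by ring.
by rewrite pmulr_rge0 // subr_ge0.
Qed.

Definition subset_prod n (l : 'I_n -> R) (S : {set 'I_n}) := \prod_(i in S) (l i)^-1.

(** Divided by [Phi k l], this is the probability that [i] lies in a random k-subset with weights
    [subset_prod]. It also equals -l_i times the derivative of [Phi k] in l_i. *)
Definition incl n k (l : 'I_n -> R) i :=
  \sum_(S : {set 'I_n} | (#|S| == k) && (i \in S)) subset_prod l S.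

Lemma sum_incl n k (l x : 'I_n -> R) :
  \sum_(S : {set 'I_n} | #|S| == k) subset_prod l S * \sum_(i in S) x i =
  \sum_i incl k l i * x i.
Proof.
under eq_bigr do rewrite mulr_sumr big_mkcond /=.
rewrite exchange_big /=; apply: eq_bigr => i _.
by rewrite /incl mulr_suml big_mkcondr.
Qed.

Lemma subset_prod_gt0 n (l : 'I_n -> R) S : (forall i, 0 < l i) -> 0 < subset_prod l S.
Proof. by move=> l0; apply: prodr_gt0 => i _; rewrite invr_gt0. Qed.

(** The transposition of [a] and [b] sends subsets containing only [a] to subsets containing only
    [b], and replaces a factor 1/l_a by the larger 1/l_b; subsets containing both count equally on
    the two sides. *)
Lemma incl_min n k (l : 'I_n -> R) (a b : 'I_n) : (forall i, 0 < l i) -> l b <= l a ->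
  incl k l a <= incl k l b.
Proof.
move=> l0 ba; rewrite /incl (bigID (fun S : {set 'I_n} => b \in S)) /=.
rewrite [X in _ <= X](bigID (fun S : {set 'I_n} => a \in S)) /=.
apply: lerD.
  by rewrite le_eqVlt; apply/orP; left; apply/eqP/eq_bigl => S; rewrite andbAC.
pose t := tperm a b.
rewrite [X in _ <= X](reindex_inj (imset_inj (@perm_inj _ t))) /=.
have tS (S : {set 'I_n}) i : (t i \in [set t x | x in S]%SET) = (i \in S).
  by rewrite mem_imset //; exact: perm_inj.
have tab : t a = b by rewrite /t tpermL.
have tba : t b = a by rewrite /t tpermR.
have tb (S : {set 'I_n}) : (b \in [set t x | x in S]%SET) = (a \in S) by rewrite -(tS S a) tab.
have ta (S : {set 'I_n}) : (a \in [set t x | x in S]%SET) = (b \in S) by rewrite -(tS S b) tba.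
have eqP1 (S : {set 'I_n}) : (#|[set t x | x in S]%SET| == k) &&
    (b \in [set t x | x in S]%SET) && (a \notin [set t x | x in S]%SET) =
    (#|S| == k) && (a \in S) && (b \notin S).
  by rewrite tb ta card_imset //; exact: perm_inj.
rewrite [X in _ <= X](eq_bigl _ _ eqP1); apply: ler_sum => S /andP[/andP[_ aS] bS].
rewrite /subset_prod big_imset /=; last by move=> i j _ _; exact: perm_inj.
apply: ler_prod => i iS; rewrite invr_ge0 ltW // lef_pV2 ?posrE //.
rewrite /t; case: tpermP => [->|ib|_ _] //=.
by rewrite ib in iS; rewrite iS in bS.
Qed.

Lemma sum_incl1 n k (l : 'I_n -> R) : \sum_i incl k l i = k%:R * Phi k l.
Proof.
transitivity (\sum_i incl k l i * 1); first by under [RHS]eq_bigr do rewrite mulr1.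
rewrite -sum_incl /Phi mulr_sumr; apply: eq_bigr => S /eqP cS.
by rewrite sumr_const cS mulrC.
Qed.

(* Split [sum_S x_i] as [X + Y], with [X] the contribution of [x a].  The variance of
   [X + Y] is [Var X / 2 - Var Y + Var (X + 2 Y) / 2], the term [Var Y] is absorbed by
   the last sum on the right after scaling by [1/k], and [incl k l a <= (1 - 1/n) Phi]
   because [l a] is maximal, so that [Var X] is comparable to [X^2]. *)
Lemma variance_bound n k (l x : 'I_n -> R) (a : 'I_n) : (1 <= k <= n - 1)%N ->
  (forall i, 0 < l i) -> (forall i, l i <= l a) ->
  (1 + (2 * k%:R * n%:R)^-1) * Phi k l * incl k l a * x a ^+ 2 <=
  Phi k l * (\sum_(S : {set 'I_n} | #|S| == k) subset_prod l S * (\sum_(i in S) x i) ^+ 2)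
  - (\sum_(S : {set 'I_n} | #|S| == k) subset_prod l S * \sum_(i in S) x i) ^+ 2
  + Phi k l * \sum_i incl k l i * x i ^+ 2.
Proof.
move=> hk l0 la; set Z := Phi k l; have [k1 kn] := andP hk.
have n0 : (0 < n)%N by lia.
have kn' : (k <= n)%N by lia.
have Z0 : 0 < Z by exact: Phi_gt0.
pose w := @subset_prod n l.
have w0 S : 0 < w S by exact: subset_prod_gt0.
pose L := incl k l; rewrite -/L.
have L0 i : 0 <= L i by apply: sumr_ge0 => S _; exact: ltW (w0 S).
pose y i := if i == a then 0 else x i.
pose X (S : {set 'I_n}) := if a \in S then x a else 0.
pose Y (S : {set 'I_n}) := \sum_(i in S) y i.
have xS (S : {set 'I_n}) : \sum_(i in S) x i = X S + Y S.
  rewrite /X /Y; case: ifPn => aS.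
    rewrite (bigD1 a) //= [X in _ = _ + X](bigD1 a) //= /y eqxx add0r; congr (_ + _).
    by apply: eq_bigr => i /andP[_ /negbTE ->].
  rewrite add0r; apply: eq_bigr => i iS; rewrite /y; case: eqP => // ia.
  by rewrite -ia iS in aS.
pose E (h : {set 'I_n} -> R) := \sum_(S : {set 'I_n} | #|S| == k) w S * h S.
have EX : E X = L a * x a.
  by rewrite /E /L /incl mulr_suml big_mkcondr; apply: eq_bigr => S _; rewrite /X; case: ifP; rewrite ?mulr0.
have EX2 : E (fun S => X S ^+ 2) = L a * x a ^+ 2.
  rewrite /E /L /incl mulr_suml big_mkcondr; apply: eq_bigr => S _; rewrite /X; case: ifP => //.
  by rewrite expr0n mulr0.
set b := E (fun S => X S * Y S); set c := E (fun S => Y S ^+ 2); set q := E Y.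
have E1 : \sum_(S : {set 'I_n} | #|S| == k) subset_prod l S * (\sum_(i in S) x i) ^+ 2 =
   L a * x a ^+ 2 + 2 * b + c.
  rewrite -EX2 /b /c /E mulr_sumr -!big_split /=; apply: eq_bigr => S _.
  rewrite xS /w; ring.
have E2 : \sum_(S : {set 'I_n} | #|S| == k) subset_prod l S * \sum_(i in S) x i = L a * x a + q.
  rewrite -EX /q /E -big_split /=; apply: eq_bigr => S _; rewrite xS /w; ring.
rewrite E1 E2.
have V1 : (L a * x a + 2 * q) ^+ 2 <= Z * (L a * x a ^+ 2 + 4 * b + 4 * c).
  have := @weighted_cauchy_schwarz _ (fun S : {set 'I_n} => #|S| == k) w
    (fun S => X S + 2 * Y S) (fun S _ => ltW (w0 S)) Z0.
  have -> : \sum_(S : {set 'I_n} | #|S| == k) w S * (X S + 2 * Y S) = L a * x a + 2 * q.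
    rewrite -EX /q /E mulr_sumr -!big_split /=; apply: eq_bigr => S _; ring.
  have -> // : \sum_(S : {set 'I_n} | #|S| == k) w S * (X S + 2 * Y S) ^+ 2 =
     L a * x a ^+ 2 + 4 * b + 4 * c.
  rewrite -EX2 /b /c /E !mulr_sumr -!big_split /=; apply: eq_bigr => S _; ring.
have V2 : (L a * x a + q) ^+ 2 <= Z * (L a * x a ^+ 2 + 2 * b + c).
  rewrite -E1 -E2; apply: weighted_cauchy_schwarz Z0 => S _; exact: ltW (w0 S).
pose D := \sum_(i | i != a) L i * x i ^+ 2.
have D0 : 0 <= D by apply: sumr_ge0 => i _; rewrite mulr_ge0 ?sqr_ge0.
have k0 : 0 < k%:R :> R by rewrite ltr0n.
have cD : c <= k%:R * D.
  have -> : D = \sum_i L i * y i ^+ 2.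
    rewrite [RHS](bigD1 a) //= /y eqxx expr0n mulr0 add0r; apply: eq_bigr => i ia.
    by rewrite (negbTE ia).
  rewrite -sum_incl mulr_sumr; apply: ler_sum => S /eqP cS.
  rewrite [X in _ <= X]mulrCA; apply: ler_wpM2l; first exact: ltW (w0 S).
  have := @weighted_cauchy_schwarz _ (mem S) (fun=> 1) y.
  rewrite sumr_const cS; under eq_bigr do rewrite mul1r; under [X in _ * X]eq_bigr do rewrite mul1r.
  by apply.
have sumL : \sum_i L i * x i ^+ 2 = L a * x a ^+ 2 + D by rewrite (bigD1 a).
rewrite sumL.
(* [L a] is the least of the n weights [L i], whose sum is k Phi with k <= n - 1. *)
have nL : n%:R * L a <= (n%:R - 1) * Z.
  apply: (@le_trans _ _ (\sum_i L i)).
    rewrite -[X in X%:R]card_ord mulr_natl -sumr_const; apply: ler_sum => i _.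
    exact: incl_min.
  rewrite sum_incl1 ler_wpM2r ?(ltW Z0) //.
  by rewrite lerBrDr natr1 ler_nat; lia.
set u := x a ^+ 2 in V1 V2 sumL *; have u0 : 0 <= u by exact: sqr_ge0.
have nn : 0 < n%:R :> R by rewrite ltr0n.
have ki1 : k%:R^-1 <= 1 :> R by rewrite invf_le1 // ler1n.
have ki0 : 0 < k%:R^-1 :> R by rewrite invr_gt0.
have cD' : k%:R^-1 * c <= D by rewrite mulrC ler_pdivrMr // mulrC.
have ZL : n%:R^-1 * Z <= Z - L a.
  by rewrite mulrC ler_pdivrMr // mulrBl; have := nL; lra.
set V := Z * (L a * u + 2 * b + c) - (L a * x a + q) ^+ 2.
have V0 : 0 <= V by rewrite subr_ge0.
have VV : 2^-1 * (Z * L a * u - L a ^+ 2 * u) - Z * c <= V.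
  have -> : V = 2^-1 * (Z * L a * u - L a ^+ 2 * u) - (Z * c - q ^+ 2) +
     2^-1 * (Z * (L a * u + 4 * b + 4 * c) - (L a * x a + 2 * q) ^+ 2).
    by rewrite /V /u; field.
  have := sqr_ge0 q; lra.
have kV : k%:R^-1 * V <= V by rewrite ler_piMl.
have kVV := ler_wpM2l (ltW ki0) VV.
have Lu : 0 <= L a * u by rewrite mulr_ge0.
have H1 := ler_wpM2l Lu ZL.
have H2 := ler_wpM2l (ltW ki0) H1.
have H3 := ler_wpM2l (ltW Z0) cD'.
rewrite -/V (_ : (1 + (2 * k%:R * n%:R)^-1) * Z * L a * u =
  Z * L a * u + 2^-1 * (k%:R^-1 * (L a * u * (n%:R^-1 * Z)))); last first.
  by rewrite !invfM; ring.
nra.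
Qed.

(* The derivative of [1 / Phi k] in [l i]. *)
Definition gradF n k (l : 'I_n -> R) i := incl k l i / (l i * Phi k l ^+ 2).

Lemma gradF_ge0 n k (l : 'I_n -> R) i : (forall i, 0 < l i) -> 0 <= gradF k l i.
Proof.
move=> l0; apply: divr_ge0.
  by apply: sumr_ge0 => S _; exact: ltW (subset_prod_gt0 _ l0).
by rewrite mulr_ge0 ?sqr_ge0 // ltW.
Qed.

(** The function u Phi(d) is at most 1 near 0 and equals 1 at 0, so its linear coefficient vanishes
    and its quadratic one is nonpositive. In the relative increments x_i = X_i / l_i the latter is
    the quantity estimated by [variance_bound]. *)
Lemma F_second_order n k (l X Y : 'I_n -> R) (d : 'I_n -> R -> R) (u : R -> R) f0 f1 f2 a :
  (1 <= k <= n - 1)%N -> (forall i, 0 < l i) -> (forall i, l i <= l a) ->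
  (forall i, jet (d i) (l i) (X i) (Y i)) -> jet u f0 f1 f2 -> f0 = (Phi k l)^-1 ->
  (\forall t \near (0 : R), u t <= (Phi k (d ^~ t))^-1) ->
  f1 = \sum_i gradF k l i * X i /\
  2 * f2 <= f1 ^+ 2 / f0 + 2 * (\sum_i gradF k l i * Y i)
     - (1 + (2 * k%:R * n%:R)^-1) * (gradF k l a * X a ^+ 2 / l a).
Proof.
move=> hk l0 la jd ju f0E unear.
have kn : (k <= n)%N by lia.
set Z := Phi k l in f0E; have Z0 : 0 < Z by exact: Phi_gt0.
have Zn : Z != 0 by rewrite gt_eqF.
pose x i := X i / l i; pose y i := Y i / l i.
have ln i : l i != 0 by rewrite gt_eqF.
have jd' i : jet (d i) (l i) (l i * x i) (l i * y i).
  by apply: jet_eq (jd i) _ _ _ => //; rewrite /x /y mulrC divfK.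
pose w := @subset_prod n l.
have jP := @jet_sum R _ (index_enum {set 'I_n}) (fun S : {set 'I_n} => #|S| == k)
   (fun S t => \prod_(i in S) (d i t)^-1) _ _ _
   (fun S _ => @jet_prod_inv R _ (index_enum 'I_n) (mem S) d l x y
      (fun i _ => l0 i) (fun i _ => jd' i)).
set E1 := \sum_(S : {set 'I_n} | #|S| == k) subset_prod l S * \sum_(i in S) x i.
set E2 := \sum_(S : {set 'I_n} | #|S| == k) subset_prod l S * (\sum_(i in S) x i) ^+ 2.
set G2 := \sum_i incl k l i * x i ^+ 2; set Gy := \sum_i incl k l i * y i.
have {jP}jP : jet (fun t => Phi k (d ^~ t)) Z (- E1) ((E2 + G2) / 2 - Gy).
  apply: jet_eq jP _ _ _ => //; first by rewrite /E1 -sumrN.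
  rewrite /G2 /Gy -!sum_incl /E2 -big_split /= mulr_suml -sumrB; apply: eq_bigr => S _.
  by rewrite /subset_prod; field.
have dnear : \forall t \near (0 : R), forall i, 0 < d i t.
  by apply: (@filter_forall _ _ _ (nbhs (0 : R))) => i; exact: jet_gt (jd i) (l0 i).
have j1 : jet (fun=> 1) (f0 * Z) 0 0 by rewrite f0E mulVf //; exact: jet_cst.
have le1 : \forall t \near (0 : R), u t * Phi k (d ^~ t) <= 1.
  apply: filterS (filterI dnear unear) => t [d0 ut].
  have P0 : 0 < Phi k (d ^~ t) by exact: Phi_gt0.
  by rewrite -ler_pdivlMr // div1r.
have [E0 E] := jet_le (jetM ju jP) j1 le1.
have f1E : f1 = E1 / Z ^+ 2.
  have : f1 * Z = f0 * E1 by move: E0; lra.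
  move=> /(congr1 (fun z => z / Z)); rewrite mulfK // f0E => ->; by field.
have gE (v : 'I_n -> R) : \sum_i gradF k l i * v i = (\sum_i incl k l i * (v i / l i)) / Z ^+ 2.
  rewrite mulr_suml; apply: eq_bigr => i _; rewrite /gradF -/Z; field; exact/andP.
split; first by rewrite gE f1E /E1 sum_incl.
have V := @variance_bound n k l x a hk l0 la.
rewrite -/Z -/E1 -/E2 -/G2 in V.
rewrite gE -/Gy.
have -> : gradF k l a * X a ^+ 2 / l a = incl k l a * x a ^+ 2 / Z ^+ 2.
  by rewrite /gradF /x -/Z; field; apply/andP.
set eps := 1 + _ in V *.
have Z30 : 0 < Z ^+ 3 by rewrite exprn_gt0.
have {}V : eps * (incl k l a * x a ^+ 2 / Z ^+ 2) <= (Z * E2 - E1 ^+ 2 + Z * G2) / Z ^+ 3.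
  rewrite ler_pdivlMr // (_ : _ * Z ^+ 3 = eps * Z * incl k l a * x a ^+ 2) //.
  by field.
have {}E : 2 * f2 <= (2 / Z) * (f1 * E1 - f0 * ((E2 + G2) / 2 - Gy)).
  have : f2 * Z <= f1 * E1 - f0 * ((E2 + G2) / 2 - Gy) by move: E; lra.
  rewrite -ler_pdivlMr // => H; apply: le_trans (ler_wpM2l (ler0n _ 2) H) _.
  by rewrite le_eqVlt; apply/orP; left; apply/eqP; rewrite mulrCA mulrC.
apply: le_trans E _.
have -> : 2 / Z * (f1 * E1 - f0 * ((E2 + G2) / 2 - Gy)) =
  f1 ^+ 2 / f0 + 2 * (Gy / Z ^+ 2) - (Z * E2 - E1 ^+ 2 + Z * G2) / Z ^+ 3.
  by rewrite f1E f0E; field.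
lra.
Qed.

End Variance.

(** * Curves of symmetric matrices *)

Section SymmetricCurves.
Variables (R : realType) (n : nat).

Lemma spectral_diag_bound k (N : 'M[R]_n) (l : n.-tuple R) : (k <= n)%N -> N^T = N ->
  is_spectrum N l -> (forall i, 0 < tnth l i) -> (forall i, 0 < N i i) ->
  quotientF k N <= (Phi k (fun i => N i i))^-1.
Proof.
move=> kn sN sp l0 d0; have [Q [oQ eN]] := sym_spectral_decomposition sN sp.
rewrite (quotientF_Phi kn sp l0) lef_pV2 ?posrE; last 2 first.
- exact: Phi_gt0.
- exact: Phi_gt0.
apply: (@Phi_diag_le R n k (tnth l) (fun i => N i i) _ (orthogonal_mx_doubly_stochastic oQ)) => // i.
by rewrite eN; apply: eq_bigr => j _; rewrite mxE; ring.
Qed.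

Lemma trmx_conj (A B : 'M[R]_n) : B^T = B -> (A^T *m B *m A)^T = A^T *m B *m A.
Proof. by move=> sB; rewrite !trmx_mul trmxK sB mulmxA. Qed.

Lemma jet_exists_char_poly (M : R -> 'M[R]_n) m :
  (forall i j, exists a b c, jet (fun t => M t i j) a b c) ->
  exists a b c, jet (fun t => (char_poly (M t))`_m) a b c.
Proof.
apply: (@cls_char_poly R R (fun h => exists a b c, jet h a b c)).
- by move=> c; exists c, 0, 0; exact: jet_cst.
- by move=> h u [a [b [c jh]]] [a' [b' [c' ju]]]; do 3 eexists; exact: jetD jh ju.
- by move=> h u [a [b [c jh]]] [a' [b' [c' ju]]]; do 3 eexists; exact: jetM jh ju.
Qed.

Lemma derive_lineE (f : 'M[R]_n -> R) (x v : 'M[R]_n) (l : R) :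
  is_derive (0 : R) 1 (fun t => f (t *: v + x)) l -> 'D_v f x = l.
Proof.
move=> [_ <-]; rewrite /derive; set g1 := fun h : R => _; set g2 := fun h : R => _.
suff -> : g1 = g2 by [].
apply/funext => h; rewrite /g1 /g2 /=; congr (_ *: (f _ - f _)); last by rewrite scale0r add0r.
by rewrite [h%:A]mulr1 addr0.
Qed.

Lemma exists_max (l : 'I_n -> R) (z : 'I_n) : exists a, forall i, l i <= l a.
Proof. by case: (@arg_maxP _ _ _ z xpredT l isT) => a _ H; exists a => i; exact: H. Qed.

Lemma exists_lower_bound (l : 'I_n -> R) : (forall i, 0 < l i) ->
  exists2 m, 0 < m & forall i, m <= l i.
Proof.
move=> l0; have [[z _]|H] := pselect (exists z : 'I_n, True); last first.
  by exists 1 => // i; exfalso; apply: H; exists i.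
have [a Ha] := exists_max (fun i => - l i) z.
by exists (l a) => // i; rewrite -lerN2.
Qed.

(** The characteristic polynomial shows that F has an expansion along the line; its linear
    coefficient is then forced by the one-sided bound F <= 1/Phi (diagonal entries) in an eigenframe
    of [B]. *)
Lemma dF_spectral k (P B : 'M[R]_n) (l : n.-tuple R) a b : (1 <= k <= n - 1)%N ->
  orthogonal_mx P -> (forall i, 0 < tnth l i) ->
  B = P *m diag_mx (\row_i tnth l i) *m P^T -> is_spectrum B l ->
  dF k B a b = \sum_i gradF k (tnth l) i * (P a i * P b i).
Proof.
move=> hk oP l0 eB sB.
have kn : (k <= n)%N by lia.
pose H : 'M[R]_n := 2^-1 *: (delta_mx a b + delta_mx b a).
have sH : H^T = H by rewrite /H linearZ /= linearD /= !trmx_delta addrC.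
have symB : B^T = B by rewrite eB !trmx_mul trmxK tr_diag_mx mulmxA.
pose M t := t *: H + B.
have symM t : (M t)^T = M t by rewrite linearD linearZ /= sH symB.
have jM i j : jet (fun t => M t i j) (B i j) (H i j) 0.
  by apply: jet_ext (jet_poly _ _ _) => t; rewrite !mxE; ring.
pose q t := quotientF k (M t).
have qE t : q t = (-1) ^+ k * (char_poly (M t))`_0 / (char_poly (M t))`_k.
  have [lt slt] := sym_is_spectrum (symM t).
  exact: is_spectrum_conjP slt _ kn.
have jex i j : exists a b c, jet (fun t => M t i j) a b c by do 3 eexists; exact: jM.
have [a0 [b0 [c0 j0]]] := jet_exists_char_poly 0 jex.
have [ak [bk [ck jk]]] := jet_exists_char_poly k jex.
have M0 : M 0 = B by rewrite /M scale0r add0r.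
have ak0 : ak != 0.
  rewrite -(jet_at0 jk) M0.
  have := sigma_char_poly (leq_subr k n) sB; rewrite subKn // => E.
  have : 0 < sigma (n - k) l.
    rewrite sigma_compl // => [|i]; last by rewrite gt_eqF.
    rewrite mulr_gt0 ?Phi_gt0 // sigma_all; exact: prodr_gt0.
  by rewrite E; apply: contraTneq => ->; rewrite mulr0 ltxx.
have [q0 [q1 [q2 jq]]] : exists q0 q1 q2, jet q q0 q1 q2.
  by do 3 eexists; apply: jet_ext (jetM (jetZ ((-1) ^+ k) j0) (jet_inv jk ak0)).
pose N t := P^T *m M t *m P; pose H' := P^T *m H *m P.
have eN t : N t = t *: H' + diag_mx (\row_i tnth l i).
  rewrite /N mulmxDr mulmxDl -scalemxAr -scalemxAl eB !mulmxA oP mul1mx.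
  by rewrite -mulmxA oP mulmx1.
have symN t : (N t)^T = N t by exact: trmx_conj.
have cN t : char_poly (N t) = char_poly (M t) by exact: char_poly_conj.
have jd i : jet (fun t => N t i i) (tnth l i) (H' i i) 0.
  apply: jet_ext (jet_poly (tnth l i) (H' i i) 0) => t.
  rewrite eN mxE [X in X + _]mxE [X in _ + X]mxE [X in X *+ _]mxE eqxx mulr1n; ring.
(* Eigenvalues of [N t] are values of its quadratic form at unit vectors, hence at least m - |t| S,
   which is positive for small t. *)
have [m m0 ml] := exists_lower_bound l0.
pose S := \sum_i \sum_j `|H' i j|.
have S0 : 0 <= S by do 2 apply: sumr_ge0 => ? _.
have S10 : 0 < S + 1 by lra.
have qnear : \forall t \near (0 : R), q t <= (Phi k (fun i => N t i i))^-1.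
  have dnear : \forall t \near (0 : R), forall i, 0 < N t i i.
    by apply: (@filter_forall _ _ _ (nbhs (0 : R))) => i; exact: jet_gt (jd i) (l0 i).
  apply: filterS (filterI dnear (near0_lt (divr_gt0 m0 S10))) => t [d0 tm].
  have [lt slt] := sym_is_spectrum (symN t).
  have -> : q t = quotientF k (N t).
    by rewrite /q (quotientF_spectrum k slt) (quotientF_spectrum k (is_spectrum_conj (cN t) slt)).
  apply: spectral_diag_bound (slt) _ d0 => // i.
  have [Q [oQ eQ]] := sym_spectral_decomposition (symN t) slt.
  have -> : tnth lt i = (Q^T *m N t *m Q) i i.
    have -> : N t = Q *m diag_mx (\row_i tnth lt i) *m Q^T.
      by apply/matrixP => x y; rewrite eQ diag_conjE; apply: eq_bigr => j _; rewrite mxE.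
    by rewrite !mulmxA oQ mul1mx -mulmxA oQ mulmx1 !mxE eqxx.
  rewrite eN mulmxDr mulmxDl -scalemxAr -scalemxAl mxE [X in X + _]mxE.
  have H1 : m <= (Q^T *m diag_mx (\row_i tnth l i) *m Q) i i.
    have := diag_conjE Q^T (\row_i tnth l i) i i; rewrite trmxK => ->.
    rewrite -[X in X <= _]mulr1 -(orthogonal_col_norm i oQ) mulr_sumr.
    apply: ler_sum => j _; rewrite !mxE (mulrC (Q j i)) -mulrA -expr2.
    by rewrite ler_wpM2r ?sqr_ge0.
  have H2 : `|(Q^T *m H' *m Q) i i| <= S.
    rewrite mxE /S exchange_big /=; apply: le_trans (ler_norm_sum _ _ _) _.
    apply: ler_sum => j _; rewrite mxE mulr_suml; apply: le_trans (ler_norm_sum _ _ _) _.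
    apply: ler_sum => j' _; rewrite !normrM -[X in _ <= X]mul1r -[X in _ <= X]mulr1.
    by rewrite [Q^T _ _]mxE !ler_pM ?mulr_ge0 ?orthogonal_le1.
  have H3 : `|t * (Q^T *m H' *m Q) i i| < m.
    rewrite normrM; apply: (@le_lt_trans _ _ (`|t| * (S + 1))); last by rewrite -ltr_pdivlMr.
    by rewrite ler_wpM2l // (le_trans H2) // lerDl.
  by move: H3; rewrite ltr_norml; lra.
have [z Hz] := exists_max (tnth l) a.
have q0E : q0 = (Phi k (tnth l))^-1.
  by rewrite -(jet_at0 jq) /q M0 (quotientF_Phi kn sB l0).
have [q1E _] := F_second_order hk l0 Hz jd jq q0E qnear.
rewrite /dF -/H (derive_lineE (jet_is_derive jq)) q1E; apply: eq_bigr => i _; congr (_ * _).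
have HE : H' i i = \sum_c \sum_d P c i * H c d * P d i.
  rewrite mxE exchange_big /=; apply: eq_bigr => d _; rewrite mxE mulr_suml.
  by apply: eq_bigr => c _; rewrite mxE.
have deltaE (x y : 'I_n) : \sum_c \sum_d P c i * (delta_mx x y : 'M[R]_n) c d * P d i = P x i * P y i.
  rewrite (bigD1 x) //= (bigD1 y) //= mxE !eqxx mulr1 big1 ?addr0; last first.
    by move=> d dy; rewrite mxE (negbTE dy) andbF mulr0 mul0r.
  rewrite big1 ?addr0 // => c cx; rewrite big1 // => d _.
  by rewrite mxE (negbTE cx) mulr0 mul0r.
rewrite HE; transitivity (2^-1 * (P a i * P b i + P b i * P a i)); last by field.
rewrite -!deltaE -big_split mulr_sumr /=; apply: eq_bigr => c _.
rewrite -big_split mulr_sumr /=; apply: eq_bigr => d _; rewrite !mxE; ring.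
Qed.

(** * Tests of a curve of symmetric matrices at a diagonal matrix *)

Variables (N : R -> 'M[R]_n) (lt : R -> n.-tuple R) (l : 'I_n -> R) (N1 N2 : 'M[R]_n).
Variable z : 'I_n.
Hypothesis symN : forall t, (N t)^T = N t.
Hypothesis jN : mjet N (diag_mx (\row_i l i)) N1 N2.
Hypothesis specN : \forall t \near (0 : R), is_spectrum (N t) (lt t).
Hypothesis posN : \forall t \near (0 : R), forall i, 0 < tnth (lt t) i.
Hypothesis topN : \forall t \near (0 : R), forall i, tnth (lt t) i <= tnth (lt t) z.
Hypothesis l0 : forall i, 0 < l i.
Hypothesis lz : forall i, l i <= l z.

Let D : 'M[R]_n := diag_mx (\row_i l i).

Lemma quad_form_le (B : 'M[R]_n) (s : n.-tuple R) (x : 'rV[R]_n) : B^T = B ->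
  is_spectrum B s -> (forall i, tnth s i <= tnth s z) ->
  quad_form B x <= tnth s z * quad_form 1%:M x.
Proof.
move=> sB sp sz; have [Q [oQ eB]] := sym_spectral_decomposition sB sp.
have -> : quad_form B x = \sum_i tnth s i * (x *m Q) 0 i ^+ 2.
  have -> : B = Q *m diag_mx (\row_i tnth s i) *m Q^T.
    by apply/matrixP => a b; rewrite eB diag_conjE; apply: eq_bigr => j _; rewrite mxE.
  rewrite quad_formE !mulmxA -(mulmxA _ Q^T) -trmx_mul diag_conjE.
  by apply: eq_bigr => i _; rewrite [X in _ * X * _]mxE; ring.
have -> : quad_form 1%:M x = \sum_i (x *m Q) 0 i ^+ 2.
  rewrite -quad_form1 !quad_formE !mulmx1 trmx_mul !mulmxA -(mulmxA x).
  by rewrite orthogonal_tr // mulmx1.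
rewrite mulr_sumr; apply: ler_sum => i _; by rewrite ler_wpM2r ?sqr_ge0.
Qed.

Definition bil_form (B : 'M[R]_n) (x y : 'rV[R]_n) : R := \sum_a \sum_b x 0 a * B a b * y 0 b.

Lemma bil_formE B x y : bil_form B x y = (x *m B *m y^T) 0 0.
Proof.
rewrite /bil_form mxE exchange_big /=; apply: eq_bigr => b _.
by rewrite !mxE mulr_suml.
Qed.

Lemma quad_form_bil B x : quad_form B x = bil_form B x x.
Proof. by []. Qed.

Lemma jet_bil_form x y : jet (fun t => bil_form (N t) x y) (bil_form D x y)
  (bil_form N1 x y) (bil_form N2 x y).
Proof.
apply: jet_sum => a _; apply: jet_sum => b _.
apply: jet_eq (jet_ext _ (jetZ (x 0 a * y 0 b) (jN a b))) _ _ _; [move=> t| | |]; ring.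
Qed.

Lemma jet_quad_form_line x y : jet (fun t => quad_form (N t) (x + t *: y))
  (quad_form D x) (quad_form N1 x + 2 * bil_form D x y)
  (quad_form N2 x + 2 * bil_form N1 x y + quad_form D y).
Proof.
have jt : jet (fun t : R => t) 0 1 0 by apply: jet_ext (jet_poly 0 1 0) => t; ring.
apply: jet_eq (jet_ext _ (jetD (jetD (jet_bil_form x x) (jetZ 2 (jetM jt (jet_bil_form x y))))
  (jetM (jetM jt jt) (jet_bil_form y y)))) _ _ _.
- by move=> t; rewrite quad_form_line // -bil_formE !quad_form_bil; ring.
- by rewrite quad_form_bil; ring.
- by rewrite quad_form_bil; ring.
- by rewrite !quad_form_bil; ring.
Qed.

Section TouchAbove.
Variables (phi : R -> R) (p1 p2 : R).
Hypothesis jphi : jet phi (ln (1 + l z)) p1 p2.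
Hypothesis phi_above : \forall t \near (0 : R), ln (1 + tnth (lt t) z) <= phi t.

(** Coefficients of e^phi - 1, which lies above the top eigenvalue and touches it at 0. *)
Let psi1 := (1 + l z) * p1.
Let psi2 := (1 + l z) * (p2 + p1 ^+ 2 / 2).

Lemma jet_psi : jet (fun t => expR (phi t) - 1) (l z) psi1 psi2.
Proof.
have z0 := l0 z.
have e : expR (ln (1 + l z)) = 1 + l z by rewrite lnK // posrE; lra.
apply: jet_eq (jetB (jet_expR jphi) (jet_cst 1)) _ _ _; rewrite e.
- by ring.
- by rewrite /psi1; ring.
- by rewrite /psi2; field.
Qed.

(** Along x + t y the quadratic form of [N t] is at most e^phi - 1 times the squared norm, with
    equality at t = 0 because [x] lies in the top eigenspace. The choice of [y] plays the part of
    the derivative of an eigenvector. *)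
Lemma top_eigenvalue_test (x y : 'rV[R]_n) : quad_form D x = l z * quad_form 1%:M x ->
  psi1 * quad_form 1%:M x + l z * (2 * bil_form 1%:M x y) =
    quad_form N1 x + 2 * bil_form D x y /\
  quad_form N2 x + 2 * bil_form N1 x y + quad_form D y <=
  l z * quad_form 1%:M y + psi1 * (2 * bil_form 1%:M x y) + psi2 * quad_form 1%:M x.
Proof.
move=> Dx.
have jn : jet (fun t => quad_form 1%:M (x + t *: y)) (quad_form 1%:M x)
    (2 * bil_form 1%:M x y) (quad_form 1%:M y).
  apply: jet_ext (jet_poly _ _ _) => t.
  by rewrite quad_form_line ?trmx1 // bil_formE.
have jr := jetM jet_psi jn.
have jl := jet_quad_form_line x y.
rewrite Dx in jl.
have H : \forall t \near (0 : R), quad_form (N t) (x + t *: y) <=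
    (expR (phi t) - 1) * quad_form 1%:M (x + t *: y).
  apply: filterS (filterI (filterI specN posN) (filterI topN phi_above)) => t [[sp po] [to ab]].
  apply: le_trans (quad_form_le _ (symN t) sp to) _.
  apply: ler_wpM2r.
    by rewrite quad_form1; apply: sumr_ge0 => i _; exact: sqr_ge0.
  have := po z => p0.
  rewrite lerBrDl -[X in X <= _]lnK ?posrE; last by lra.
  by rewrite ler_expR.
have [E1 E2] := jet_le jl jr H; split; first by rewrite E1; ring.
by apply: le_trans E2 _; rewrite le_eqVlt; apply/orP; left; apply/eqP; ring.
Qed.

Lemma quad_form_delta (B : 'M[R]_n) i : quad_form B (delta_mx 0 i) = B i i.
Proof. by rewrite quad_formE -rowE trmx_delta -colE !mxE. Qed.

Lemma bil_form_delta (B : 'M[R]_n) i y : bil_form B (delta_mx 0 i) y = \sum_b B i b * y 0 b.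
Proof.
by rewrite bil_formE -rowE mxE; apply: eq_bigr => b _; rewrite !mxE.
Qed.

Lemma quad_form_diag (d : 'rV[R]_n) x : quad_form (diag_mx d) x = \sum_b d 0 b * x 0 b ^+ 2.
Proof.
rewrite quad_formE diag_conjE; apply: eq_bigr => b _; ring.
Qed.

(** The first-order equality on e_i, e_j and e_i + e_j: a single smooth bound touches all branches
    of a multiple top eigenvalue, so they share one first derivative. *)
Lemma top_block_first_order i j : l i = l z -> l j = l z -> N1^T = N1 ->
  N1 i j = psi1 * (i == j)%:R.
Proof.
move=> li lj sN1.
have test (m : 'I_n) : l m = l z -> N1 m m = psi1.
  move=> lm; have [|+ _] := @top_eigenvalue_test (delta_mx 0 m) 0.
    by rewrite !quad_form_delta !mxE eqxx mulr1 !mulr1n.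
  rewrite !bil_form_delta !quad_form_delta [X in psi1 * X]mxE eqxx !big1; last 2 first.
  - by move=> b _; rewrite [X in _ * X]mxE mulr0.
  - by move=> b _; rewrite [X in _ * X]mxE mulr0.
  by rewrite !mulr0 !addr0 mulr1.
have [->|ij] := eqVneq i j; first by rewrite mulr1 test.
pose x : 'rV[R]_n := delta_mx 0 i + 1 *: delta_mx 0 j.
have qx (B : 'M[R]_n) : B^T = B -> quad_form B x = B i i + 2 * B i j + B j j.
  move=> sB; rewrite quad_form_line // -bil_formE bil_form_delta !quad_form_delta.
  rewrite expr1n !mulr1 (bigD1 j) //= big1 ?addr0; last first.
    by move=> b bj; rewrite mxE (negbTE bj) andbF mulr0.
  by rewrite mxE !eqxx mulr1.
have [|+ _] := @top_eigenvalue_test x 0.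
  rewrite !qx ?trmx1 ?tr_diag_mx // !mxE !eqxx (negbTE ij) !mulr1n !mulr0n li lj; ring.
have b0 (B : 'M[R]_n) : bil_form B x 0 = 0.
  by rewrite /bil_form !big1 // => a _; rewrite big1 // => b _; rewrite [X in _ * X]mxE mulr0.
rewrite !b0 !qx ?trmx1 // !test // !mxE !eqxx (negbTE ij) /= mulr0n mulr1n; lra.
Qed.

Lemma top_second_order :
  2 * N2 z z + 2 * \sum_(p | l p < l z) N1 z p ^+ 2 / (l z - l p) <= 2 * psi2.
Proof.
(* [c] maximises 2 N1_zp c_p - (l_z - l_p) c_p^2 for each p; on the top eigenspace the denominator
   vanishes and c_p is 0. *)
pose c : 'rV[R]_n := \row_p (if l p < l z then N1 z p / (l z - l p) else 0).
have cz : c 0 z = 0 by rewrite mxE ltxx.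
have [|_] := @top_eigenvalue_test (delta_mx 0 z) c.
  by rewrite !quad_form_delta !mxE eqxx mulr1 !mulr1n.
rewrite !quad_form_delta !bil_form_delta quad_form_diag quad_form1.
have -> : \sum_b (1%:M : 'M[R]_n) z b * c 0 b = 0.
  rewrite (bigD1 z) //= cz mulr0 add0r big1 // => b bz.
  by rewrite [X in X * _]mxE eq_sym (negbTE bz) mul0r.
rewrite [X in psi2 * X]mxE eqxx !mulr0 mulr1 => H.
have E : \sum_(p | l p < l z) N1 z p ^+ 2 / (l z - l p) =
  2 * (\sum_b N1 z b * c 0 b) + \sum_b (\row_i l i) 0 b * c 0 b ^+ 2 - l z * \sum_b c 0 b ^+ 2.
  rewrite !mulr_sumr -big_split -sumrB big_mkcond /=; apply: eq_bigr => p _.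
  rewrite !mxE; case: ifP => lp; last by rewrite expr0n /= !mulr0 addr0 subrr.
  by field; rewrite subr_eq0 gt_eqF.
rewrite E; lra.
Qed.

End TouchAbove.

Section EquationSecondOrder.
Variables (k : nat) (u : R -> R) (f0 f1 f2 : R).
Hypothesis hk : (1 <= k <= n - 1)%N.
Hypothesis ju : jet u f0 f1 f2.
Hypothesis uF : \forall t \near (0 : R), u t = quotientF k (N t).
Hypothesis f0E : f0 = (Phi k l)^-1.

Lemma second_order_rotated (K : 'M[R]_n) : K^T = - K -> N1^T = N1 ->
  2 * f2 <= f1 ^+ 2 / f0 + 2 * (\sum_i gradF k l i *
       (N2 i i + \sum_m ((l m - l i) * K m i ^+ 2 + 2 * N1 i m * K m i)))
     - (1 + (2 * k%:R * n%:R)^-1) * (gradF k l z * N1 z z ^+ 2 / l z).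
Proof.
move=> aK sN1; have kn : (k <= n)%N by lia.
pose Y i := N2 i i + \sum_m ((l m - l i) * K m i ^+ 2 + 2 * N1 i m * K m i).
have Kd i : K i i = 0.
  by have /matrixP /(_ i i) := aK; rewrite !mxE; lra.
(* The second-order Taylor polynomial of exp (t K), orthogonal only up to o(t^2); [L] corrects
   it. *)
pose Q t : 'M[R]_n := 1%:M + t *: K + t ^+ 2 *: (2^-1 *: (K *m K)).
have jQ : mjet Q 1%:M K (2^-1 *: (K *m K)) by exact: mjet_poly.
have jG : mjet (fun t => (Q t)^T *m Q t) 1%:M 0 0.
  apply: mjet_eq (mjetM (mjetT jQ) jQ) _ _ _.
  - by rewrite trmx1 mulmx1.
  - by rewrite trmx1 mul1mx mulmx1 aK subrr.
  - rewrite trmx1 mul1mx mulmx1 linearZ /= trmx_mul aK !mulNmx mulmxN opprK.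
    rewrite addrAC -scalerDl (_ : 2^-1 + 2^-1 = 1); last by field.
    by rewrite scale1r subrr.
have sG : \forall t \near (0 : R), ((Q t)^T *m Q t)^T = (Q t)^T *m Q t.
  by apply: near0W => t; rewrite trmx_mul trmxK.
have [L [jL LG]] := mjet_orthonormalise sG jG.
pose O t := Q t *m L t.
have jO : mjet O 1%:M K (2^-1 *: (K *m K)).
  apply: mjet_eq (mjetM jQ jL) _ _ _; rewrite ?mulmx1 //.
  - by rewrite mulmx0 add0r.
  - by rewrite !mulmx0 !add0r.
have oO : \forall t \near (0 : R), orthogonal_mx (O t).
  apply: filterS LG => t; rewrite /orthogonal_mx /O trmx_mul => <-.
  by rewrite !mulmxA.
pose M t := (O t)^T *m N t *m O t.
have jM := mjet_conj jO jN.
have symM t : (M t)^T = M t by exact: trmx_conj.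
have jd i : jet (fun t => M t i i) (l i) (N1 i i) (Y i).
  apply: jet_eq (jM i i) _ _ _.
  - by rewrite trmx1 mul1mx mulmx1 !mxE eqxx.
  - rewrite trmx1 mul1mx mul1mx mulmx1 aK mul_diag_mx mulNmx mul_mx_diag !mxE Kd; ring.
  - have sKK : (2^-1 *: (K *m K))^T = 2^-1 *: (K *m K).
      by rewrite linearZ /= trmx_mul aK mulNmx mulmxN opprK.
    rewrite trmx1 !mul1mx !mulmx1 sKK aK mulmxDl !mulNmx.
    have KK : (K *m K) i i = - \sum_m K m i ^+ 2.
      rewrite mxE -sumrN; apply: eq_bigr => m _.
      by have /matrixP /(_ m i) := aK; rewrite !mxE => ->; ring.
    have KDK : (K *m diag_mx (\row_j l j) *m K) i i = - \sum_m l m * K m i ^+ 2.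
      rewrite mul_mx_diag mxE -sumrN; apply: eq_bigr => m _; rewrite !mxE.
      by have /matrixP /(_ m i) := aK; rewrite !mxE => ->; ring.
    have NK : (N1 *m K) i i = \sum_m N1 i m * K m i by rewrite mxE.
    have KN : (K *m N1) i i = - \sum_m N1 i m * K m i.
      rewrite mxE -sumrN; apply: eq_bigr => m _.
      have /matrixP /(_ m i) := aK; have /matrixP /(_ m i) := sN1.
      by rewrite !mxE => <- ->; ring.
    have mxDE (A B : 'M[R]_n) : (A + B) i i = A i i + B i i by rewrite mxE.
    have mxNE (A : 'M[R]_n) : (- A) i i = - A i i by rewrite mxE.
    have mxZE (c : R) (A : 'M[R]_n) : (c *: A) i i = c * A i i by rewrite mxE.
    rewrite -scalemxAr -scalemxAl !mxDE !mxNE !mxZE KDK NK KN.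
    have DKK : (diag_mx (\row_j l j) *m (K *m K)) i i = l i * (K *m K) i i.
      by rewrite mul_diag_mx mxE; congr (_ * _); rewrite mxE.
    have KKD : (K *m K *m diag_mx (\row_j l j)) i i = (K *m K) i i * l i.
      by rewrite mul_mx_diag mxE; congr (_ * _); rewrite mxE.
    rewrite DKK KKD KK /Y big_split /=.
    have -> : \sum_m (l m - l i) * K m i ^+ 2 = \sum_m l m * K m i ^+ 2 - l i * \sum_m K m i ^+ 2.
      by rewrite mulr_sumr -sumrB; apply: eq_bigr => m _; ring.
    have -> : \sum_m 2 * N1 i m * K m i = 2 * \sum_m N1 i m * K m i.
      by rewrite mulr_sumr; apply: eq_bigr => m _; ring.
    by field.
have dnear : \forall t \near (0 : R), forall i, 0 < M t i i.
  by apply: (@filter_forall _ _ _ (nbhs (0 : R))) => i; exact: jet_gt (jd i) (l0 i).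
have unear : \forall t \near (0 : R), u t <= (Phi k (fun i => M t i i))^-1.
  apply: filterS (filterI (filterI specN posN) (filterI (filterI oO uF) dnear)).
  move=> t [[sp po] [[oOt ut] d0]].
  have cM : char_poly (N t) = char_poly (M t) by rewrite char_poly_conj.
  have spM := is_spectrum_conj cM sp.
  have -> : u t = quotientF k (M t).
    by rewrite ut (quotientF_spectrum k spM) (quotientF_spectrum k sp).
  exact: spectral_diag_bound spM po d0.
by have [_] := F_second_order hk l0 lz jd ju f0E unear.
Qed.

(* The rotation with generator [K m z = N1 z m / (l z - l m)] cancels the first-order
   off-diagonal entries in row [z] below the top eigenspace. *)
Lemma equation_second_order : N1^T = N1 ->
  2 * f2 <= f1 ^+ 2 / f0 + 2 * (\sum_i gradF k l i * N2 i i)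
     - (1 + (2 * k%:R * n%:R)^-1) * (gradF k l z * N1 z z ^+ 2 / l z)
     - 2 * \sum_(p | l p < l z) (gradF k l p - gradF k l z) * N1 z p ^+ 2 / (l z - l p).
Proof.
move=> sN1.
pose c p := if l p < l z then N1 z p / (l z - l p) else 0.
have cz : c z = 0 by rewrite /c ltxx.
pose K : 'M[R]_n := \matrix_(m, i) ((i == z)%:R * c m - (m == z)%:R * c i).
have aK : K^T = - K by apply/matrixP => m i; rewrite !mxE; ring.
have := second_order_rotated aK sN1.
set F := gradF k l.
(* The rotation adds the sum of all [T p] to the second coefficient of the diagonal entry z and
   takes [T p] from that of each other entry p. *)
pose T p := if l p < l z then N1 z p ^+ 2 / (l z - l p) else 0.
pose S := \sum_p T p.
have Kz m : K m z = c m by rewrite mxE eqxx cz mulr0 mul1r subr0.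
have sym a b : N1 a b = N1 b a by rewrite -[in LHS]sN1 mxE.
have Yz : \sum_m ((l m - l z) * K m z ^+ 2 + 2 * N1 z m * K m z) = S.
  apply: eq_bigr => m _; rewrite Kz /c /T; case: ifP => lm; last by rewrite expr0n /= !mulr0 addr0.
  by field; rewrite subr_eq0 gt_eqF.
have Yp p : p != z -> \sum_m ((l m - l p) * K m p ^+ 2 + 2 * N1 p m * K m p) = - T p.
  move=> pz; have Km m : K m p = - ((m == z)%:R * c p).
    by rewrite mxE (negbTE pz) mul0r sub0r.
  rewrite (bigD1 z) //= big1 ?addr0; last first.
    by move=> m mz; rewrite Km (negbTE mz) mul0r oppr0 expr0n /= !mulr0 addr0.
  rewrite Km eqxx mul1r (sym p) /c /T; case: ifP => lp.
    by field; rewrite subr_eq0 gt_eqF.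
  by rewrite oppr0 expr0n /= !mulr0 addr0.
have -> : \sum_i F i * (N2 i i + \sum_m ((l m - l i) * K m i ^+ 2 + 2 * N1 i m * K m i)) =
   \sum_i F i * N2 i i + F z * S - \sum_(p | l p < l z) F p * (N1 z p ^+ 2 / (l z - l p)).
  under eq_bigr do rewrite mulrDr.
  rewrite big_split /= -addrA; congr (_ + _).
  rewrite (bigD1 z) //= Yz; congr (_ + _).
  rewrite [X in _ = - X]big_mkcond /= [X in _ = - X](bigD1 z) //= ltxx add0r -sumrN.
  apply: eq_bigr => p pz; rewrite Yp // /T; case: ifP => _; by rewrite ?oppr0 ?mulr0 ?mulrN.
have -> : \sum_(p | l p < l z) (F p - F z) * N1 z p ^+ 2 / (l z - l p) =
   \sum_(p | l p < l z) F p * (N1 z p ^+ 2 / (l z - l p)) - F z * S.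
  rewrite /S [X in F z * X]big_mkcond /= /T.
  have -> : \sum_i (if true then if l i < l z then N1 z i ^+ 2 / (l z - l i) else 0 else 0) =
     \sum_(p | l p < l z) N1 z p ^+ 2 / (l z - l p) by rewrite [RHS]big_mkcond.
  by rewrite mulr_sumr -sumrB; apply: eq_bigr => p _; ring.
lra.
Qed.

End EquationSecondOrder.

End SymmetricCurves.

(** * Covariant derivatives in a chart *)

Section MatrixEntries.
Variables (R : pzRingType) (m n : nat).
Implicit Types A B : 'M[R]_(m, n).

Lemma mx_addE A B i j : (A + B) i j = A i j + B i j. Proof. by rewrite mxE. Qed.
Lemma mx_oppE A i j : (- A) i j = - A i j. Proof. by rewrite mxE. Qed.
Lemma mx_scaleE c A i j : (c *: A) i j = c * A i j. Proof. by rewrite mxE. Qed.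
Lemma trmxD A B : (A + B)^T = A^T + B^T. Proof. by apply/matrixP => i j; rewrite !mxE. Qed.
Lemma trmxN A : (- A)^T = - A^T. Proof. by apply/matrixP => i j; rewrite !mxE. Qed.
Lemma trmxZ c A : (c *: A)^T = c *: A^T. Proof. by apply/matrixP => i j; rewrite !mxE. Qed.

End MatrixEntries.

Lemma sum_mul_delta (R : pzRingType) n (f : 'I_n -> R) e :
  \sum_d f d * (1%:M : 'M[R]_n) e d = f e.
Proof.
rewrite (bigD1 e) //= mxE eqxx mulr1 big1 ?addr0 //.
by move=> d de; rewrite mxE eq_sym (negbTE de) mulr0.
Qed.

Section ChartCovariant.
Variables (R : realType) (n : nat) (U : set 'rV[R]_n) (G : 'rV[R]_n -> 'M[R]_n).
Hypothesis oU : open U.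
Hypothesis G2 : forall a b, C_on 2 U (fun y => G y a b).
Hypothesis Gsym : forall y, U y -> (G y)^T = G y.
Hypothesis Gunit : forall y, U y -> G y \in unitmx.

Lemma C_on_char_poly r (M : 'rV[R]_n -> 'M[R]_n) m : (forall a b, C_on r U (fun y => M y a b)) ->
  C_on r U (fun y => (char_poly (M y))`_m).
Proof.
apply: (@cls_char_poly R _ (C_on r U)).
- exact: C_on_cst.
- by move=> h u; exact: C_onD.
- by move=> h u; exact: C_onM.
Qed.

Lemma C_on_det r p (M : 'rV[R]_n -> 'M[R]_p) : (forall a b, C_on r U (fun y => M y a b)) ->
  C_on r U (fun y => \det (M y)).
Proof.
move=> hM.
have H : C_on r U (fun y => (char_poly (M y))`_0).
  apply: (@cls_char_poly R _ (C_on r U)) hM.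
  - exact: C_on_cst.
  - by move=> h u; exact: C_onD.
  - by move=> h u; exact: C_onM.
apply: (C_on_eq oU) (C_onZ oU ((-1) ^+ p) H) => y _.
by rewrite char_poly_det mulrA -expr2 sqrr_sign mul1r.
Qed.

Lemma C_on_invmx r (M : 'rV[R]_n -> 'M[R]_n) c d : (forall a b, C_on r U (fun y => M y a b)) ->
  (forall y, U y -> M y \in unitmx) -> C_on r U (fun y => invmx (M y) c d).
Proof.
move=> hM Mu.
have dM := C_on_det hM.
have hc : C_on r U (fun y => cofactor (M y) d c).
  apply: (C_onZ oU); apply: C_on_det => a b.
  by apply: (C_on_eq oU) (hM (lift d a) (lift c b)) => y _; rewrite !mxE.
have hd : C_on r U (fun y => (\det (M y))^-1).
  by apply: (C_onV oU) dM => y Uy; have := Mu y Uy; rewrite unitmxE unitfE.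
apply: (C_on_eq oU) (C_onM oU hd hc) => y Uy.
by rewrite /invmx (Mu y Uy) !mxE.
Qed.

Lemma christoffel_C1 c a b : C_on 1 U (christoffel G c a b).
Proof.
apply: (C_onZ oU); apply: (C_on_sum oU) => d _; apply: (C_onM oU).
  by apply: C_on_invmx Gunit => i j; exact: C_on_pred (G2 i j).
by apply: (C_onB oU); [apply: (C_onD oU)|]; exact: C_on_partial.
Qed.

(** The connection matrix in direction [l]: covariant derivatives of (0,2) tensors become matrix
    expressions. *)
Definition gammam l y : 'M[R]_n := \matrix_(c, b) christoffel G c l b y.

Definition mx_cov (W : 'rV[R]_n -> 'M[R]_n) : covtensor R n :=
  fun I y => if I is [:: a; b] then W y a b else 0.

Definition dmx l (W : 'rV[R]_n -> 'M[R]_n) y : 'M[R]_n :=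
  \matrix_(a, b) partial l (fun z => W z a b) y.

Lemma nabla_mx_covE W l a b y : nabla G (mx_cov W) [:: l; a; b] y =
  partial l (fun z => W z a b) y
  - ((gammam l y)^T *m W y) a b - (W y *m gammam l y) a b.
Proof.
rewrite /nabla /= !big_ord_recl big_ord0 /= addr0 opprD addrA; congr (_ - _ - _).
- by rewrite mxE; apply: eq_bigr => c _; rewrite !mxE.
- by rewrite mxE; apply: eq_bigr => c _; rewrite !mxE mulrC.
Qed.

Definition nabla_mx W l y : 'M[R]_n := \matrix_(a, b) nabla G (mx_cov W) [:: l; a; b] y.

Lemma nabla_mxE W l y :
  nabla_mx W l y = dmx l W y - (gammam l y)^T *m W y - W y *m gammam l y.
Proof. by apply/matrixP => a b; rewrite mxE nabla_mx_covE !mx_addE !mx_oppE [dmx _ _ _ _ _]mxE. Qed.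

Lemma nabla_metric l a b y : U y -> nabla G (mx_cov G) [:: l; a; b] y = 0.
Proof.
move=> Uy; rewrite nabla_mx_covE.
have symG i j z : U z -> G z i j = G z j i by move=> Uz; rewrite -[in LHS](Gsym Uz) mxE.
have pG d i j : partial d (fun z => G z i j) y = partial d (fun z => G z j i) y.
  by apply: (partial_eq_on oU) => // z Uz; exact: symG.
(* Christoffel symbols of the first kind; metric compatibility is that lower l a b + lower l b a is
   the derivative of G_ab in direction l. *)
pose lower i j d := 2^-1 * (partial i (fun z => G z j d) y + partial j (fun z => G z i d) y
     - partial d (fun z => G z i j) y).
have lowerE j e : ((gammam l y)^T *m G y) j e = lower l j e.
  rewrite mxE.
  transitivity (\sum_c (\sum_d invmx (G y) c d * lower l j d) * G y c e).
    apply: eq_bigr => c _; rewrite !mxE; congr (_ * _).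
    by rewrite /christoffel mulr_sumr; apply: eq_bigr => d _; rewrite /lower; ring.
  have -> : \sum_c (\sum_d invmx (G y) c d * lower l j d) * G y c e =
     \sum_d lower l j d * (G y *m invmx (G y)) e d.
    under eq_bigr do rewrite mulr_suml.
    rewrite exchange_big /=; apply: eq_bigr => d _; rewrite mxE mulr_sumr.
    by apply: eq_bigr => c _; rewrite (symG e c) //; ring.
  rewrite mulmxV; last exact: Gunit.
  exact: sum_mul_delta.
have -> : (G y *m gammam l y) a b = ((gammam l y)^T *m G y) b a.
  have -> : (gammam l y)^T *m G y = (G y *m gammam l y)^T by rewrite trmx_mul (Gsym Uy).
  by rewrite [RHS]mxE.
rewrite !lowerE /lower (pG a l b) (pG b l a) (pG l b a); by field.
Qed.

Lemma nabla2_metric l m a b y : U y -> nabla G (nabla G (mx_cov G)) [:: l; m; a; b] y = 0.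
Proof.
move=> Uy; rewrite {1}/nabla.
have -> : partial l (nabla G (mx_cov G) [:: m; a; b]) y = 0.
  rewrite (partial_eq_on oU (u := fun=> 0)) //; last by move=> z Uz; exact: nabla_metric.
  by rewrite /partial (derive_cst (0 : R)).
rewrite sub0r; apply/eqP; rewrite oppr_eq0; apply/eqP.
apply: big1 => s _; apply: big1 => c _.
rewrite (_ : nabla _ _ _ _ = 0) ?mulr0 //.
by case: s => -[|[|[|//]]] i3; exact: nabla_metric.
Qed.

Section Tensor.
Variable W : 'rV[R]_n -> 'M[R]_n.
Hypothesis W2 : forall a b, C_on 2 U (fun y => W y a b).
Variable y : 'rV[R]_n.
Hypothesis Uy : U y.

Definition dgammam l m : 'M[R]_n := \matrix_(c, b) partial l (christoffel G c m b) y.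
Definition ddmx l m : 'M[R]_n := \matrix_(a, b) partial l (partial m (fun z => W z a b)) y.
Definition nabla2_mx l m : 'M[R]_n :=
  \matrix_(a, b) nabla G (nabla G (mx_cov W)) [:: l; m; a; b] y.

Lemma partial_sumM l (h k : 'I_n -> 'rV[R]_n -> R) :
  (forall c, C_on 1 U (h c)) -> (forall c, C_on 1 U (k c)) ->
  partial l (fun z => \sum_c h c z * k c z) y =
  \sum_c (partial l (h c) y * k c y + h c y * partial l (k c) y).
Proof.
move=> hh hk.
have d1 c : derivable (h c) y (delta_mx 0 l) by exact: C_on_derivable (hh c) Uy.
have d2 c : derivable (k c) y (delta_mx 0 l) by exact: C_on_derivable (hk c) Uy.
have -> : (fun z => \sum_c h c z * k c z) = \sum_(c < n) (h c \* k c).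
  by apply/funext => z; rewrite fct_sumE.
rewrite /partial derive_sum => [|c]; last exact: derivableM.
apply: eq_bigr => c _; rewrite -[h c \* k c]/(h c * k c) (deriveM (d1 c) (d2 c)).
by rewrite /GRing.scale /= addrC mulrC.
Qed.

Lemma partial_nabla_mx_cov l m a b : partial l (nabla G (mx_cov W) [:: m; a; b]) y =
  (ddmx l m - (dgammam l m)^T *m W y - (gammam m y)^T *m dmx l W y
   - W y *m dgammam l m - dmx l W y *m gammam m y) a b.
Proof.
pose s1 z := \sum_c christoffel G c m a z * W z c b.
pose s2 z := \sum_c christoffel G c m b z * W z a c.
have C1 c i j : C_on 1 U (christoffel G c i j) by exact: christoffel_C1.
have W1 i j : C_on 1 U (fun z => W z i j) by exact: C_on_pred.
have Cs1 : C_on 1 U s1 by apply: (C_on_sum oU) => c _; apply: (C_onM oU) (C1 _ _ _) (W1 _ _).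
have Cs2 : C_on 1 U s2 by apply: (C_on_sum oU) => c _; apply: (C_onM oU) (C1 _ _ _) (W1 _ _).
have pW := C_on_partial m (W2 a b).
have -> : nabla G (mx_cov W) [:: m; a; b] = fun z => (partial m (fun z => W z a b) z - s1 z) - s2 z.
  apply/funext => z; rewrite /nabla /= !big_ord_recl big_ord0 /= addr0 opprD addrA.
  by [].
have dW : derivable (partial m (fun z => W z a b)) y (delta_mx 0 l).
  exact: C_on_derivable pW Uy.
have d1 : derivable s1 y (delta_mx 0 l) by exact: C_on_derivable Cs1 Uy.
have d2 : derivable s2 y (delta_mx 0 l) by exact: C_on_derivable Cs2 Uy.
have d01 : derivable (fun z => partial m (fun z => W z a b) z - s1 z) y (delta_mx 0 l).
  exact: derivableB dW d1.
rewrite (partialB d01 d2) (partialB dW d1).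
rewrite (partial_sumM l (fun c => C1 c m a) (fun c => W1 c b)).
rewrite (partial_sumM l (fun c => C1 c m b) (fun c => W1 a c)).
rewrite !big_split /= !opprD.
rewrite !mx_addE !mx_oppE [ddmx l m a b]mxE !addrA; congr (_ - _ - _ - _ - _).
- by rewrite mxE; apply: eq_bigr => c _; rewrite !mxE.
- by rewrite mxE; apply: eq_bigr => c _; rewrite !mxE.
- by rewrite mxE; apply: eq_bigr => c _; rewrite !mxE mulrC.
- by rewrite mxE; apply: eq_bigr => c _; rewrite !mxE mulrC.
Qed.

Lemma nabla2_mxE l m : nabla2_mx l m =
  (ddmx l m - (dgammam l m)^T *m W y - (gammam m y)^T *m dmx l W y
   - W y *m dgammam l m - dmx l W y *m gammam m y)
  - \sum_c christoffel G c l m y *: nabla_mx W c y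
  - (gammam l y)^T *m nabla_mx W m y - nabla_mx W m y *m gammam l y.
Proof.
apply/matrixP => a b; rewrite mxE {1}/nabla partial_nabla_mx_cov.
rewrite !big_ord_recl big_ord0 /= addr0 !opprD !addrA.
rewrite [in RHS]mx_addE [in RHS]mx_oppE [in RHS]mx_addE [in RHS]mx_oppE [in RHS]mx_addE [in RHS]mx_oppE.
congr (_ - _ - _ - _).
- by rewrite summxE; apply: eq_bigr => c _; rewrite !mxE.
- by rewrite mxE; apply: eq_bigr => c _; rewrite !mxE.
- by rewrite mxE; apply: eq_bigr => c _; rewrite !mxE mulrC.
Qed.

Variable v : 'rV[R]_n.

Definition gammav (p : 'rV[R]_n) : 'M[R]_n := \sum_l p 0 l *: gammam l y.
Definition dgammav : 'M[R]_n := \sum_l \sum_m (v 0 l * v 0 m) *: dgammam l m.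
(** Minus the acceleration of the geodesic with velocity [v] at [y]. *)
Definition gamma2 : 'rV[R]_n := \row_c \sum_l \sum_m v 0 l * v 0 m * christoffel G c l m y.
Definition dmxv (p : 'rV[R]_n) : 'M[R]_n := \sum_l p 0 l *: dmx l W y.
Definition ddmxv : 'M[R]_n := \sum_l \sum_m (v 0 l * v 0 m) *: ddmx l m.
Definition nablav (p : 'rV[R]_n) : 'M[R]_n := \sum_l p 0 l *: nabla_mx W l y.

Lemma nablavE p : nablav p = dmxv p - (gammav p)^T *m W y - W y *m gammav p.
Proof.
rewrite /nablav /dmxv /gammav linear_sum mulmx_suml mulmx_sumr -!sumrB.
apply: eq_bigr => l _; rewrite nabla_mxE linearZ /= -scalemxAl -scalemxAr.
by rewrite !scalerBr.
Qed.

Lemma sum2_mull (A B : 'I_n -> 'M[R]_n) :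
  \sum_l \sum_m (v 0 l * v 0 m) *: (A l *m B m) =
  (\sum_l v 0 l *: A l) *m (\sum_m v 0 m *: B m).
Proof.
rewrite mulmx_suml; apply: eq_bigr => l _; rewrite mulmx_sumr; apply: eq_bigr => m _.
by rewrite -scalemxAl -scalemxAr scalerA.
Qed.

Lemma sum2_mulr (A B : 'I_n -> 'M[R]_n) :
  \sum_l \sum_m (v 0 l * v 0 m) *: (A m *m B l) =
  (\sum_l v 0 l *: A l) *m (\sum_m v 0 m *: B m).
Proof.
rewrite exchange_big /= -sum2_mull; apply: eq_bigr => l _; apply: eq_bigr => m _.
by rewrite mulrC.
Qed.

Lemma gammav_tr p : (gammav p)^T = \sum_l p 0 l *: (gammam l y)^T.
Proof. by rewrite linear_sum; apply: eq_bigr => l _; rewrite linearZ. Qed.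

(** Contraction with [v] in both derivative slots makes the order of l and m immaterial, so every
    mixed term becomes a product of two matrices contracted once. *)
Lemma nabla2vE : \sum_l \sum_m (v 0 l * v 0 m) *: nabla2_mx l m =
  (ddmxv - dgammav^T *m W y - (gammav v)^T *m dmxv v - W y *m dgammav - dmxv v *m gammav v)
  - nablav gamma2 - (gammav v)^T *m nablav v - nablav v *m gammav v.
Proof.
have dgl : dgammav^T *m W y = \sum_l \sum_m (v 0 l * v 0 m) *: ((dgammam l m)^T *m W y).
  rewrite linear_sum mulmx_suml; apply: eq_bigr => l _.
  rewrite linear_sum mulmx_suml; apply: eq_bigr => m _.
  by rewrite linearZ /= -scalemxAl.
have dgr : W y *m dgammav = \sum_l \sum_m (v 0 l * v 0 m) *: (W y *m dgammam l m).
  rewrite mulmx_sumr; apply: eq_bigr => l _; rewrite mulmx_sumr; apply: eq_bigr => m _.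
  by rewrite -scalemxAr.
have n2 : nablav gamma2 = \sum_l \sum_m (v 0 l * v 0 m) *:
    \sum_c christoffel G c l m y *: nabla_mx W c y.
  under [RHS]eq_bigr do under eq_bigr do rewrite scaler_sumr.
  under [RHS]eq_bigr do rewrite exchange_big /=.
  rewrite exchange_big /=; apply: eq_bigr => c _; rewrite mxE scaler_suml.
  apply: eq_bigr => l _; rewrite scaler_suml; apply: eq_bigr => m _.
  by rewrite scalerA.
have e1 : (gammav v)^T *m dmxv v =
    \sum_l \sum_m (v 0 l * v 0 m) *: ((gammam m y)^T *m dmx l W y).
  by rewrite gammav_tr [RHS](sum2_mulr (fun l => (gammam l y)^T) (fun l => dmx l W y)).
have e2 : dmxv v *m gammav v =
    \sum_l \sum_m (v 0 l * v 0 m) *: (dmx l W y *m gammam m y).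
  by rewrite [RHS](sum2_mull (fun l => dmx l W y) (fun l => gammam l y)).
have e3 : (gammav v)^T *m nablav v =
    \sum_l \sum_m (v 0 l * v 0 m) *: ((gammam l y)^T *m nabla_mx W m y).
  by rewrite gammav_tr [RHS](sum2_mull (fun l => (gammam l y)^T) (fun l => nabla_mx W l y)).
have e4 : nablav v *m gammav v =
    \sum_l \sum_m (v 0 l * v 0 m) *: (nabla_mx W m y *m gammam l y).
  by rewrite [RHS](sum2_mulr (fun l => nabla_mx W l y) (fun l => gammam l y)).
rewrite dgl dgr n2 e1 e2 e3 e4.
rewrite /ddmxv -!sumrB; apply: eq_bigr => l _; rewrite -!sumrB; apply: eq_bigr => m _.
by rewrite nabla2_mxE !scalerBr.
Qed.

Variable E : 'M[R]_n.

(* Second-order Taylor polynomials of the parallel transport of [E] and of the geodesic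
   with initial velocity [v]. *)
Definition frame_d1 : 'M[R]_n := - gammav v *m E.
Definition frame_d2 : 'M[R]_n :=
  2^-1 *: ((gammav gamma2 + gammav v *m gammav v - dgammav) *m E).
Definition frame_curve t : 'M[R]_n := E + t *: frame_d1 + t ^+ 2 *: frame_d2.
Definition geod t := quad_curve y v (- 2^-1 *: gamma2) t.

(** Along a geodesic and in a parallel frame covariant derivatives are ordinary ones. Agreement to
    second order suffices, and there it is an identity between matrices. *)
Lemma mjet_along : mjet (fun t => (frame_curve t)^T *m W (geod t) *m frame_curve t)
  (E^T *m W y *m E) (E^T *m nablav v *m E)
  (2^-1 *: (E^T *m (\sum_l \sum_m (v 0 l * v 0 m) *: nabla2_mx l m) *m E)).
Proof.
have jW : mjet (fun t => W (geod t)) (W y) (dmxv v) (2^-1 *: (ddmxv - dmxv gamma2)).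
  move=> a b; apply: jet_eq (jet_quad_curve oU v (- 2^-1 *: gamma2) (W2 a b) Uy) _ _ _ => //.
  - by rewrite summxE; apply: eq_bigr => l _; rewrite !mxE.
  - rewrite [RHS]mx_scaleE mx_addE mx_oppE mulrBr addrC; congr (_ + _).
      congr (_ * _); rewrite summxE; apply: eq_bigr => l _; rewrite summxE.
      by apply: eq_bigr => m _; rewrite !mxE.
    rewrite summxE mulr_sumr -sumrN; apply: eq_bigr => l _.
    by rewrite !mx_scaleE [dmx _ _ _ _ _]mxE; ring.
have jF : mjet frame_curve E frame_d1 frame_d2 by exact: mjet_poly.
pose g := gammav v; pose w := W y; pose w1 := dmxv v.
pose h := 2^-1 *: (gammav gamma2 + g *m g - dgammav).
have f1 : frame_d1 = - g *m E by [].
have f2 : frame_d2 = h *m E by rewrite /frame_d2 -scalemxAl.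
apply: mjet_eq (mjet_conj jF jW) _ _ _ => //.
- rewrite nablavE f1 -/g -/w -/w1 trmx_mul trmxN.
  rewrite !(mulmxDr, mulmxDl, mulmxN, mulNmx, mulmxA).
  by apply/matrixP => i j; rewrite !(mx_addE, mx_oppE); ring.
rewrite f1 f2 -/w -/w1.
have -> : E^T *m w *m (h *m E) + (E^T *m w1 + (- g *m E)^T *m w) *m (- g *m E) +
   (E^T *m (2^-1 *: (ddmxv - dmxv gamma2)) + (- g *m E)^T *m w1 + (h *m E)^T *m w) *m E =
   E^T *m (w *m h - (w1 - g^T *m w) *m g + 2^-1 *: (ddmxv - dmxv gamma2) - g^T *m w1
     + h^T *m w) *m E.
  rewrite !trmx_mul !trmxN !(mulmxDr, mulmxDl, mulmxN, mulNmx, mulmxA).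
  by apply/matrixP => i j; rewrite !(mx_addE, mx_oppE); ring.
rewrite [RHS]scalemxAl [X in _ = X *m _]scalemxAr; congr (_ *m _ *m _).
rewrite nabla2vE !nablavE -/g -/w -/w1 /h !(trmxZ, trmxD, trmxN) trmx_mul.
rewrite !(mulmxDr, mulmxDl, mulmxN, mulNmx, =^~ scalemxAl, =^~ scalemxAr, mulmxA).
by apply/matrixP => i j; rewrite !(mx_addE, mx_oppE, mx_scaleE); field.
Qed.

End Tensor.

Lemma mjet_along_metric y (v : 'rV[R]_n) (E : 'M[R]_n) : U y -> E^T *m G y *m E = 1%:M ->
  mjet (fun t => (frame_curve y v E t)^T *m G (geod y v t) *m frame_curve y v E t) 1%:M 0 0.
Proof.
move=> Uy oE; apply: mjet_eq (mjet_along G2 Uy v E) _ _ _ => //.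
- rewrite /nablav big1 ?mulmx0 ?mul0mx // => l _.
  suff -> : nabla_mx G l y = 0 by rewrite scaler0.
  by apply/matrixP => a b; rewrite !mxE; exact: nabla_metric.
- rewrite big1 ?mulmx0 ?mul0mx ?scaler0 // => l _; rewrite big1 // => m _.
  suff -> : nabla2_mx G y l m = 0 by rewrite scaler0.
  by apply/matrixP => a b; rewrite !mxE; exact: nabla2_metric.
Qed.

Lemma nabla2_funE (f : 'rV[R]_n -> R) y l m :
  let T : covtensor R n := fun I z => if I is [::] then f z else 0 in
  nabla G (nabla G T) [:: l; m] y =
  partial l (partial m f) y - \sum_c christoffel G c l m y * partial c f y.
Proof.
move=> T; have E c : nabla G T [:: c] = partial c f.
  by apply/funext => z; rewrite /nabla /= big_ord0 subr0.
rewrite {1}/nabla E /= big_ord_recl big_ord0 addr0 /=; congr (_ - _).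
by apply: eq_bigr => c _; rewrite big_ord0 subr0.
Qed.

Lemma jet_along_fun (f : 'rV[R]_n -> R) y (v : 'rV[R]_n) : C_on 2 U f -> U y ->
  jet (fun t => f (geod y v t)) (f y) (\sum_l v 0 l * partial l f y)
   (2^-1 * \sum_l \sum_m v 0 l * v 0 m *
     (partial l (partial m f) y - \sum_c christoffel G c l m y * partial c f y)).
Proof.
move=> f2 Uy; apply: jet_eq (jet_quad_curve oU v _ f2 Uy) _ _ _ => //.
have -> : \sum_l \sum_m v 0 l * v 0 m *
     (partial l (partial m f) y - \sum_c christoffel G c l m y * partial c f y) =
   \sum_l \sum_m v 0 l * v 0 m * partial l (partial m f) y -
   \sum_c gamma2 y v 0 c * partial c f y.
  have -> : \sum_c gamma2 y v 0 c * partial c f y =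
      \sum_l \sum_m v 0 l * v 0 m * \sum_c christoffel G c l m y * partial c f y.
    under [RHS]eq_bigr do under eq_bigr do rewrite mulr_sumr.
    under [RHS]eq_bigr do rewrite exchange_big /=.
    rewrite exchange_big /=; apply: eq_bigr => c _; rewrite mxE mulr_suml.
    apply: eq_bigr => l _; rewrite mulr_suml; apply: eq_bigr => m _; ring.
  by rewrite -sumrB; apply: eq_bigr => l _; rewrite -sumrB; apply: eq_bigr => m _; ring.
rewrite mulrBr addrC; congr (_ + _); rewrite mulr_sumr -sumrN; apply: eq_bigr => c _.
rewrite mx_scaleE; ring.
Qed.

End ChartCovariant.

(** * The pointwise inequality *)

(** The budget behind [error_const]. The y^2 terms total 5/4 + 5/16 + 1/4 = 29/16, within the 2
    available; the K^2 terms total 25/4, rounded up to 7. Each nonlinear product has its own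
    hypothesis, which makes the problem linear. *)
Lemma direction_arith (R : realFieldType) (A K s D v y S2 S1 nd N e1 w : R) :
  e1 * w <= 5 / 4 * (y ^+ 2 + 2 * v * D + D ^+ 2) ->
  4 * A * s * v <= y ^+ 2 / 4 + 16 * A ^+ 2 * s ^+ 2 ->
  2 * v * D <= y ^+ 2 / 4 + 4 * D ^+ 2 ->
  0 <= y ^+ 2 ->
  4 * A * s * S1 <= 2 * S2 + N * (4 * A ^+ 2 * s ^+ 2) ->
  4 * A * s * nd <= 4 * A * s * v + 4 * A * s * S1 + 4 * N * A * K * s ^+ 2 ->
  s * D <= K * s ^+ 2 ->
  D ^+ 2 <= K ^+ 2 * s ^+ 2 ->
  0 <= K ^+ 2 * s ^+ 2 -> 0 <= A ^+ 2 * s ^+ 2 -> 0 <= N * (A ^+ 2 * s ^+ 2) ->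
  0 <= N * A * K * s ^+ 2 ->
  e1 * w + (s * D + 4 * A * s * nd) <= 2 * y ^+ 2 + 2 * S2 +
  (7 * K ^+ 2 + K + 16 * A ^+ 2 + 4 * N * A ^+ 2 + 4 * N * A * K) * s ^+ 2.
Proof.
move=> we yb yD y0 ub ndA sD DD t1 t2 t3 t4.
lra.
Qed.

Lemma block_arith (R : realFieldType) (A K s D S2 nd N e1 w : R) :
  e1 * w <= 5 / 4 * D ^+ 2 -> 4 * A * s * nd <= 0 -> 0 <= S2 ->
  s * D <= K * s ^+ 2 -> D ^+ 2 <= K ^+ 2 * s ^+ 2 ->
  0 <= K ^+ 2 * s ^+ 2 -> 0 <= A ^+ 2 * s ^+ 2 -> 0 <= N * (A ^+ 2 * s ^+ 2) ->
  0 <= N * A * K * s ^+ 2 ->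
  e1 * w + (s * D + 4 * A * s * nd) <= 2 * S2 +
  (7 * K ^+ 2 + K + 16 * A ^+ 2 + 4 * N * A ^+ 2 + 4 * N * A * K) * s ^+ 2.
Proof.
move=> we nd0 S0 sD DD t1 t2 t3 t4.
lra.
Qed.

Section FinalAlgebra.
Variable R : realType.

(** [K] is such that A (1 + |W|) <= K (1 + lambda_1), because |W| <= n lambda_1 for positive
    eigenvalues. *)
Definition error_const (n : nat) (A : R) : R :=
  let K := A * (n%:R + 1) in 7 * K ^+ 2 + K + 16 * A ^+ 2 + 4 * n%:R * A ^+ 2 + 4 * n%:R * A * K.

(** In the application w m i j is nabla_m w_ij, a m is nabla^2_mm w_zz, b m is nabla^2_zz w_mm, nd m
    is |nabla w_zm| and NW is |W|; p1, p2 are derivatives of phi, f0, f1, f2 those of f in direction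
    z, and e0 is the surplus 1/(2kn). *)
Variables (n : nat) (z : 'I_n) (l F a b p1 p2 : 'I_n -> R) (w : 'I_n -> 'I_n -> 'I_n -> R).
Variables (nd : 'I_n -> R) (A NW f0 f1 f2 e0 e : R).
Hypothesis l0 : forall i, 0 < l i.
Hypothesis lz : forall i, l i <= l z.
Hypothesis F0 : forall i, 0 <= F i.
Hypothesis f00 : 0 < f0.
Hypothesis A0 : 0 < A.
Hypothesis wsym : forall m i j, w m i j = w m j i.
Hypothesis codazzi : forall i j m, `|w m i j - w i j m| <= A * (1 + NW).
Hypothesis commute : forall m, `|a m - b m| <= A * (1 + NW + nd m + nd m + nd m + nd m).
Hypothesis az : a z = b z.
Hypothesis ndw : forall m, nd m <= \sum_p `|w p z m|.
Hypothesis NW0 : 0 <= NW.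
Hypothesis NWl : NW <= n%:R * l z.
Hypothesis block : forall m i j, l i = l z -> l j = l z -> w m i j = (1 + l z) * p1 m * (i == j)%:R.
Hypothesis touch : forall m,
  a m + 2 * (\sum_(p | l p < l z) w m z p ^+ 2 / (l z - l p)) <= (1 + l z) * (p2 m + p1 m ^+ 2).
Hypothesis equation :
  f2 <= f1 ^+ 2 / f0 + \sum_i F i * b i - (1 + e0) * (F z * w z z z ^+ 2 / l z)
    - 2 * \sum_(p | l p < l z) (F p - F z) * w z z p ^+ 2 / (l z - l p).
Hypothesis e_gt0 : 0 < e.
Hypothesis e_le : e <= e0.
Hypothesis e_le4 : e <= 4^-1.

Let s := 1 + l z.
Let D := A * (1 + NW).
Let K := A * (n%:R + 1).

Let s1 : 1 < s. Proof. by rewrite ltrDl. Qed.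
Let s0 : 0 < s. Proof. exact: lt_trans ltr01 s1. Qed.
Let n0 : 0 <= n%:R :> R. Proof. exact: ler0n. Qed.
Let D0 : 0 <= D. Proof. by rewrite mulr_ge0 ?addr_ge0 // ltW. Qed.
Let K0 : 0 <= K. Proof. by rewrite mulr_ge0 ?addr_ge0 // ltW. Qed.

Let DK : D <= K * s.
Proof.
rewrite /D /K -mulrA ler_pM2l //; apply: le_trans (lerD (lexx 1) NWl) _.
rewrite /s; have := mulr_ge0 n0 (ltW (l0 z)); have := l0 z; have := n0; nra.
Qed.

Let DD : D ^+ 2 <= K ^+ 2 * s ^+ 2.
Proof. by rewrite -exprMn !expr2; exact: ler_pM D0 D0 DK DK. Qed.

(** Codazzi replaces nabla_m w_zz by y = nabla_z w_zm up to [D]. Below the top eigenspace 2 y^2 and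
    the squares of nabla_m w_zp absorb everything; inside it [block] annihilates y and all of nabla
    w_zm. *)
Lemma direction_bound m : m != z ->
  (1 + e) * w m z z ^+ 2 + s * (A * (1 + NW + nd m + nd m + nd m + nd m)) <=
  (if l m < l z then 2 * w z z m ^+ 2 else 0) + 2 * (\sum_(p | l p < l z) w m z p ^+ 2)
    + error_const n A * s ^+ 2.
Proof.
move=> mz; set y := w z z m.
have wy : `|w m z z| <= `|y| + D.
  have := codazzi z z m; rewrite -/y -/D => H.
  have := ler_normD (w m z z - y) y; rewrite subrK; lra.
have w2 : w m z z ^+ 2 <= (`|y| + D) ^+ 2.
  by rewrite -[w m z z ^+ 2]real_normK ?num_real // ler_pXn2r ?nnegrE ?addr_ge0.
have y2 : `|y| ^+ 2 = y ^+ 2 by rewrite real_normK ?num_real.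
have S0 : 0 <= \sum_(p | l p < l z) w m z p ^+ 2 by apply: sumr_ge0 => p _; exact: sqr_ge0.
have sD : s * D <= K * s ^+ 2 by have := ler_wpM2l (ltW s0) DK; nra.
have E0 : s * (A * (1 + NW + nd m + nd m + nd m + nd m)) = s * D + 4 * A * s * nd m.
  by rewrite /D; ring.
have As : 0 <= A * s by rewrite mulr_ge0 ?ltW.
rewrite E0 /error_const -/K.
have t1 : 0 <= K ^+ 2 * s ^+ 2 by rewrite mulr_ge0 ?sqr_ge0.
have t2 : 0 <= A ^+ 2 * s ^+ 2 by rewrite mulr_ge0 ?sqr_ge0.
have t3 : 0 <= n%:R * (A ^+ 2 * s ^+ 2) by rewrite mulr_ge0.
have t4 : 0 <= n%:R * A * K * s ^+ 2 by rewrite !mulr_ge0 ?sqr_ge0 // ltW.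
have ny := normr_ge0 y.
have we : (1 + e) * w m z z ^+ 2 <= 5 / 4 * (`|y| + D) ^+ 2.
  have e54 : 1 + e <= 5 / 4 by have := e_le4; lra.
  by apply: ler_pM w2 => //; [rewrite addr_ge0 // ltW|exact: sqr_ge0].
case: (ltrP (l m) (l z)) => lm.
(* For p <> z, nabla_p w_zm is traded for nabla_m w_zp by Codazzi; the latter is zero when p belongs
   to the top eigenspace. *)
- have ndb : nd m <= `|y| + (\sum_(p | l p < l z) `|w m z p| + n%:R * D).
    apply: le_trans (ndw m) _; rewrite (bigD1 z) //= lerD2l.
    apply: (@le_trans _ _ (\sum_(p | p != z) ((if l p < l z then `|w m z p| else 0) + D))).
      apply: ler_sum => p pz; have := codazzi m z p; rewrite -/D (wsym p) => H.
      have H2 : `|w p z m| <= `|w m z p| + D.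
        by have := ler_normD (w p z m - w m z p) (w m z p); rewrite subrK; lra.
      case: ltrP => lp //.
      have lpz : l p = l z by apply/eqP; rewrite eq_le lz lp.
      have := block m (erefl (l z)) lpz; rewrite eq_sym (negbTE pz) mulr0 => E.
      by move: H2; rewrite E normr0.
    rewrite big_split /=; apply: lerD.
      rewrite [X in _ <= X]big_mkcond /= [X in _ <= X](bigD1 z) //= ltxx add0r.
      exact: lexx.
    rewrite sumr_const -[X in X <= _]mulr_natl ler_wpM2r // ler_nat.
    by rewrite -[X in (_ <= X)%N]card_ord max_card.
  have ub : 4 * A * s * (\sum_(p | l p < l z) `|w m z p|) <=
     2 * (\sum_(p | l p < l z) w m z p ^+ 2) + n%:R * (4 * A ^+ 2 * s ^+ 2).
    apply: (@le_trans _ _ (\sum_(p | l p < l z) (2 * w m z p ^+ 2 + 4 * A ^+ 2 * s ^+ 2))).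
      rewrite mulr_sumr; apply: ler_sum => p _.
      rewrite -[w m z p ^+ 2]real_normK ?num_real //.
      have := sqr_ge0 (`|w m z p| - 2 * A * s); have := sqr_ge0 `|w m z p|; nra.
    rewrite big_split /= -mulr_sumr lerD2l sumr_const -[X in X <= _]mulr_natl.
    rewrite ler_wpM2r //; first by rewrite -mulrA mulr_ge0.
    by rewrite ler_nat -[X in (_ <= X)%N]card_ord max_card.
  have ndA : 4 * A * s * nd m <= 4 * A * s * `|y| + 4 * A * s * (\sum_(p | l p < l z) `|w m z p|)
      + 4 * n%:R * A * K * s ^+ 2.
    have As4 : 0 <= 4 * A * s by rewrite -mulrA mulr_ge0.
    have := ler_wpM2l As4 ndb.
    have := ler_wpM2l (mulr_ge0 As4 n0) DK.
    nra.
  have yb : 4 * A * s * `|y| <= y ^+ 2 / 4 + 16 * A ^+ 2 * s ^+ 2.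
    rewrite -y2; have := sqr_ge0 (`|y| / 2 - 4 * A * s); nra.
  have yD : 2 * `|y| * D <= y ^+ 2 / 4 + 4 * D ^+ 2.
    rewrite -y2; have := sqr_ge0 (`|y| / 2 - 2 * D); nra.
  have y0 : 0 <= y ^+ 2 by exact: sqr_ge0.
  have E1 : (`|y| + D) ^+ 2 = y ^+ 2 + 2 * `|y| * D + D ^+ 2 by rewrite -y2; ring.
  rewrite E1 in we.
  exact: (direction_arith we yb yD y0 ub ndA sD DD t1 t2 t3 t4).
- have lmz : l m = l z by apply/eqP; rewrite eq_le lz lm.
  have w0 p : w p z m = 0 by rewrite block // eq_sym (negbTE mz) mulr0.
  have nd0 : nd m <= 0 by apply: le_trans (ndw m) _; rewrite big1 // => p _; rewrite w0 normr0.
  have yz : y = 0 by exact: w0.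
  rewrite yz normr0 add0r in we.
  have nd1 : 4 * A * s * nd m <= 0.
    by rewrite -!mulrA mulr_ge0_le0 // mulrA mulr_ge0_le0.
  have wyz : (1 + e) * w m z z ^+ 2 <= 5 / 4 * D ^+ 2 := we.
  rewrite add0r; exact: (block_arith wyz nd1 S0 sD DD t1 t2 t3 t4).
Qed.

Lemma final_algebra :
  \sum_m F m * p2 m >= e * (\sum_m F m * p1 m ^+ 2) - error_const n A * (\sum_m F m)
    - f1 ^+ 2 / (f0 * s) - `|f2| / s.
Proof.
set C := error_const n A.
pose T m := \sum_(p | l p < l z) w m z p ^+ 2 / (l z - l p).
have wp m : w m z z = s * p1 m by rewrite block // eqxx mulr1.
have touchm m : F m * (a m + 2 * T m - w m z z ^+ 2 / s) <= s * (F m * p2 m).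
  rewrite [X in _ <= X]mulrCA; apply: ler_wpM2l => //.
  have := touch m; rewrite -/s -/(T m) wp exprMn (_ : s ^+ 2 * _ / s = s * p1 m ^+ 2).
    by lra.
  by field; rewrite gt_eqF.
have inv_ge p (x : R) : l p < l z -> x ^+ 2 / s <= x ^+ 2 / (l z - l p).
  move=> lp; apply: ler_wpM2l; first exact: sqr_ge0.
  by rewrite lef_pV2 ?posrE ?subr_gt0 // /s; have := l0 p; lra.
have Tge m : (\sum_(p | l p < l z) w m z p ^+ 2) / s <= T m.
  by rewrite mulr_suml; apply: ler_sum => p lp; exact: inv_ge.
pose Y m := if l m < l z then w z z m ^+ 2 / (l z - l m) else 0.
have key m : m != z -> F m * ((1 + e) * w m z z ^+ 2 / s - C * s) <=
   F m * (a m - b m + 2 * T m + 2 * Y m).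
  move=> mz; apply: ler_wpM2l => //.
  have := direction_bound mz; rewrite -/C.
  set X := (1 + e) * _; set B := A * _; set I1 := (if _ then _ else _).
  set S2 := \sum_(p | _) _ => H.
  have {}H : X / s + B <= I1 / s + 2 * (S2 / s) + C * s.
    rewrite (_ : X / s + B = (X + s * B) / s); last by field; rewrite gt_eqF.
    rewrite (_ : _ + _ + _ = (I1 + 2 * S2 + C * s ^+ 2) / s); last by field; rewrite gt_eqF.
    by rewrite ler_pM2r // invr_gt0.
  have Ym : I1 / s <= 2 * Y m.
    rewrite /Y /I1; case: ifP => lm; last by rewrite mul0r mulr0.
    by rewrite -mulrA ler_pM2l // inv_ge.
  have := commute m; rewrite ler_norml -/B => /andP[H1 _].
  have := Tge m; rewrite -/S2; lra.
(* The part carrying [F z] cancels the term 2 F_z T_z that [touch] gives in direction z; the other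
   part is consumed by [key]. *)
have sumY : \sum_(p | l p < l z) (F p - F z) * w z z p ^+ 2 / (l z - l p) =
   \sum_(m | m != z) F m * Y m - F z * T z.
  have -> : \sum_(m | m != z) F m * Y m = \sum_(p | l p < l z) F p * (w z z p ^+ 2 / (l z - l p)).
    rewrite [RHS]big_mkcond /= [RHS](bigD1 z) //= ltxx add0r; apply: eq_bigr => m _.
    by rewrite /Y; case: ifP => // _; rewrite mulr0.
  by rewrite /T mulr_sumr -sumrB; apply: eq_bigr => p _; ring.
have eqn := equation; rewrite sumY in eqn.
have total : \sum_m F m * (a m + 2 * T m - w m z z ^+ 2 / s) <= s * \sum_m F m * p2 m.
  by rewrite mulr_sumr; apply: ler_sum.
have keysum : \sum_(m | m != z) F m * ((1 + e) * w m z z ^+ 2 / s - C * s) <=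
   \sum_(m | m != z) F m * (a m - b m + 2 * T m + 2 * Y m) by exact: ler_sum.
(* The direction z, where only the surplus [e0] is available; it survives the replacement of l_z by
   s. *)
have zb : F z * ((1 + e) * w z z z ^+ 2 / s) <= (1 + e0) * (F z * w z z z ^+ 2 / l z).
  have -> : (1 + e0) * (F z * w z z z ^+ 2 / l z) = F z * ((1 + e0) * w z z z ^+ 2 / l z) by ring.
  apply: ler_wpM2l => //; rewrite -(mulrA (1 + e)) -(mulrA (1 + e0)); apply: ler_pM.
  - by rewrite addr_ge0 // ltW.
  - by apply: mulr_ge0; [exact: sqr_ge0|rewrite invr_ge0 ltW].
  - by rewrite lerD2l.
  - apply: ler_wpM2l; first exact: sqr_ge0.
    by rewrite lef_pV2 ?posrE // /s; lra.
have E1 : \sum_m F m * (a m + 2 * T m - w m z z ^+ 2 / s) =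
   F z * (a z + 2 * T z - w z z z ^+ 2 / s) +
   (\sum_(m | m != z) F m * (a m - b m + 2 * T m + 2 * Y m) + \sum_(m | m != z) F m * b m
    - 2 * (\sum_(m | m != z) F m * Y m) - \sum_(m | m != z) F m * w m z z ^+ 2 / s).
  rewrite (bigD1 z) //=; congr (_ + _).
  by rewrite mulr_sumr -big_split -!sumrB /=; apply: eq_bigr => m _; ring.
have E2 : \sum_(m | m != z) F m * ((1 + e) * w m z z ^+ 2 / s - C * s) =
   \sum_(m | m != z) F m * w m z z ^+ 2 / s + e * (\sum_(m | m != z) F m * w m z z ^+ 2 / s)
    - C * s * (\sum_(m | m != z) F m).
  by rewrite !mulr_sumr -big_split -sumrB /=; apply: eq_bigr => m _; ring.
have E3 : \sum_i F i * b i = F z * b z + \sum_(m | m != z) F m * b m by rewrite (bigD1 z).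
have E4 : \sum_m F m = F z + \sum_(m | m != z) F m by rewrite (bigD1 z).
have E5 : s * (\sum_m F m * p1 m ^+ 2) =
    F z * w z z z ^+ 2 / s + \sum_(m | m != z) F m * w m z z ^+ 2 / s.
  rewrite mulr_sumr (bigD1 z) //=; congr (_ + _); [|apply: eq_bigr => m _].
    by rewrite wp; field; rewrite gt_eqF.
  by rewrite wp; field; rewrite gt_eqF.
have C0 : 0 <= C.
  have n0' := n0; have A0' := ltW A0.
  rewrite /C /error_const -/K; have K0' := K0.
  by rewrite !addr_ge0 ?mulr_ge0 ?sqr_ge0.
have CF : 0 <= C * s * F z by rewrite !mulr_ge0 // ltW.
rewrite -(ler_pM2l s0).
have -> : s * (e * (\sum_m F m * p1 m ^+ 2) - C * (\sum_m F m) - f1 ^+ 2 / (f0 * s) - `|f2| / s) =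
   e * (s * (\sum_m F m * p1 m ^+ 2)) - C * s * (\sum_m F m) - f1 ^+ 2 / f0 - `|f2|.
  by field; rewrite !gt_eqF.
apply: le_trans total; rewrite E1.
have := ler_norm (- f2); rewrite normrN => nf2.
rewrite E2 in keysum; rewrite E3 in eqn; rewrite E4 E5 az.
have zb' : F z * ((1 + e) * w z z z ^+ 2 / s) = F z * w z z z ^+ 2 / s + e * (F z * w z z z ^+ 2 / s).
  by ring.
rewrite zb' in zb.
have zz : F z * (b z + 2 * T z - w z z z ^+ 2 / s) = F z * b z + 2 * (F z * T z) - F z * w z z z ^+ 2 / s.
  by ring.
rewrite zz; lra.
Qed.

End FinalAlgebra.

(** * The estimate on the manifold *)

Lemma sqrtr_le_nneg (R : rcfType) (X Y : R) : 0 <= Y -> X <= Y ^+ 2 -> Num.sqrt X <= Y.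
Proof. by move=> Y0 XY; rewrite -(ger0_norm Y0) -sqrtr_sqr ler_wsqrtr. Qed.

Lemma sum_sqr_le (R : realDomainType) n (h : 'I_n -> R) :
  \sum_p h p ^+ 2 <= (\sum_p `|h p|) ^+ 2.
Proof.
rewrite [X in _ <= X]expr2 mulr_suml; apply: ler_sum => p _.
rewrite -[h p ^+ 2]real_normK ?num_real // expr2 ler_wpM2l //.
by rewrite (bigD1 p) //= lerDl sumr_ge0.
Qed.

Section Chart.
Local Notation coord := Defs.coord.
Variables (R : realType) (n : nat) (M : manifold R n) (g : riemannian_metric M).
Variables (i : chart M).

Let V : set 'rV[R]_n := coord i @` dom i.

Lemma chart_open : open V. Proof. exact: coord_open. Qed.

Lemma param_dom y : V y -> dom i (param i y) /\ coord i (param i y) = y.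
Proof. by case=> x xi <-; rewrite coordK. Qed.

Lemma param_image (U : set M) y : (coord i @` (dom i `&` U)) y -> V y /\ U (param i y).
Proof. by case=> x [xi Ux] <-; rewrite coordK //; split=> //; exists x. Qed.

Lemma image_open (U : set M) : open U -> open (coord i @` (dom i `&` U)).
Proof.
move=> oU; rewrite openE => y Uy; have [Vy Up] := param_image Uy.
have nV : \forall z \near y, V z by apply: open_nbhs_nbhs; split; [exact: chart_open|].
have nU : \forall z \near y, U (param i z).
  by apply: (param_continuous Vy); apply: open_nbhs_nbhs; split.
rewrite /interior /=; near=> z.
have Vz : V z by near: z.
have [pd cz] := param_dom Vz; exists (param i z) => //; split => //.
by near: z.
Unshelve. all: end_near. Qed.

Lemma tensor_sym (W : sym2_tensor M) y : V y -> (W i y)^T = W i y.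
Proof. by case=> x xi <-; exact: tcomp_sym. Qed.

Lemma tensor_C2 (W : sym2_tensor M) a b : C_on 2 V (fun y => W i y a b).
Proof. exact: tcomp_smooth. Qed.

Lemma metric_unit y : V y -> g i y \in unitmx.
Proof.
case=> x xi <-; rewrite unitmxE unitfE; apply/eqP => /eqP/det0P[v v0 vG].
by have := metric_pos g xi v0; rewrite vG mul0mx mxE ltxx.
Qed.

(** Orthonormality says that E^T g is inverse to E, so the matrix of W in the frame is conjugate to
    g^-1 W. *)
Lemma frame_char_poly y (E : 'M[R]_n) (W : sym2_tensor M) : V y ->
  E^T *m g i y *m E = 1%:M ->
  char_poly (E^T *m W i y *m E) = char_poly (invmx (g i y) *m W i y).
Proof.
move=> Vy oE; have -> : E^T *m W i y *m E = (E^T *m g i y) *m (invmx (g i y) *m W i y) *m E.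
  by rewrite -!mulmxA; congr (_ *m _); rewrite mulKVmx ?metric_unit.
exact: char_poly_conj.
Qed.

Variables (x : M) (xi : dom i x).

Definition frame_dir (E : 'M[R]_n) m : 'rV[R]_n := (col m E)^T.

Lemma frame_dirE (E : 'M[R]_n) m c : frame_dir E m 0 c = E c m.
Proof. by rewrite !mxE. Qed.

Lemma conj_entry (E B : 'M[R]_n) a b :
  (E^T *m B *m E) a b = \sum_d E d a * \sum_e E e b * B d e.
Proof.
rewrite -mulmxA mxE; apply: eq_bigr => d _; rewrite !mxE; congr (_ * _).
by apply: eq_bigr => e _; rewrite mulrC.
Qed.

Lemma nabla_comp1E (W : sym2_tensor M) E l a b :
  nabla_comp g i x E 1 (sym2_cov i W) [:: l; a; b] =
  (E^T *m nablav (g i) (W i) (coord i x) (frame_dir E l) *m E) a b.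
Proof.
rewrite /nablav mulmx_sumr mulmx_suml summxE /nabla_comp /=.
apply: eq_bigr => c _; rewrite -scalemxAr -scalemxAl mx_scaleE frame_dirE conj_entry.
congr (_ * _); apply: eq_bigr => d _; congr (_ * _); apply: eq_bigr => e _.
by rewrite mxE.
Qed.

Lemma nabla_comp2E (W : sym2_tensor M) E m a b :
  nabla_comp g i x E 2 (sym2_cov i W) [:: m; m; a; b] =
  (E^T *m (\sum_c \sum_d (frame_dir E m 0 c * frame_dir E m 0 d) *:
     nabla2_mx (g i) (W i) (coord i x) c d) *m E) a b.
Proof.
rewrite mulmx_sumr mulmx_suml summxE /nabla_comp /=.
apply: eq_bigr => c _; rewrite mulmx_sumr mulmx_suml summxE mulr_sumr.
apply: eq_bigr => d _; rewrite -scalemxAr -scalemxAl mx_scaleE !frame_dirE conj_entry -mulrA.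
congr (_ * (_ * _)); apply: eq_bigr => a' _; congr (_ * _); apply: eq_bigr => e _.
by rewrite mxE.
Qed.

Lemma frame_mxE (W : sym2_tensor M) E : frame_mx g i x E W = E^T *m W i (coord i x) *m E.
Proof. by apply/matrixP => a b; rewrite mxE conj_entry. Qed.

Lemma nabla_comp1_fun (f : M -> R) E m : nabla_comp g i x E 1 (fun_cov i f) [:: m] =
  \sum_c E c m * partial c (fun y => f (param i y)) (coord i x).
Proof.
rewrite /nabla_comp /=; apply: eq_bigr => c _; congr (_ * _).
by rewrite /nabla /= big_ord0 subr0.
Qed.

Lemma nabla_comp2_fun (f : M -> R) E a b : nabla_comp g i x E 2 (fun_cov i f) [:: a; b] =
  \sum_c \sum_d E c a * E d b *
   (partial c (partial d (fun y => f (param i y))) (coord i x)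
    - \sum_e christoffel (g i) e c d (coord i x) * partial e (fun y => f (param i y)) (coord i x)).
Proof.
rewrite /nabla_comp /=; apply: eq_bigr => c _; rewrite mulr_sumr; apply: eq_bigr => d _.
by rewrite -(nabla2_funE (g i) (fun y => f (param i y))) -mulrA.
Qed.

Lemma jet_function (U : set 'rV[R]_n) (f : M -> R) E m : open U ->
  C_on 2 U (fun y => f (param i y)) -> U (coord i x) ->
  jet (fun t => f (param i (geod (g i) (coord i x) (frame_dir E m) t))) (f x)
    (nabla_comp g i x E 1 (fun_cov i f) [:: m])
    (2^-1 * nabla_comp g i x E 2 (fun_cov i f) [:: m; m]).
Proof.
move=> oU fU Ux; apply: jet_eq (jet_along_fun (g i) oU (frame_dir E m) fU Ux) _ _ _.
- by rewrite coordK.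
- by rewrite nabla_comp1_fun; apply: eq_bigr => c _; rewrite frame_dirE.
- rewrite nabla_comp2_fun; congr (_ * _); apply: eq_bigr => c _; apply: eq_bigr => d _.
  by rewrite !frame_dirE.
Qed.

Lemma geod_near (U : set 'rV[R]_n) (v : 'rV[R]_n) : open U -> U (coord i x) ->
  \forall t \near (0 : R), U (geod (g i) (coord i x) v t).
Proof. by move=> oU Ux; exact: quad_curve_near. Qed.

Variables (W : sym2_tensor M) (lam : M -> n.-tuple R).
Hypothesis specW : forall i x, dom i x -> is_spectrum (raise_index g W i x) (lam x).
Variable E : 'M[R]_n.
Hypothesis oE : orthonormal_frame g i x E.

Let Vx : V (coord i x). Proof. by exists x. Qed.

(* [N] is the matrix of [W] in frames along the curve that are orthonormalised, which
   does not change their 2-jet since the metric is parallel. *)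
Lemma geodesic_restriction m : exists N : R -> 'M[R]_n,
  [/\ forall t, (N t)^T = N t,
      mjet N (frame_mx g i x E W)
       (\matrix_(a, b) nabla_comp g i x E 1 (sym2_cov i W) [:: m; a; b])
       (2^-1 *: \matrix_(a, b) nabla_comp g i x E 2 (sym2_cov i W) [:: m; m; a; b]) &
      \forall t \near (0 : R),
        is_spectrum (N t) (lam (param i (geod (g i) (coord i x) (frame_dir E m) t)))].
Proof.
set v := frame_dir E m; set c := geod _ _ _.
pose Fr := frame_curve (g i) (coord i x) v E.
have G2 a b := tensor_C2 g a b.
have jG : mjet (fun t => (Fr t)^T *m g i (c t) *m Fr t) 1%:M 0 0.
  exact: (mjet_along_metric chart_open G2 (tensor_sym g) metric_unit v Vx oE).
have Vc : \forall t \near (0 : R), V (c t) by exact: geod_near chart_open Vx.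
have [K [jK KG]] : exists K : R -> 'M[R]_n, mjet K 1%:M 0 0 /\
    \forall t \near (0 : R), (K t)^T *m ((Fr t)^T *m g i (c t) *m Fr t) *m K t = 1%:M.
  apply: mjet_orthonormalise jG.
  by near=> t; apply: trmx_conj; apply: tensor_sym; near: t.
pose N0 t := (K t)^T *m ((Fr t)^T *m W i (c t) *m Fr t) *m K t.
have N0E t : N0 t = (Fr t *m K t)^T *m W i (c t) *m (Fr t *m K t).
  by rewrite /N0 trmx_mul !mulmxA.
have N0sym : \forall t \near (0 : R), (N0 t)^T = N0 t.
  near=> t; apply: trmx_conj; apply: trmx_conj; apply: tensor_sym; near: t; exact: Vc.
have jN0 : mjet N0 (frame_mx g i x E W)
       (\matrix_(a, b) nabla_comp g i x E 1 (sym2_cov i W) [:: m; a; b])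
       (2^-1 *: \matrix_(a, b) nabla_comp g i x E 2 (sym2_cov i W) [:: m; m; a; b]).
  have jW := mjet_along chart_open G2 metric_unit (tensor_C2 W) Vx v E.
  apply: mjet_eq (mjet_conj jK jW) _ _ _.
  - by rewrite trmx1 mul1mx mulmx1 frame_mxE.
  - rewrite trmx1 !trmx0 !mul1mx !mulmx0 !mul0mx add0r addr0 mulmx1.
    by apply/matrixP => a b; rewrite [RHS]mxE nabla_comp1E.
  - rewrite trmx1 !trmx0 !mul1mx !mulmx0 !mul0mx !add0r !addr0 mulmx1.
    by apply/matrixP => a b; rewrite !mx_scaleE [X in _ = _ * X]mxE nabla_comp2E.
(* [N0 t] is known to be symmetric only while the curve stays in the chart; the modification gives
   symmetry at every t and does not change the germ at 0. *)
pose N t := if (N0 t)^T == N0 t then N0 t else 0.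
have NE : \forall t \near (0 : R), N t = N0 t.
  by near=> t; rewrite /N ifT //; apply/eqP; near: t.
exists N; split.
- by move=> t; rewrite /N; case: eqP => // _; rewrite trmx0.
- move=> a b; apply: jet_near (jN0 a b); near=> t.
  by congr (fun_of_matrix _ a b); near: t.
- near=> t.
  have -> : N t = N0 t by near: t.
  have Vt : V (c t) by near: t.
  have [pd cp] := param_dom Vt.
  have := specW pd; rewrite /raise_index cp; apply: is_spectrum_conj.
  rewrite N0E frame_char_poly // trmx_mul.
  rewrite -[LHS]/(_ *m _ *m _ *m _) !mulmxA.
  have : (K t)^T *m ((Fr t)^T *m g i (c t) *m Fr t) *m K t = 1%:M by near: t.
  by rewrite !mulmxA.
Unshelve. all: end_near. Qed.

Variable k : nat.
Hypothesis hk : (1 <= k <= n - 1)%N.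
Variable f : M -> R.
Hypothesis gammaW : forall x, in_Gamma_n (lam x).
Hypothesis eqF : forall i x, dom i x -> quotientF k (raise_index g W i x) = f x.

Let kn : (k <= n)%N. Proof. by move: hk; lia. Qed.

(** The regularity of f is read off the equation, F being a ratio of coefficients of the
    characteristic polynomial with nonvanishing denominator. *)
Lemma rhs_C2 : C_on 2 V (fun y => f (param i y)).
Proof.
have oV := chart_open.
pose B y := invmx (g i y) *m W i y.
have B2 a b : C_on 2 V (fun y => B y a b).
  apply: (C_on_eq oV (h := fun y => \sum_c invmx (g i y) a c * W i y c b)).
    by move=> y _; rewrite mxE.
  apply: (C_on_sum oV) => c _; apply: (C_onM oV); last exact: tensor_C2.
  by apply: (C_on_invmx oV); [exact: tensor_C2|exact: metric_unit].
have cp m : C_on 2 V (fun y => (char_poly (B y))`_m) by exact: C_on_char_poly.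
have spec y : V y -> is_spectrum (B y) (lam (param i y)).
  by move=> Vy; have [pd cy] := param_dom Vy; have := specW pd; rewrite /raise_index cy.
have cp0 y : V y -> (char_poly (B y))`_k != 0.
  move=> Vy; have := sigma_char_poly (leq_subr k n) (spec y Vy).
  rewrite subKn // => E0; apply/eqP => E1.
  have knk : (1 <= n - k <= n)%N by move: hk; lia.
  have : 0 < sigma (n - k) (lam (param i y)) by exact: gammaW.
  by rewrite E0 E1 mulr0 ltxx.
have C3 := C_onM oV (C_onZ oV ((-1) ^+ k) (cp 0%N)) (C_onV oV cp0 (cp k)).
apply: (C_on_eq oV) C3 => y Vy.
have [pd cy] := param_dom Vy.
by rewrite -(eqF pd) /raise_index cy (is_spectrum_conjP (spec y Vy) kn).
Qed.

Variable z : 'I_n.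
Hypothesis z0 : val z = 0%N.
Variable A : R.
Hypothesis A0 : 0 < A.
Hypothesis condW : condition_A g W A.
Hypothesis dE : frame_mx g i x E W = diag_mx (\row_j tnth (lam x) j).
Variable phi : M -> R.
Hypothesis phiT : C2_touches_above phi (fun y => ln (1 + tnth (lam y) z)) x.

Let l j := tnth (lam x) j.
Let w m a b := nabla_comp g i x E 1 (sym2_cov i W) [:: m; a; b].
Let w2 m a b := nabla_comp g i x E 2 (sym2_cov i W) [:: m; m; a; b].
Let p1 m := nabla_comp g i x E 1 (fun_cov i phi) [:: m].
Let p2 m := nabla_comp g i x E 2 (fun_cov i phi) [:: m; m].

Lemma spectrum_pos y j : 0 < tnth (lam y) j.
Proof. exact: Gamma_pos. Qed.

Lemma spectrum_top y j : tnth (lam y) j <= tnth (lam y) z.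
Proof.
have [q yq] := dom_cover y; have [srt _] := specW yq.
rewrite !(tnth_nth 0) z0; apply: (sorted_leq_nth ge_trans ge_refl 0 srt) => //.
- by rewrite inE size_tuple; exact: leq_ltn_trans (leq0n j) (ltn_ord j).
- by rewrite inE size_tuple.
Qed.

Lemma jet_touching m :
  jet (fun t => phi (param i (geod (g i) (coord i x) (frame_dir E m) t)))
    (ln (1 + l z)) (p1 m) (2^-1 * p2 m) /\
  \forall t \near (0 : R),
    ln (1 + tnth (lam (param i (geod (g i) (coord i x) (frame_dir E m) t))) z) <=
    phi (param i (geod (g i) (coord i x) (frame_dir E m) t)).
Proof.
have [U [oU Ux C2 phi_ge phix]] := phiT.
have oV := image_open oU.
have Vx' : (coord i @` (dom i `&` U)) (coord i x) by exists x.
split; first by have := jet_function E m oV (C2 i) Vx'; rewrite phix.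
have := geod_near (frame_dir E m) oV Vx'; apply: filterS => t Ut.
by have [_ Up] := param_image Ut; exact: phi_ge.
Qed.

(** The curve [N] is symmetric for all t, and coefficients of expansions are unique. *)
Lemma first_derivative_sym m a b : w m a b = w m b a.
Proof.
have [N [symN jN _]] := geodesic_restriction m.
have NT t : N t a b = (N t)^T a b by rewrite symN.
have [_ E1 _] := jet_uniq (jN a b) (jet_ext NT (mjetT jN a b)).
by move: E1; rewrite !mxE.
Qed.

Lemma derivative_mx_sym m :
  (\matrix_(a, b) nabla_comp g i x E 1 (sym2_cov i W) [:: m; a; b])^T =
  \matrix_(a, b) nabla_comp g i x E 1 (sym2_cov i W) [:: m; a; b].
Proof. by apply/matrixP => a b; rewrite !mxE; exact: first_derivative_sym. Qed.

Lemma diagonal_frame_estimate e : 0 < e -> e <= (2 * k%:R * n%:R)^-1 -> e <= 4^-1 ->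
  \sum_m gradF k l m * p2 m >=
    e * (\sum_m gradF k l m * p1 m ^+ 2) - error_const n A * (\sum_m gradF k l m)
    - nabla_comp g i x E 1 (fun_cov i f) [:: z] ^+ 2 / (f x * (1 + l z))
    - `|nabla_comp g i x E 2 (fun_cov i f) [:: z; z]| / (1 + l z).
Proof.
move=> e_gt0 e_le e_le4.
have l0 j : 0 < l j by exact: spectrum_pos.
have lz j : l j <= l z by exact: spectrum_top.
have fxE : f x = (Phi k l)^-1 by rewrite -(eqF xi) (quotientF_Phi kn (specW xi)).
have [condA1 condA2] := condW xi oE.
apply: (@final_algebra _ _ z l (gradF k l) (fun m => w2 m z z) (fun m => w2 z m m) p1 p2 w
  (norm_grad_comp g i x E W z) A (norm_sym2 g i x E W) _ _ _ (2 * k%:R * n%:R)^-1 e) => //.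
- by move=> j; exact: gradF_ge0.
- by rewrite fxE invr_gt0 Phi_gt0.
- exact: first_derivative_sym.
- by move=> m; exact: condA2.
- move=> m; apply: sqrtr_le_nneg; first by rewrite sumr_ge0.
  exact: sum_sqr_le.
- exact: sqrtr_ge0.
- apply: sqrtr_le_nneg; first by rewrite mulr_ge0 // ltW.
  rewrite dE (_ : \sum_a _ = \sum_a l a ^+ 2); last first.
    apply: eq_bigr => a _; rewrite (bigD1 a) //= big1 ?addr0; last first.
      by move=> b ba; rewrite !mxE eq_sym (negbTE ba) expr0n.
    by rewrite !mxE eqxx.
  apply: le_trans (sum_sqr_le _) _; rewrite ler_pXn2r ?nnegrE ?sumr_ge0 //; last first.
    by rewrite mulr_ge0 // ltW.
  apply: (@le_trans _ _ (\sum_(a < n) l z)); last by rewrite sumr_const card_ord mulr_natl.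
  by apply: ler_sum => a _; rewrite gtr0_norm.
- move=> m a b la lb; have [N [symN jN specN]] := geodesic_restriction m.
  have [jp ph] := jet_touching m; rewrite dE in jN.
  have := top_block_first_order symN jN specN (near0W (fun t => spectrum_pos _))
    (near0W (fun t => spectrum_top _)) l0 jp ph la lb (derivative_mx_sym m).
  by rewrite mxE.
- move=> m; have [N [symN jN specN]] := geodesic_restriction m.
  have [jp ph] := jet_touching m; rewrite dE in jN.
  have := top_second_order symN jN specN (near0W (fun t => spectrum_pos _))
    (near0W (fun t => spectrum_top _)) l0 jp ph.
  rewrite mx_scaleE mxE.
  under eq_bigr do rewrite mxE.
  rewrite -/(w2 m z z); set S := \sum_(p | _) _.
  have -> : 2 * ((1 + tnth (lam x) z) * (2^-1 * p2 m + p1 m ^+ 2 / 2)) =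
    (1 + l z) * (p2 m + p1 m ^+ 2) by rewrite -/(l z); field.
  by rewrite (mulrA 2 2^-1) divff // mul1r.
(* The equation is expanded in the top direction alone, which is why a single first and a single
   second derivative of f appear. *)
- have [N [symN jN specN]] := geodesic_restriction z; rewrite dE in jN.
  have jf := jet_function E z chart_open rhs_C2 Vx.
  have uF : \forall t \near (0 : R),
      f (param i (geod (g i) (coord i x) (frame_dir E z) t)) = quotientF k (N t).
    near=> t; have Vt : V (geod (g i) (coord i x) (frame_dir E z) t).
      by near: t; exact: geod_near chart_open Vx.
    have [pd _] := param_dom Vt; rewrite -(eqF pd) (quotientF_spectrum k (specW pd)).
    have sp : is_spectrum (N t) (lam (param i (geod (g i) (coord i x) (frame_dir E z) t))).
      by near: t.
    by rewrite (quotientF_spectrum k sp).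
  have := equation_second_order symN jN specN (near0W (fun t => spectrum_pos _)) l0 lz hk jf uF
    fxE (derivative_mx_sym z).
  rewrite mxE (mulrA 2 2^-1) divff // mul1r.
  under [X in 2 * X]eq_bigr do rewrite mx_scaleE mxE.
  under [X in _ - 2 * X]eq_bigr do rewrite mxE.
  have -> : 2 * (\sum_a gradF k l a * (2^-1 * w2 z a a)) = \sum_a gradF k l a * w2 z a a.
    by rewrite mulr_sumr; apply: eq_bigr => a _; field.
  by [].
Unshelve. all: end_near. Qed.

End Chart.

(** * From a diagonalising frame to an arbitrary orthonormal frame *)

Lemma unit_cauchy_schwarz (R : realDomainType) (I : finType) (u h : I -> R) :
  \sum_a u a ^+ 2 = 1 -> (\sum_a u a * h a) ^+ 2 <= \sum_a h a ^+ 2.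
Proof.
move=> u1; set s := \sum_a u a * h a.
have : 0 <= \sum_a (h a - s * u a) ^+ 2 by apply: sumr_ge0 => a _; exact: sqr_ge0.
have -> : \sum_a (h a - s * u a) ^+ 2 = \sum_a h a ^+ 2 - 2 * s * s + s ^+ 2 * \sum_a u a ^+ 2.
  transitivity (\sum_a (h a ^+ 2 - 2 * s * (u a * h a) + s ^+ 2 * u a ^+ 2)).
    by apply: eq_bigr => a _; ring.
  by rewrite big_split sumrB /= -!mulr_sumr.
rewrite u1 => H; lra.
Qed.

Section FrameChange.
Variables (R : realType) (n : nat) (M : manifold R n) (g : riemannian_metric M).
Variables (i : chart M) (x : M) (E P : 'M[R]_n).
Local Notation coord := Defs.coord.

Lemma frame_change1 (f : M -> R) m : nabla_comp g i x (E *m P) 1 (fun_cov i f) [:: m] =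
  \sum_a P a m * nabla_comp g i x E 1 (fun_cov i f) [:: a].
Proof.
rewrite nabla_comp1_fun; under [RHS]eq_bigr do rewrite nabla_comp1_fun mulr_sumr.
rewrite exchange_big /=; apply: eq_bigr => c _; rewrite mxE mulr_suml.
by apply: eq_bigr => a _; ring.
Qed.

Lemma frame_change2 (f : M -> R) m q : nabla_comp g i x (E *m P) 2 (fun_cov i f) [:: m; q] =
  \sum_a \sum_b P a m * P b q * nabla_comp g i x E 2 (fun_cov i f) [:: a; b].
Proof.
rewrite nabla_comp2_fun.
transitivity (\sum_c \sum_d \sum_a \sum_b P a m * P b q * (E c a * E d b *
   (partial c (partial d (fun y => f (param i y))) (coord i x)
    - \sum_e christoffel (g i) e c d (coord i x) * partial e (fun y => f (param i y)) (coord i x)))).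
  apply: eq_bigr => c _; apply: eq_bigr => d _; rewrite !mxE.
  rewrite mulr_suml mulr_suml; apply: eq_bigr => a _.
  rewrite mulr_sumr mulr_suml; apply: eq_bigr => b _; ring.
under eq_bigr do rewrite exchange_big /=.
rewrite exchange_big /=; apply: eq_bigr => a _.
under eq_bigr do rewrite exchange_big /=.
rewrite exchange_big /=; apply: eq_bigr => b _.
rewrite nabla_comp2_fun mulr_sumr; apply: eq_bigr => c _; rewrite mulr_sumr.
by [].
Qed.

Hypothesis oP : orthogonal_mx P.

Lemma frame_change_grad (f : M -> R) m :
  nabla_comp g i x (E *m P) 1 (fun_cov i f) [:: m] ^+ 2 <= norm_grad g i x E f ^+ 2.
Proof.
rewrite sqr_sqrtr; last by apply: sumr_ge0 => a _; exact: sqr_ge0.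
by rewrite frame_change1; apply: unit_cauchy_schwarz; exact: orthogonal_col_norm.
Qed.

(** The products P_am P_bm form a unit vector indexed by pairs (a, b), to which Cauchy-Schwarz
    applies. *)
Lemma frame_change_hess (f : M -> R) m :
  `|nabla_comp g i x (E *m P) 2 (fun_cov i f) [:: m; m]| <= norm_hess g i x E f.
Proof.
rewrite -sqrtr_sqr ler_wsqrtr // frame_change2 !pair_big /=.
apply: unit_cauchy_schwarz.
rewrite -(pair_big xpredT xpredT (fun a b => (P a m * P b m) ^+ 2)) /=.
under eq_bigr do under eq_bigr do rewrite exprMn.
under eq_bigr do rewrite -mulr_sumr orthogonal_col_norm // mulr1.
exact: orthogonal_col_norm.
Qed.

End FrameChange.

Lemma sum_spectral (R : comPzRingType) n (P : 'M[R]_n) (c : 'I_n -> R) (F X : 'I_n -> 'I_n -> R) :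
  (forall a b, F a b = \sum_m c m * (P a m * P b m)) ->
  \sum_a \sum_b F a b * X a b = \sum_m c m * \sum_a \sum_b P a m * P b m * X a b.
Proof.
move=> FE; under [RHS]eq_bigr do rewrite mulr_sumr.
rewrite [RHS]exchange_big; apply: eq_bigr => a _ /=.
under [RHS]eq_bigr do rewrite mulr_sumr.
rewrite [RHS]exchange_big; apply: eq_bigr => b _ /=.
by rewrite FE mulr_suml; apply: eq_bigr => m _; rewrite -[LHS]mulrA.
Qed.

Theorem proposition3p4 (R : realType) (n k : nat)
    (hn : (2 <= n)%N) (hk : (1 <= k <= n - 1)%N) :
  exists2 eps : R, 0 < eps &
  forall (M : manifold R n) (f : M -> R) (A : R), 0 < A ->
  exists C : R,
  forall (g : riemannian_metric M) (W : sym2_tensor M) (lam : M -> n.-tuple R),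
    (forall i x, dom i x -> is_spectrum (raise_index g W i x) (lam x)) ->
    (forall x, in_Gamma_n (lam x)) ->
    (forall i x, dom i x -> quotientF k (raise_index g W i x) = f x) ->
    condition_A g W A ->
  forall (x : M) (phi : M -> R),
    C2_touches_above phi (fun z => ln (1 + (lam z)`_0)) x ->
  forall (i : chart M) (E : 'M[R]_n), dom i x -> orthonormal_frame g i x E ->
    let F' := dF k (frame_mx g i x E W) in
    let phi1 a := nabla_comp g i x E 1 (fun_cov i phi) [:: a] in
    let phi2 a b := nabla_comp g i x E 2 (fun_cov i phi) [:: a; b] in
    let lam1 := (lam x)`_0 in
    \sum_(a < n) \sum_(b < n) F' a b * phi2 a b >=
      eps * (\sum_(a < n) \sum_(b < n) F' a b * phi1 a * phi1 b)
      - C * (\sum_(a < n) F' a a)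
      - norm_grad g i x E f ^+ 2 / (f x * (lam1 + 1))
      - norm_hess g i x E f / (lam1 + 1).
Proof.
have [n0 k0] : (0 < n)%N /\ (0 < k)%N by move: hn hk; lia.
have k1 : 1 <= k%:R :> R by rewrite ler1n.
have n1 : 1 <= n%:R :> R by rewrite ler1n.
have kn1 : 1 <= k%:R * n%:R :> R by nra.
(* At most 1/(2kn), the variance surplus, and at most 1/4 since kn >= 1. *)
exists (4 * (k%:R * n%:R))^-1; first by rewrite invr_gt0; lra.
(* The constant depends on n and A only; the dependence on f is carried by the gradient and Hessian
   terms. *)
move=> M f A A0; exists (error_const n A) => g W lam specW gammaW eqF condW x phi phiT i E xi oE.
pose F' := dF k (frame_mx g i x E W).
pose phi1 a := nabla_comp g i x E 1 (fun_cov i phi) [:: a].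
pose phi2 a b := nabla_comp g i x E 2 (fun_cov i phi) [:: a; b].
change (\sum_a \sum_b F' a b * phi2 a b >=
  (4 * (k%:R * n%:R))^-1 * (\sum_a \sum_b F' a b * phi1 a * phi1 b)
  - error_const n A * (\sum_a F' a a) - norm_grad g i x E f ^+ 2 / (f x * ((lam x)`_0 + 1))
  - norm_hess g i x E f / ((lam x)`_0 + 1)).
pose z : 'I_n := Ordinal n0.
have lamz y : (lam y)`_0 = tnth (lam y) z by rewrite (tnth_nth 0).
have Vx : (Defs.coord i @` dom i) (Defs.coord i x) by exists x.
have BE := frame_mxE g i x W E.
have Bsym : (frame_mx g i x E W)^T = frame_mx g i x E W.
  by rewrite BE; apply: trmx_conj; exact: tensor_sym Vx.
have specB : is_spectrum (frame_mx g i x E W) (lam x).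
  by apply: is_spectrum_conj (specW i x xi); rewrite BE (frame_char_poly W Vx oE).
have [P [oP BP]] := sym_spectral_decomposition Bsym specB.
have BD : frame_mx g i x E W = P *m diag_mx (\row_j tnth (lam x) j) *m P^T.
  apply/matrixP => a b; rewrite BP diag_conjE.
  by apply: eq_bigr => j _; rewrite mxE.
have oEP : orthonormal_frame g i x (E *m P).
  rewrite /orthonormal_frame trmx_mul.
  rewrite (_ : _ *m _ = P^T *m (E^T *m g i (Defs.coord i x) *m E) *m P); last first.
    by rewrite !mulmxA.
  by rewrite oE mulmx1.
have dEP : frame_mx g i x (E *m P) W = diag_mx (\row_j tnth (lam x) j).
  rewrite frame_mxE trmx_mul.
  have -> : P^T *m E^T *m W i (Defs.coord i x) *m (E *m P) = P^T *m frame_mx g i x E W *m P.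
    by rewrite BE !mulmxA.
  by rewrite BD !mulmxA oP mul1mx -mulmxA oP mulmx1.
have lam_gt0 j : 0 < tnth (lam x) j by exact: Gamma_pos.
have phiT' : C2_touches_above phi (fun y => ln (1 + tnth (lam y) z)) x.
  by have -> : (fun y => ln (1 + tnth (lam y) z)) = (fun y => ln (1 + (lam y)`_0))
    by apply/funext => y; rewrite lamz.
pose F := gradF k (tnth (lam x)).
have FE a b : F' a b = \sum_m F m * (P a m * P b m) by exact: dF_spectral.
(* The sums against F are frame-invariant, so the estimate in the frame E P transfers; only the
   single components of nabla f and nabla^2 f must still be bounded by norms. *)
have H := diagonal_frame_estimate xi specW oEP hk gammaW eqF (erefl : val z = 0%N) A0 condW dEP phiT'
  (e := (4 * (k%:R * n%:R))^-1).
have E2 : \sum_a \sum_b F' a b * phi2 a b =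
    \sum_m F m * nabla_comp g i x (E *m P) 2 (fun_cov i phi) [:: m; m].
  by rewrite (sum_spectral _ FE); apply: eq_bigr => m _; rewrite frame_change2.
have E1 : \sum_a \sum_b F' a b * phi1 a * phi1 b =
    \sum_m F m * nabla_comp g i x (E *m P) 1 (fun_cov i phi) [:: m] ^+ 2.
  transitivity (\sum_a \sum_b F' a b * (phi1 a * phi1 b)).
    by apply: eq_bigr => a _; apply: eq_bigr => b _; rewrite mulrA.
  rewrite (sum_spectral _ FE); apply: eq_bigr => m _; congr (_ * _).
  rewrite frame_change1 expr2 mulr_suml; apply: eq_bigr => a _; rewrite mulr_sumr.
  by apply: eq_bigr => b _; rewrite /phi1; ring.
have E0 : \sum_a F' a a = \sum_m F m.
  under eq_bigr do rewrite FE.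
  rewrite exchange_big; apply: eq_bigr => m _ /=; rewrite -mulr_sumr -[RHS]mulr1.
  by rewrite -(orthogonal_col_norm m oP).
rewrite E0 E1 E2 lamz (addrC (tnth _ _)).
have fx0 : 0 < f x by rewrite -(eqF i x xi) (quotientF_Phi _ (specW i x xi)) ?invr_gt0 ?Phi_gt0 //; lia.
have s0 : 0 < 1 + tnth (lam x) z by rewrite addr_gt0.
apply: le_trans (H _ _ _); last first.
- by rewrite lef_pV2 ?posrE; lra.
- by rewrite lef_pV2 ?posrE; lra.
- by rewrite invr_gt0; lra.
- have := frame_change_grad g i x E oP f z; have := frame_change_hess g i x E oP f z => Hh Hg.
  rewrite -!addrA lerD2l lerD2l; apply: lerD; rewrite lerN2.
    by apply: ler_wpM2r Hg; rewrite invr_ge0 mulr_ge0 ?ltW.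
  by apply: ler_wpM2r Hh; rewrite invr_ge0 ltW.
Qed.
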